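(* Let $\Sigma$ be a subset of $\mathbb N^*$ of cardinality $|\Sigma|<q$. There is a structure of left $K[\boldsymbol\tau]$-module on $\mathcal Z_\Sigma^{\mathrm{triv}}(K)$, given by $\boldsymbol\tau f=\tau_\Sigma(f)$, compatible with the grading by degrees $\binom{\Sigma}{n}$ (that is, $\boldsymbol\tau$ maps $\mathcal Z^{\mathrm{triv}}_{n,\Sigma}(K)$ into $\mathcal Z^{\mathrm{triv}}_{qn,\Sigma}(K)$). There is an isomorphism of $\mathcal Z_\emptyset(K)$-modules $\mathcal Z^{\mathrm{triv}}_\Sigma(K)\cong\bigotimes_{i\in\Sigma}\mathcal Z^{\mathrm{triv}}_{\{i\}}(K)$ (tensor product over $\mathcal Z_\emptyset(K)$). Moreover, for every $i\in\Sigma$, $\zeta_A\binom{\{i\}}{1}$ freely generates $\mathcal Z^{\mathrm{triv}}_{\{i\}}(K)$ with its left $K[\boldsymbol\tau]$-module structure and its right $\mathcal Z_\emptyset(K)$-module structure given by multiplication (the harmonic product): every element of $\mathcal Z^{\mathrm{triv}}_{\{i\}}(K)$ can be written in a unique way as a finite sum $\sum_{k\ge0}\left(\boldsymbol\tau^k\zeta_A\binom{\{i\}}{1}\right)g_k$ with $g_k\in\mathcal Z_\emptyset(K)$.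
   Context: Notation. $p$ is a prime, $q=p^e$; $\mathbb N=\mathbb Z_{\ge0}$, $\mathbb N^*=\mathbb Z_{>0}$; $A=\mathbb F_q[\theta]$, $K=\mathbb F_q(\theta)$, $\mathbb C_\infty$ is the completion of an algebraic closure of $\mathbb F_q((1/\theta))$; $A^+$ is the set of monic polynomials of $A$. For $a\in A$, $a(t)\in\mathbb F_q[t]$ is obtained by replacing $\theta$ by $t$. $K[\boldsymbol\tau]$ is the skew polynomial ring with $\boldsymbol\tau c=c^q\boldsymbol\tau$ for $c\in K$. $\mathfrak S$ is the set of maps $\Sigma:\mathbb N^*\to\mathbb N$ with finite support, with product $(\Sigma\cdot\Sigma')(x)=\Sigma(x)+\Sigma'(x)$ and neutral element $\emptyset$ (the zero map); finite subsets of $\mathbb N^*$ are identified with their characteristic functions. An admissible composition array of $\binom{\Sigma}{n}$ is a matrix $\mathcal C=\begin{pmatrix}\Sigma_1&\cdots&\Sigma_r\\ n_1&\cdots&n_r\end{pmatrix}$ with $r\ge1$, $\Sigma_i\in\mathfrak S$, $n_i\in\mathbb N^*$, $\Sigma_1\cdots\Sigma_r=\Sigma$, $\sum n_i=n$; in addition $\binom{\emptyset}{0}$ is admissible. $\zeta_A(\mathcal C)=\sum_{a_1,\dots,a_r\in A^+,\ |a_1|>\cdots>|a_r|}\frac{\chi_{\Sigma_1}(a_1)\cdots\chi_{\Sigma_r}(a_r)}{a_1^{n_1}\cdots a_r^{n_r}}$ with $\chi_\Sigma(a)=\prod_i a(t_i)^{\Sigma(i)}$, $\zeta_A\binom{\emptyset}{0}=1$;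 these are entire functions of the variables $t_i$, $i\in\Sigma$. $\mathcal Z_{n,\Sigma}(K)$ is the $K$-span of the $\zeta_A(\mathcal C)$ with $\mathcal C$ admissible of $\binom{\Sigma}{n}$; $\mathcal Z_\emptyset(K)=\sum_n\mathcal Z_{n,\emptyset}(K)$ is the $K$-algebra of Thakur's multiple zeta values (graded by $n$). For a finite subset $\Sigma\subset\mathbb N^*$: $\mathcal Z^{\mathrm{triv}}_{n,\Sigma}(K)$ is the set of $f\in\mathcal Z_{n,\Sigma}(K)$ such that $f(\underline\theta^{q^{\underline i}})=0$ for all but finitely many $\underline i=(i_j)_{j\in\Sigma}\in\mathbb N^\Sigma$, where $\underline\theta^{q^{\underline i}}=(\theta^{q^{i_j}})_{j\in\Sigma}$ (i.e. $t_j=\theta^{q^{i_j}}$); $\mathcal Z^{\mathrm{triv}}_\Sigma(K)=\bigoplus_n\mathcal Z^{\mathrm{triv}}_{n,\Sigma}(K)$, a $\mathcal Z_\emptyset(K)$-module by multiplication. $\tau$ acts on entire functions in the $t_j$ as the $\mathbb F_q[t_j:j\in\Sigma]$-linear operator raising the coefficients (in $\mathbb C_\infty$) to the $q$-th power, and $\tau_\Sigma(f)=\prod_{j\in\Sigma}(t_j-\theta)\,\tau(f)$. *)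

(* Defs.v *)
From HB Require Import structures.
From mathcomp Require Import all_boot all_order all_algebra all_field.
From mathcomp Require Import finmap.
From mathcomp Require Import all_classical all_reals all_analysis.

Set Implicit Arguments.
Unset Strict Implicit.
Unset Printing Implicit Defensive.

Import Order.TTheory GRing.Theory Num.Theory.
Import numFieldNormedType.Exports.

Local Open Scope classical_set_scope.
Local Open Scope ring_scope.

(* The skew polynomial ring K[tau], tau c = s(c) tau: the polynomial
   \sum_i a_i 'X^i stands for \sum_i a_i tau^i, coefficients on the left. *)
Definition skewpoly (K : fieldType) (s : {rmorphism K -> K}) : Type :=
  {poly K}.

Section SkewPoly.
Variables (K : fieldType) (s : {rmorphism K -> K}).

HB.instance Definition _ := GRing.Zmodule.on (skewpoly s).

Definition skewC (c : K) : skewpoly s := c%:P.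
Definition skewX : skewpoly s := 'X.

Definition skew_iter i : K -> K := iter i s.

Definition skew_mul (p r : skewpoly s) : skewpoly s :=
  \sum_(i < size (p : {poly K}))
    (p : {poly K})`_i *: (map_poly (skew_iter i) (r : {poly K}) * 'X^i).

Fact skew_iter_is_zmod_morphism i : zmod_morphism (skew_iter i).
Proof.
move=> x y; rewrite /skew_iter.
by elim: i => // i IHi; rewrite !iterS IHi rmorphB.
Qed.

Fact skew_iter_is_monoid_morphism i : monoid_morphism (skew_iter i).
Proof.
rewrite /skew_iter; elim: i => // i [IH1 IHM].
by split=> [|x y]; rewrite !iterS ?IH1 ?rmorph1 ?IHM ?rmorphM.
Qed.

HB.instance Definition _ i := GRing.isZmodMorphism.Build K K (skew_iter i)
  (skew_iter_is_zmod_morphism i).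
HB.instance Definition _ i := GRing.isMonoidMorphism.Build K K (skew_iter i)
  (skew_iter_is_monoid_morphism i).

Lemma skew_mulE n (p r : {poly K}) : (size p <= n)%N ->
  skew_mul p r = \sum_(i < n) p`_i *: (map_poly (skew_iter i) r * 'X^i).
Proof.
move=> le_p; rewrite /skew_mul (big_ord_widen n (fun i =>
  p`_i *: (map_poly (skew_iter i) r * 'X^i)) le_p) big_mkcond.
apply: eq_bigr => i _; case: ltnP => // h.
by rewrite nth_default // scale0r.
Qed.

Fact skew_mulDl : left_distributive skew_mul +%R.
Proof.
move=> p1 p2 r; pose n := maxn (size (p1 : {poly K})) (size (p2 : {poly K})).
rewrite (@skew_mulE n (_ + _)) ?size_polyD //.
rewrite (@skew_mulE n p1) ?leq_maxl // (@skew_mulE n p2) ?leq_maxr //.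
by rewrite -big_split; apply: eq_bigr => i _ /=; rewrite coefD scalerDl.
Qed.

Fact skew_mulDr : right_distributive skew_mul +%R.
Proof.
move=> p r1 r2; rewrite /skew_mul -big_split; apply: eq_bigr => i _ /=.
by rewrite [map_poly _ _]rmorphD mulrDl scalerDr.
Qed.

Lemma skew_mul_mono a i (r : {poly K}) :
  skew_mul (a *: 'X^i) r = a *: (map_poly (skew_iter i) r * 'X^i).
Proof.
rewrite (@skew_mulE i.+1); last first.
  by rewrite (leq_trans (size_scale_leq _ _)) // size_polyXn.
rewrite big_ord_recr /= coefZ coefXn eqxx mulr1 big1 ?add0r // => j _.
by rewrite coefZ coefXn ltn_eqF // mulr0 scale0r.
Qed.

Lemma skew_mul0r (r : skewpoly s) : skew_mul 0 r = 0.
Proof. by rewrite /skew_mul size_poly0 big_ord0. Qed.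

Lemma skew_mulr0 (r : skewpoly s) : skew_mul r 0 = 0.
Proof.
by rewrite /skew_mul big1 // => i _; rewrite [map_poly _ _]rmorph0 mul0r scaler0.
Qed.

Lemma skew_ind (P : skewpoly s -> Prop) : P 0 ->
  (forall p r, P p -> P r -> P (p + r)) ->
  (forall a i, P (a *: 'X^i : {poly K})) -> forall p, P p.
Proof.
move=> P0 PD PX p; rewrite -[p]coefK poly_def.
by elim/big_ind: _ => // i _; apply: PX.
Qed.

Fact skew_mulA : associative skew_mul.
Proof.
move=> p q r; elim/skew_ind: p => [|p1 p2 IH1 IH2|a i].
- by rewrite !skew_mul0r.
- by rewrite !skew_mulDl IH1 IH2.
elim/skew_ind: q => [|p1 p2 IH1 IH2|b j].
- by rewrite skew_mul0r skew_mulr0 skew_mul0r.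
- by rewrite skew_mulDl !skew_mulDr skew_mulDl IH1 IH2.
rewrite !skew_mul_mono !map_polyZ map_polyXn rmorphM /= map_polyXn.
rewrite -!scalerAl -!mulrA -!exprD !scalerA skew_mul_mono addnC.
rewrite -map_poly_comp (@eq_map_poly _ _ _ (skew_iter (i + j))) // => x.
by rewrite /= /skew_iter iterD.
Qed.

Fact skew_mul1r : left_id (1%:P : skewpoly s) skew_mul.
Proof.
move=> r; have -> : (1%:P : {poly K}) = 1 *: 'X^0 by rewrite scale1r expr0.
by rewrite skew_mul_mono scale1r expr0 mulr1 map_poly_id.
Qed.

Fact skew_mulr1 : right_id (1%:P : skewpoly s) skew_mul.
Proof.
move=> p; rewrite -[RHS](coefK p) poly_def /skew_mul; apply: eq_bigr => i _.
by rewrite [map_poly _ _]rmorph1 mul1r.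
Qed.

Fact skew_oner_neq0 : (1%:P : skewpoly s) != 0.
Proof. exact: (oner_neq0 {poly K}). Qed.

HB.instance Definition _ := GRing.Zmodule_isNzRing.Build (skewpoly s)
  skew_mulA skew_mul1r skew_mulr1 skew_mulDl skew_mulDr skew_oner_neq0.

End SkewPoly.

Section QFrobenius.
Variables (F : finFieldType).

Definition qfrob (x : {fraction {poly F}}) : {fraction {poly F}} := x ^+ #|F|.

Fact qfrob_pchar : [pchar {fraction {poly F}}].-nat #|F|.
Proof.
have [p p_pr pF] := finPcharP F.
have pK : p \in [pchar {fraction {poly F}}].
  have := rmorph_pchar (tofrac (R := {poly F}) : {rmorphism _ -> _}).
  by apply; apply: (rmorph_pchar (polyC : {rmorphism F -> {poly F}})).
rewrite (eq_pnat _ (pcharf_eq pK)).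
have [n _ ->] : exists2 n, True & #|F| = (p ^ n)%N.
  by exists (logn p #|pPrimeCharType pF|) => //; exact: (card_pprimeChar pF).
by rewrite pnatX pnat_id.
Qed.

Fact qfrob_is_zmod_morphism : zmod_morphism qfrob.
Proof. 
move=> x y; rewrite /qfrob exprDn_pchar ?qfrob_pchar //; congr (_ + _).
have := exprDn_pchar y (- y) qfrob_pchar.
rewrite subrr expr0n (gtn_eqF (ltnW (finNzRing_gt1 F))) /=.
by move/esym/eqP; rewrite addrC addr_eq0 => /eqP.
Qed.

Fact qfrob_is_monoid_morphism : monoid_morphism qfrob.
Proof. by split=> [|x y]; rewrite /qfrob ?expr1n ?exprMn. Qed.

HB.instance Definition _ := GRing.isZmodMorphism.Build _ _ qfrob
  qfrob_is_zmod_morphism.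
HB.instance Definition _ := GRing.isMonoidMorphism.Build _ _ qfrob
  qfrob_is_monoid_morphism.

Definition Ktau : nzRingType := skewpoly qfrob.

End QFrobenius.

(* A completion of an algebraic closure of the completion of F_q(theta) at the
   place 1/theta, as an extension of F_q(theta); the absolute value is
   normalized by |theta| = q. *)
Record Cinfty (R : realType) (F : finFieldType) := CInfty {
  Cfield :> fieldType;
  Cemb : {rmorphism {fraction {poly F}} -> Cfield};
  Cabs : Cfield -> R;
  Ctheta : Cfield := Cemb (tofrac 'X);
  Ccvg : (nat -> Cfield) -> Cfield -> Prop := fun u l =>
    (fun n => Cabs (u n - l)) @ \oo --> (0 : R);
  Claurent : set Cfield := [set x | exists (N : nat) (c : nat -> F),
    Ccvg (fun n => \sum_(i < n) Cemb (tofrac (c i)%:P) * Ctheta ^+ N / Ctheta ^+ i) x];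
  (* the elements that are algebraic over F_q((1/theta)) *)
  Calg : set Cfield := [set x | exists p : {poly Cfield},
    [/\ p != 0, forall i, Claurent p`_i & root p x]];
  Cabs_ge0 : forall x, 0 <= Cabs x;
  Cabs_eq0 : forall x, Cabs x = 0 -> x = 0;
  Cabs0 : Cabs 0 = 0;
  CabsM : forall x y, Cabs (x * y) = Cabs x * Cabs y;
  CabsD : forall x y, Cabs (x + y) <= Num.max (Cabs x) (Cabs y);
  Cabs_theta : Cabs Ctheta = #|F|%:R;
  Calg_closed : forall p : {poly Cfield},
    (forall i, Calg p`_i) -> (1 < size p)%N -> exists2 x, Calg x & root p x;
  Calg_dense : forall x (e : R), 0 < e -> exists2 y, Calg y & Cabs (x - y) < e;
  Ccomplete : forall u : nat -> Cfield,
    (forall e : R, 0 < e -> exists N : nat, forall m n : nat,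
      (N <= m)%N -> (N <= n)%N -> Cabs (u m - u n) < e) ->
    exists l, Ccvg u l
}.

Notation posnat := {i : nat | (0 < i)%N}.

Notation compmap := {fsfun posnat -> nat with 0%N}.

Definition charmap (Sigma : {fset posnat}) : compmap :=
  [fsfun j in Sigma => 1%N].

(* [:: (Sigma_1, n_1); ...; (Sigma_r, n_r)] *)
Definition comp_array : Type := seq (compmap * nat).

(* The empty array (r = 0) is the array written (emptyset, 0); it is admissible
   exactly for sigma = emptyset and n = 0. *)
Definition admissible (sigma : compmap) (n : nat) (c : comp_array) : Prop :=
  [/\ all (fun col => (0 < col.2)%N) c,
      forall j, (\sum_(col <- c) col.1 j)%N = sigma j
    & (\sum_(col <- c) col.2)%N = n].

Section Zeta.
Variables (R : realType) (F : finFieldType) (C : Cinfty R F).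

(* Functions of the variables (t_j), j >= 1. *)
Definition tfun : Type := (posnat -> C) -> C.

HB.instance Definition _ := GRing.ComPzRing.on tfun.

(* Junk value 0 if u diverges. *)
Definition Clim (u : nat -> C) : C := xget 0 [set l | Ccvg u l].

Definition embA (a : {poly F}) : C := Cemb C (tofrac a).

Definition chi (sigma : compmap) (a : {poly F}) : tfun := fun t =>
  \prod_(j <- finsupp sigma)
    (map_poly (fun x : F => embA x%:P) a).[t j] ^+ sigma j.

(* Limit over N of the finite sums over the monic a_1, ..., a_r with
   q^N > |a_1| > ... > |a_r|. *)
Definition zetaA (c : comp_array) : tfun := fun t =>
  Clim (fun N => \sum_(a : (size c).-tuple {poly_N F} |
      all (fun p : {poly_N F} => polyn p \is monic) a
      && sorted (fun p r : {poly_N F} => (size r < size p)%N) a)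
    \prod_(i < size c)
      (chi (tnth (in_tuple c) i).1 (tnth a i) t
       / embA (tnth a i) ^+ (tnth (in_tuple c) i).2)).

Definition Zn (Sigma : {fset posnat}) (n : nat) : set tfun :=
  [set f | exists (r : nat) (k : 'I_r -> {fraction {poly F}})
      (c : 'I_r -> comp_array),
    (forall i, admissible (charmap Sigma) n (c i)) /\
    f = \sum_(i < r) (cst (Cemb C (k i)) : tfun) * zetaA (c i)].

Definition graded_sum (V : nat -> set tfun) : set tfun :=
  [set f | exists (N : nat) (g : nat -> tfun),
    (forall n, V n (g n)) /\ f = \sum_(n < N) g n].

(* Z_emptyset(K), the multiple zeta values being seen as constant functions. *)
Definition Zempty : set tfun := graded_sum (Zn fset0).

(* t_j = theta^(q^(i_j)) for j in Sigma; the other variables do not matter. *)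
Definition theta_pt (Sigma : {fset posnat}) (i : Sigma -> nat) : posnat -> C :=
  fun j => if insub j is Some j' then Ctheta C ^+ (#|F| ^ i j') else 0.

Definition Ztriv_n (Sigma : {fset posnat}) (n : nat) : set tfun :=
  [set f | Zn Sigma n f /\
    finite_set [set i : Sigma -> nat | f (theta_pt i) <> 0]].

Definition Ztriv (Sigma : {fset posnat}) : set tfun :=
  graded_sum (Ztriv_n Sigma).

Section Entire.
Variable Sigma : {fset posnat}.

Definition entire_coef (a : (Sigma -> nat) -> C) : Prop :=
  forall r e : R, 0 < r -> 0 < e ->
    finite_set [set m | e <= Cabs (a m) * r ^+ (\sum_(j : Sigma) m j)%N].

Definition entire_eval (a : (Sigma -> nat) -> C) : tfun := fun t =>
  Clim (fun N => \sum_(m : {ffun Sigma -> 'I_N})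
    a (fun j => m j) * \prod_(j : Sigma) t (val j) ^+ m j).

(* The coefficients of an entire function are determined by the function, since
   C is infinite; junk value 0 if f is not entire in the (t_j), j in Sigma. *)
Definition coefs (f : tfun) : (Sigma -> nat) -> C :=
  xget (fun=> 0) [set a | entire_coef a /\ f = entire_eval a].

Definition tau (f : tfun) : tfun :=
  entire_eval (fun m => coefs f m ^+ #|F|).

Definition tauS (f : tfun) : tfun :=
  (\prod_(j : Sigma) ((fun t => t (val j) - Ctheta C) : tfun)) * tau f.

End Entire.

End Zeta.

Arguments zetaA {R F} C c _.
Arguments Zn {R F} C Sigma n _.
Arguments Zempty {R F} C _.
Arguments Ztriv_n {R F} C Sigma n _.
Arguments Ztriv {R F} C Sigma _.

Section Subring.
Variable E : comPzRingType.

Definition is_subring (S : set E) : Prop :=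
  [/\ S 1, forall x y, S x -> S y -> S (x - y)
    & forall x y, S x -> S y -> S (x * y)].

Definition submod_over (S M : set E) : Prop :=
  M 0 /\ forall r x y, S r -> M x -> M y -> M (r * x + y).

Variables (S : set E) (SE : is_subring S).

Definition subring_pred of is_subring S : E -> bool := fun x => x \in S.

Fact subring_pred_closed : GRing.subring_closed (subring_pred SE).
Proof.
have [S1 SB SM] := SE.
by split=> [|x y /set_mem ? /set_mem ?|x y /set_mem ? /set_mem ?];
  apply/mem_set; [|apply: SB|apply: SM].
Qed.

HB.instance Definition _ := GRing.isSubringClosed.Build E (subring_pred SE) subring_pred_closed.

Record subring : Type := Subring {
  subring_val : E;
  _ : subring_val \in subring_pred SE }.

HB.instance Definition _ := [isSub for subring_val].
HB.instance Definition _ := [Choice of subring by <:].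
HB.instance Definition _ :=
  GRing.SubChoice_isSubComPzRing.Build E (subring_pred SE) subring
    subring_pred_closed.

Variables (M : set E) (SM : submod_over S M).

Definition submod_pred of is_subring S & submod_over S M : E -> bool :=
  fun x => x \in M.

Fact submod_pred_zmod : zmod_closed (submod_pred SE SM).
Proof.
have [M0 MD] := SM; have [S1 SB _] := SE.
have S0 : S 0 by rewrite -(subrr 1); apply: SB.
have SN1 : S (-1) by rewrite -(sub0r 1); apply: SB.
split=> [|x y /set_mem Mx /set_mem My]; apply/mem_set => //.
rewrite addrC -mulN1r; exact: MD.
Qed.

HB.instance Definition _ :=
  GRing.isZmodClosed.Build E (submod_pred SE SM) submod_pred_zmod.

Record submod : Type := Submod {
  submod_val : E;
  _ : submod_val \in submod_pred SE SM }.

HB.instance Definition _ := [isSub for submod_val].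
HB.instance Definition _ := [Choice of submod by <:].
HB.instance Definition _ := [SubChoice_isSubZmodule of submod by <:].

Fact submod_scale_subproof (r : subring) (x : submod) :
  val r * val x \in submod_pred SE SM.
Proof.
have [M0 MD] := SM; apply/mem_set; rewrite -[_ * _]addr0.
by apply: MD => //; apply/set_mem; [exact: (valP r) | exact: (valP x)].
Qed.

Definition submod_scale (r : subring) (x : submod) : submod :=
  Submod (submod_scale_subproof r x).

Fact submod_scaleA a b v :
  submod_scale a (submod_scale b v) = submod_scale (a * b) v.
Proof. by apply: val_inj; rewrite /= mulrA. Qed.

Fact submod_scale1 : left_id 1 submod_scale.
Proof. by move=> v; apply: val_inj; rewrite /= mul1r. Qed.

Fact submod_scaleDr : right_distributive submod_scale +%R.
Proof. by move=> a u v; apply: val_inj; rewrite /= mulrDr. Qed.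

Fact submod_scaleDl v : {morph submod_scale^~ v : a b / a + b}.
Proof. by move=> a b; apply: val_inj; rewrite /= mulrDl. Qed.

HB.instance Definition _ := GRing.Zmodule_isLmodule.Build subring submod
  submod_scaleA submod_scale1 submod_scaleDr submod_scaleDl.

End Subring.

Section Tensor.
Variables (R : comPzRingType) (I : finType) (M : I -> lmodType R).

Definition multilinear (T : lmodType R) (phi : (forall i, M i) -> T) : Prop :=
  forall (x : forall i, M i) (i : I) (a : R) (u v : M i),
    phi (dfwith x i (a *: u + v)) = a *: phi (dfwith x i u) + phi (dfwith x i v).

Definition is_tensor_product (T : lmodType R) (phi : (forall i, M i) -> T) :
    Prop :=
  multilinear phi /\
  forall (V : lmodType R) (psi : (forall i, M i) -> V), multilinear psi ->
    exists2 h : {linear T -> V}, (forall x, h (phi x) = psi x)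
      & forall h' : {linear T -> V}, (forall x, h' (phi x) = psi x) -> h' =1 h.

End Tensor.

Definition is_module_action (R : pzRingType) (V : zmodType) (act : R -> V -> V) :
    Prop :=
  [/\ forall a b v, act a (act b v) = act (a * b) v, left_id 1 act,
      right_distributive act +%R & forall v, {morph act^~ v : a b / a + b}].

Section Modules.
Variables (R : realType) (F : finFieldType) (C : Cinfty R F).
Hypothesis HZ : is_subring (Zempty C).

Definition Zempty_ring : comPzRingType := subring HZ.

Variable Sigma : {fset posnat}.
Hypothesis HM : submod_over (Zempty C) (Ztriv C Sigma).

Definition Ztriv_mod : lmodType Zempty_ring := submod HZ HM.

Definition Ztriv_val (f : Ztriv_mod) : tfun C := submod_val f.

(* act is the left K[tau]-module structure for which K acts by multiplication
   and tau acts as tau_Sigma. *)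
Definition is_Ktau_structure (act : Ktau F -> Ztriv_mod -> Ztriv_mod) : Prop :=
  [/\ is_module_action act,
      forall k f, Ztriv_val (act (skewC _ k) f)
                  = (cst (Cemb C k) : tfun C) * Ztriv_val f
    & forall f, Ztriv_val (act (skewX _) f) = tauS Sigma (Ztriv_val f)].

End Modules.

(* Main.v *)
Require Import Defs.
From HB Require Import structures.
From mathcomp Require Import all_boot all_order all_algebra all_field.
From mathcomp Require Import finmap.
From mathcomp Require Import all_classical all_reals all_analysis.
From mathcomp Require Import ring lra zify.

Set Implicit Arguments.
Unset Strict Implicit.
Unset Printing Implicit Defensive.

Import Order.TTheory GRing.Theory Num.Theory.
Import numFieldNormedType.Exports.

Local Open Scope fset_scope.
Local Open Scope ring_scope.

(** The proof expands everything in the Newton basis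
    b_m(t) = prod_(i < m) (t - theta^(q^i)) attached to the points theta^(q^i).

    Expansion. The F_q-linear Carlitz polynomials E_m satisfy
    a(t) = sum_m E_m(a) b_m(t) for every a in A ([carlitz_newton]). On the monic
    polynomials of degree d, E_d is constant, while its derivative is the constant
    1/ell_d. Lagrange interpolation at these polynomials therefore computes the
    sums of P(a)/a^n, for a polynomial P of degree less than q^d, by recursion on
    n ([poly_powsum_rec]). The hypothesis |Sigma| < q enters here: the Newton
    polynomial of one variable has degree at most q^(d-1), so that the product of
    |Sigma| of them is short enough. The recursion bounds the Newton coefficients
    of a power sum in degree d by 1/|ell_d|, and a multiple zeta value is the sum
    of a convergent Newton series ([zetaA_newton_series]). As b_m vanishes at
    theta^(q^i) for i < m, such a series is determined by its values at the points
    theta_pt ([newton_series_uniq]).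

    Harmonic product. Partial fractions in a, b and a - b turn a product of two
    power sums into a combination of truncated multiple sums with the same total
    weight ([mixed_sum_span], [powsumM]), hence truncated multiple sums form a
    graded algebra ([WspanM]), and so do multiple zeta values.

    The operator tau. If w(d) is a truncated multiple sum of weight n, then
    prod_j (t_j - theta) tau(w(d)) is a truncated multiple sum of weight qn,
    truncated at d + 1 ([Wspan_tau_stable]). This follows by strong induction on n
    from the recursion above; the seed is the identity
    ell_(d+1) / ell_d^q = ell_1 sum_(e <= d) S_e(q-1), with S_e(n) the sum of the
    a^(-n) over monic a of degree e ([sum_powsum_q1]).

    Trivial multiple zeta values. The value of the one-variable zeta at weight 1 is
    1 at theta and 0 at theta^(q^i) for i > 0. Each application of tau moves this
    point one step, so that psi_k = tau^k zeta is D_k at theta^(q^k) and 0 at the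
    other points ([psi_val]). Products of the psi_k / D_k over the variables form a
    family dual to the points theta_pt, and by uniqueness of Newton series a
    trivial f is the finite sum of its values at these points times the dual
    elements ([dual_decomposition]). The values are multiple zeta values
    ([Zn_val]): at such a point chi(a) is a power of a, and the power sums of
    nonpositive weight vanish in large degree ([sum_monic_eq0]).

    Hence the trivial multiple zeta values form a free module over the algebra of
    multiple zeta values, with basis the products of the psi_k, and everything
    follows: for one variable this is the freeness statement ([psi_basis]); for
    several, multiplication of functions is a tensor product
    ([tensor_map_is_tensor_product]). Finally a trivial f is entire, being a
    combination of products of entire functions of one variable
    ([Ztriv_entire]), so that tau f is the Frobenius twist of f, and the support of
    tau_Sigma f on the points theta_pt is the translate of that of f
    ([Ztriv_n_tau]). *)

(** * Carlitz polynomials *)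
Section Carlitz.
Variables (F : finFieldType) (L : fieldType) (io : {rmorphism {poly F} -> L}).
Hypothesis io_inj : injective io.

Notation q := #|F|.

Lemma q_gt1 : (1 < q)%N. Proof. exact: finNzRing_gt1. Qed.
Lemma q_gt0 : (0 < q)%N. Proof. exact: ltnW q_gt1. Qed.
Hint Resolve q_gt0 q_gt1 : core.
Lemma qX_gt0 k : (0 < q ^ k)%N. Proof. by rewrite expn_gt0 q_gt0. Qed.
Hint Resolve qX_gt0 : core.

Lemma q_pchar : [pchar L].-nat q.
Proof.
have [p p_pr pF] := finPcharP F.
have pL : p \in [pchar L].
  by apply: (rmorph_pchar io); apply: (rmorph_pchar (polyC : {rmorphism F -> {poly F}})).
rewrite (eq_pnat _ (pcharf_eq pL)).
have [n _ ->] : exists2 n, True & q = (p ^ n)%N.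
  by exists (logn p #|pPrimeCharType pF|) => //; exact: (card_pprimeChar pF).
by rewrite pnatX pnat_id.
Qed.

Lemma qX_pchar k : [pchar L].-nat (q ^ k)%N.
Proof. by rewrite pnatX q_pchar. Qed.

Lemma frobD k (x y : L) : (x + y) ^+ (q ^ k) = x ^+ (q ^ k) + y ^+ (q ^ k).
Proof. by rewrite exprDn_pchar // qX_pchar. Qed.

Lemma frob0 k : 0 ^+ (q ^ k) = 0 :> L.
Proof. by rewrite expr0n (gtn_eqF (qX_gt0 k)). Qed.

Lemma frobN k (x : L) : (- x) ^+ (q ^ k) = - x ^+ (q ^ k).
Proof. by apply/eqP; rewrite -addr_eq0 -frobD addNr frob0. Qed.

Lemma frobB k (x y : L) : (x - y) ^+ (q ^ k) = x ^+ (q ^ k) - y ^+ (q ^ k).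
Proof. by rewrite frobD frobN. Qed.

Lemma frob_sum k I (r : seq I) (P : pred I) (f : I -> L) :
  (\sum_(i <- r | P i) f i) ^+ (q ^ k) = \sum_(i <- r | P i) f i ^+ (q ^ k).
Proof. exact: (big_morph _ (frobD k) (frob0 k)). Qed.

Lemma frobE (x : L) : x ^+ q = x ^+ (q ^ 1).
Proof. by rewrite expn1. Qed.

Lemma frobS k (x : L) : x ^+ (q ^ k.+1) = (x ^+ (q ^ k)) ^+ q.
Proof. by rewrite -exprM expnSr. Qed.

Lemma frobX i k (x : L) : (x ^+ (q ^ i)) ^+ (q ^ k) = x ^+ (q ^ (i + k)).
Proof. by rewrite -exprM expnD. Qed.

Lemma q_natr0 : q%:R = 0 :> L.
Proof.
have pL : pdiv q \in [pchar L].
  by rewrite -pnatE ?pdiv_prime ?(pnat_dvd (pdiv_dvd q)) ?q_pchar.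
by apply/eqP; rewrite -(dvdn_pcharf pL) pdiv_dvd.
Qed.

Definition theta_img : L := io 'X.
Definition emb_cst (c : F) : L := io c%:P.
Definition peval (a : {poly F}) (t : L) : L := (map_poly emb_cst a).[t].

Lemma cst_frob c k : emb_cst c ^+ (q ^ k) = emb_cst c.
Proof.
rewrite /emb_cst; elim: k => [|k IHk]; rewrite ?expr1 // frobS IHk.
by rewrite -rmorphXn -polyC_exp expf_card.
Qed.

Fact cst_zmod : zmod_morphism emb_cst.
Proof. by move=> x y; rewrite /emb_cst !rmorphB. Qed.
Fact cst_mon : monoid_morphism emb_cst.
Proof. by split=> [|x y]; rewrite /emb_cst ?rmorph1 // !rmorphM. Qed.
HB.instance Definition _ := GRing.isZmodMorphism.Build F L emb_cst cst_zmod.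
HB.instance Definition _ := GRing.isMonoidMorphism.Build F L emb_cst cst_mon.

Lemma pevalD a b t : peval (a + b) t = peval a t + peval b t.
Proof. by rewrite /peval rmorphD hornerD. Qed.
Lemma pevalB a b t : peval (a - b) t = peval a t - peval b t.
Proof. by rewrite /peval rmorphB hornerD hornerN. Qed.
Lemma pevalM a b t : peval (a * b) t = peval a t * peval b t.
Proof. by rewrite /peval rmorphM hornerM. Qed.
Lemma pevalX t : peval 'X t = t.
Proof. by rewrite /peval map_polyX hornerX. Qed.
Lemma pevalC c t : peval c%:P t = emb_cst c.
Proof. by rewrite /peval map_polyC hornerC. Qed.
Lemma peval_theta a : peval a theta_img = io a.
Proof.
elim/poly_ind: a => [|a c IH]; first by rewrite /peval !rmorph0 horner0.
by rewrite pevalD pevalM pevalX pevalC IH rmorphD rmorphM.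
Qed.

Lemma peval_frob a t k : peval a (t ^+ (q ^ k)) = peval a t ^+ (q ^ k).
Proof.
elim/poly_ind: a => [|a c IH]; first by rewrite /peval !rmorph0 !horner0 frob0.
by rewrite !pevalD !pevalM !pevalX !pevalC frobD exprMn cst_frob IH.
Qed.

Lemma io_eq0 a : (io a == 0) = (a == 0).
Proof. by rewrite -(inj_eq io_inj) rmorph0. Qed.

Lemma theta_frob_neq i : theta_img - theta_img ^+ (q ^ i.+1) != 0.
Proof.
rewrite /theta_img -rmorphXn -rmorphB io_eq0 subr_eq0; apply/eqP.
move=> /(congr1 (fun p : {poly F} => size p)); rewrite size_polyX size_polyXn => -[h].
have : (q ^ 1 <= q ^ i.+1)%N by rewrite leq_exp2l.
by rewrite -h expn1 leqNgt q_gt1.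
Qed.

Lemma theta_frob_neq' i : theta_img ^+ (q ^ i.+1) - theta_img != 0.
Proof. by rewrite -opprB oppr_eq0 theta_frob_neq. Qed.

(** carlitz_E d is Carlitz's e_d / D_d, where e_d(x) is the product of the x - a
    over the a of degree less than d; here it is given by its coefficients
    1 / (D_k ell_(d-k)^(q^k)). The factor carlitz_H of the coefficient is isolated
    because it carries the dependence on d, satisfies [carlitz_H_rec], and is
    shifted by the Frobenius ([carlitz_H_frob]). *)
Definition carlitz_ell d : L := \prod_(i < d) (theta_img - theta_img ^+ (q ^ i.+1)).
Fixpoint carlitz_D k : L := if k is k'.+1 then (theta_img ^+ (q ^ k) - theta_img) * carlitz_D k' ^+ q else 1.
Definition carlitz_H k d : L := if (k <= d)%N then (carlitz_ell (d - k)%N ^+ (q ^ k))^-1 else 0.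
Definition carlitz_h k d : L := carlitz_H k d / carlitz_D k.
Definition carlitz_E d : {poly L} := \sum_(k < d.+1) carlitz_h k d *: 'X^(q ^ k).
Definition carlitz_b d (t : L) : L := \prod_(i < d) (t - theta_img ^+ (q ^ i)).

Notation th := theta_img.
Notation ell := carlitz_ell.
Notation DD := carlitz_D.
Notation HH := carlitz_H.
Notation hh := carlitz_h.
Notation EE := carlitz_E.
Notation bb := carlitz_b.

Lemma ell0 : ell 0 = 1. Proof. by rewrite /ell big_ord0. Qed.
Lemma ellS d : ell d.+1 = ell d * (th - th ^+ (q ^ d.+1)).
Proof. by rewrite /ell big_ord_recr. Qed.
Lemma ell_neq0 d : ell d != 0.
Proof. by apply/prodf_neq0 => i _; apply: theta_frob_neq. Qed.
Lemma carlitz_D_neq0 k : DD k != 0.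
Proof. by elim: k => [|k IHk] /=; rewrite ?oner_neq0 // mulf_neq0 ?theta_frob_neq' ?expf_neq0. Qed.
Lemma carlitz_b0 t : bb 0 t = 1. Proof. by rewrite /bb big_ord0. Qed.
Lemma carlitz_bS d t : bb d.+1 t = bb d t * (t - th ^+ (q ^ d)).
Proof. by rewrite /bb big_ord_recr. Qed.

Lemma carlitz_b_theta d i : (i < d)%N -> bb d (th ^+ (q ^ i)) = 0.
Proof.
by move=> lid; rewrite /bb (bigD1 (Ordinal lid)) //= subrr mul0r.
Qed.

Lemma carlitz_b_theta_neq0 d : bb d (th ^+ (q ^ d)) != 0.
Proof.
apply/prodf_neq0 => i _.
rewrite -[X in _ ^+ (q ^ X) - _](subnK (ltnW (ltn_ord i))) addnC.
rewrite addnC -frobX -frobB expf_neq0 //.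
by have := ltn_ord i; rewrite -subn_gt0; case: (d - i)%N => // k _; apply: theta_frob_neq'.
Qed.

Lemma carlitz_HE k d : (k <= d)%N -> HH k d = (ell (d - k)%N ^+ (q ^ k))^-1.
Proof. by rewrite /HH => ->. Qed.

Lemma carlitz_H_out k d : (d < k)%N -> HH k d = 0.
Proof. by rewrite /HH ltnNge => /negbTE ->. Qed.

Lemma carlitz_E_horner d x : (EE d).[x] = \sum_(k < d.+1) hh k d * x ^+ (q ^ k).
Proof.
by rewrite /EE horner_sum; apply: eq_bigr => k _; rewrite hornerZ hornerXn.
Qed.

Lemma carlitz_ED d x y : (EE d).[x + y] = (EE d).[x] + (EE d).[y].
Proof.
by rewrite !carlitz_E_horner -big_split; apply: eq_bigr => k _ /=; rewrite frobD mulrDr.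
Qed.

Lemma carlitz_E_cst d c x : (EE d).[emb_cst c * x] = emb_cst c * (EE d).[x].
Proof.
rewrite !carlitz_E_horner mulr_sumr; apply: eq_bigr => k _ /=.
by rewrite exprMn cst_frob mulrCA.
Qed.

Lemma carlitz_E_at0 d : (EE d).[0] = 0.
Proof.
by rewrite carlitz_E_horner big1 // => k _; rewrite frob0 mulr0.
Qed.

Lemma carlitz_E0 x : (EE 0).[x] = x.
Proof.
by rewrite carlitz_E_horner big_ord1 /hh carlitz_HE // subnn ell0 expr1n /= !invr1 !mul1r expn0 expr1.
Qed.

Lemma carlitz_H_rec k d : (k <= d.+1)%N ->
  (th ^+ (q ^ k) - th ^+ (q ^ d.+1)) * HH k d.+1 = HH k d.
Proof.
rewrite leq_eqVlt ltnS => /orP[/eqP->|lkd]; first by rewrite subrr mul0r carlitz_H_out.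
rewrite !carlitz_HE // ?leqW //.
rewrite subSn // ellS exprMn frobB frobX addSn subnK // invfM mulrCA.
rewrite divff ?mulr1 // -(subnK lkd) -[(_ + k).+1]addSn -frobX -frobB.
by rewrite expf_neq0 // theta_frob_neq.
Qed.

(** By comparing coefficients with [carlitz_H_rec]. The recursion is dual to
    t b_d(t) = b_(d+1)(t) + theta^(q^d) b_d(t), and together with [carlitz_E_at1] it
    determines the E_d on A. *)
Lemma carlitz_E_mul_theta d x : (EE d.+1).[th * x] = (EE d).[x] + th ^+ (q ^ d.+1) * (EE d.+1).[x].
Proof.
apply/eqP; rewrite -subr_eq; apply/eqP.
rewrite !carlitz_E_horner mulr_sumr -sumrB big_ord_recr /= [X in _ + X](_ : _ = 0) ?addr0.
  apply: eq_bigr => k _ /=; rewrite exprMn /hh -(carlitz_H_rec (k := k) (d := d)) //; last exact: ltnW (ltn_ord k).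
  by ring.
by rewrite exprMn mulrCA -!mulrA subrr.
Qed.

Lemma carlitz_DS k : DD k.+1 = (th ^+ (q ^ k.+1) - th) * DD k ^+ q. Proof. by []. Qed.

Lemma carlitz_H_frob k d : HH k d ^+ q = HH k.+1 d.+1.
Proof.
rewrite /HH ltnS; case: ifP => _; last by rewrite (frobE 0) frob0.
by rewrite subSS exprVn -exprM expnSr.
Qed.

(** By induction from (theta^(q^(e+1)) - theta) E_(e+1)(1) = E_e(1)^q - E_e(1):
    the coefficients of E_d(1) are those of the composition of the Carlitz
    exponential with its inverse. *)
Lemma carlitz_E_at1 d : (EE d).[1] = (d == 0%N)%:R.
Proof.
case: d => [|d]; first by rewrite carlitz_E0.
have key e : (th ^+ (q ^ e.+1) - th) * (EE e.+1).[1] = (EE e).[1] ^+ q - (EE e).[1].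
  rewrite !carlitz_E_horner (frobE (\sum_(_ < _) _)) frob_sum mulr_sumr.
  under eq_bigr => k _ do rewrite expr1n mulr1.
  under [X in _ = X - _]eq_bigr => k _ do rewrite expr1n mulr1 expn1.
  under [X in _ = _ - X]eq_bigr => k _ do rewrite expr1n mulr1.
  have E k : (k <= e.+1)%N -> (th ^+ (q ^ e.+1) - th) * hh k e.+1 =
     (th ^+ (q ^ k) - th) * hh k e.+1 - hh k e.
    by move=> lk; rewrite /hh -(carlitz_H_rec lk); ring.
  rewrite (eq_bigr (fun k : 'I_e.+2 => (th ^+ (q ^ k) - th) * hh k e.+1 - hh k e)); last first.
    by move=> k _; apply: E; rewrite -ltnS.
  rewrite sumrB big_ord_recl /= expn0 expr1 subrr mul0r add0r; congr (_ - _).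
    apply: eq_bigr => k _; rewrite /bump add1n /hh carlitz_DS -carlitz_H_frob expr_div_n.
    by field; rewrite theta_frob_neq' expf_neq0 ?carlitz_D_neq0.
  by rewrite big_ord_recr /= /hh carlitz_H_out // mul0r addr0.
(* As 1^q - 1 = 0, this case starts the induction, in which 0 gives 0. *)
have E1 : (EE 1).[1] = 0.
  by apply/eqP; have/eqP := key 0%N; rewrite carlitz_E0 expr1n subrr mulf_eq0 (negbTE (theta_frob_neq' _)).
rewrite /=; elim: d => // d IH.
apply/eqP; have/eqP := key d.+1.
by rewrite IH (frobE 0) frob0 subrr mulf_eq0 (negbTE (theta_frob_neq' _)).
Qed.

Lemma carlitz_E_coef d (a : {poly F}) : (size a <= d.+1)%N -> (EE d).[io a] = emb_cst a`_d.
Proof.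
elim/poly_ind: a d => [|a c IH] d sa.
  by rewrite rmorph0 carlitz_E_at0 coef0 rmorph0.
have sa' : (size a <= d)%N.
  have [-> |nza] := eqVneq a 0; first by rewrite size_poly0.
  by move: sa; rewrite size_MXaddC (negbTE nza).
rewrite rmorphD rmorphM carlitz_ED -[io c%:P]/(emb_cst c) -[emb_cst c]mulr1 carlitz_E_cst carlitz_E_at1.
rewrite coefD coefMX coefC -/th.
case: d sa sa' => [|d] sa sa' /=.
  move: sa'; rewrite leqn0 size_poly_eq0 => /eqP ->.
  by rewrite rmorph0 mul0r carlitz_E_at0 !add0r mulr1.
rewrite mulr0 !addr0 mulrC carlitz_E_mul_theta (IH d) // (IH d.+1 (leqW sa')).
by rewrite [a`_d.+1]nth_default // rmorph0 mulr0 addr0.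
Qed.

Lemma carlitz_E_small d (a : {poly F}) : (size a <= d)%N -> (EE d).[io a] = 0.
Proof. by move=> sa; rewrite carlitz_E_coef ?leqW // nth_default // rmorph0. Qed.

(** Horner's scheme: by [carlitz_E_mul_theta], replacing a by theta a + c on the
    right hand side amounts to multiplying it by t and adding c, because
    t b_j(t) = b_(j+1)(t) + theta^(q^j) b_j(t). *)
Lemma carlitz_newton N (a : {poly F}) t : (size a <= N)%N ->
  peval a t = \sum_(j < N) (EE j).[io a] * bb j t.
Proof.
elim/poly_ind: a N => [|a c IH] N sa.
  by rewrite /peval rmorph0 horner0 big1 // => j _; rewrite rmorph0 carlitz_E_at0 mul0r.
have [az|nza] := eqVneq a 0.
  move: sa; rewrite az mul0r add0r => sa; rewrite pevalC.
  case: N sa => [|N] sa.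
    move: sa; rewrite leqn0 size_poly_eq0 polyC_eq0 => /eqP->.
    by rewrite big_ord0 rmorph0.
  rewrite big_ord_recl carlitz_b0 mulr1 -[io _]/(emb_cst c) -[emb_cst c]mulr1 carlitz_E_cst carlitz_E_at1 !mulr1.
  by rewrite big1 ?addr0 // => j _; rewrite -[emb_cst c]mulr1 carlitz_E_cst carlitz_E_at1 /= mulr0 mul0r.
case: N sa => [|N]; rewrite size_MXaddC (negbTE nza) //= ltnS => sa.
rewrite pevalD pevalM pevalX pevalC (IH N) // big_ord_recl carlitz_b0 mulr1.
rewrite rmorphD rmorphM -/th -[io c%:P]/(emb_cst c) carlitz_E0 [io a * _]mulrC.
have -> : \sum_(i < N) (EE (lift ord0 i)).[th * io a + emb_cst c] * bb (lift ord0 i) t =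
   \sum_(i < N) (EE i).[io a] * bb i.+1 t +
   \sum_(i < N) th ^+ (q ^ i.+1) * (EE i.+1).[io a] * bb i.+1 t.
  rewrite -big_split; apply: eq_bigr => i _ /=; rewrite /bump add1n.
  rewrite carlitz_ED -[emb_cst c]mulr1 carlitz_E_cst carlitz_E_at1 mulr0 addr0 carlitz_E_mul_theta; ring.
have -> : forall x y A B : L, x + y + (A + B) = A + (B + x) + y by move=> *; ring.
congr (_ + _).
rewrite mulr_suml.
have -> : \sum_(i < N) th ^+ (q ^ i.+1) * (EE i.+1).[io a] * bb i.+1 t + th * io a =
  \sum_(i < N) th ^+ (q ^ i) * (EE i).[io a] * bb i t.
  pose f (i : nat) := th ^+ (q ^ i) * (EE i).[io a] * bb i t.
  have fN : f N = 0 by rewrite /f carlitz_E_small // mulr0 mul0r.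
  have <- : f 0%N = th * io a by rewrite /f expn0 expr1 carlitz_E0 carlitz_b0 mulr1.
  transitivity (\sum_(i < N.+1) f i).
    by rewrite big_ord_recl addrC; congr (_ + _); apply: eq_bigr.
  by rewrite big_ord_recr /= fN addr0.
rewrite -big_split; apply: eq_bigr => i _ /=.
by rewrite carlitz_bS; ring.
Qed.

(** * Interpolation at the monic polynomials *)

Definition mon d (a : {poly_d F}) : {poly F} := 'X^d + a.
Definition mon_img d (a : {poly_d F}) : L := io (mon a).

Lemma size_mon d (a : {poly_d F}) : size (mon a) = d.+1.
Proof. by rewrite size_polyDl size_polyXn // ltnS size_npoly. Qed.

Lemma mon_lead d (a : {poly_d F}) : (mon a)`_d = 1.
Proof. by rewrite coefD coefXn eqxx nth_default ?addr0 // size_npoly. Qed.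

Lemma mon_inj d : injective (@mon d).
Proof. by move=> a b /addrI /val_inj. Qed.

Lemma mon_img_inj d : injective (@mon_img d).
Proof. by move=> a b /io_inj /mon_inj. Qed.

Lemma mon_img_neq0 d (a : {poly_d F}) : mon_img a != 0.
Proof. by rewrite io_eq0 -size_poly_eq0 size_mon. Qed.

Lemma carlitz_E_monic d (a : {poly_d F}) : (EE d).[mon_img a] = 1.
Proof. by rewrite carlitz_E_coef ?size_mon // mon_lead rmorph1. Qed.

(** The quotient of E_d(y) - E_d(x), as a polynomial in y, by y - x. For x monic
    of degree d it vanishes at the other monic polynomials of degree d. *)
Definition lagrange_poly d (x : L) : {poly L} :=
  \sum_(k < d.+1) hh k d *: \poly_(i < q ^ k) x ^+ ((q ^ k).-1 - i).

Lemma lagrange_horner d x y : (y - x) * (lagrange_poly d x).[y] = (EE d).[y] - (EE d).[x].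
Proof.
rewrite !carlitz_E_horner -sumrB horner_sum mulr_sumr; apply: eq_bigr => k _.
rewrite hornerZ horner_poly -mulrBr mulrCA; congr (_ * _).
rewrite -[RHS]opprB subrXX -mulNr opprB; congr (_ * _).
Qed.

Lemma carlitz_h0 d : hh 0 d = (ell d)^-1.
Proof. by rewrite /hh carlitz_HE // subn0 expr1 invr1 mulr1. Qed.

(** The value on the diagonal is the derivative of E_d: all its exponents but the
    first are divisible by q. *)
Lemma lagrange_diag d x : (lagrange_poly d x).[x] = (ell d)^-1.
Proof.
rewrite horner_sum big_ord_recl big1 => [|k _].
  rewrite addr0 hornerZ horner_poly expn0 big_ord1 subnn !expr0 mulr1 mulr1.
  exact: carlitz_h0.
rewrite hornerZ horner_poly /=.
rewrite (eq_bigr (fun=> x ^+ (q ^ k.+1).-1)) => [|i _].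
  by rewrite sumr_const card_ord -mulr_natr natrX q_natr0 expr0n /= !mulr0.
by rewrite -exprD subnK // -ltnS prednK ?ltn_ord.
Qed.

Lemma size_lagrange d x : (size (lagrange_poly d x) <= q ^ d)%N.
Proof.
apply: (leq_trans (size_sum _ _ _)); apply/bigmax_leqP => k _.
apply: (leq_trans (size_scale_leq _ _)); apply: (leq_trans (size_poly _ _)).
by rewrite leq_exp2l // -ltnS.
Qed.

Lemma lagrange_interp d (P : {poly L}) : (size P <= q ^ d)%N ->
  P = ell d *: \sum_(a : {poly_d F}) P.[mon_img a] *: lagrange_poly d (mon_img a).
Proof.
move=> sP; apply/eqP; rewrite -subr_eq0; apply/eqP.
set Q := _ - _.
(* Q has degree less than q^d and vanishes at the q^d monic polynomials. *)
pose rs := [seq mon_img a | a <- enum {: {poly_d F}}].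
have szrs : size rs = (q ^ d)%N by rewrite size_map -cardE card_npoly.
apply: (@roots_geq_poly_eq0 _ Q rs).
- apply/allP => _ /mapP[b _ ->]; apply/rootP; rewrite hornerD hornerN hornerZ.
  rewrite horner_sum (bigD1 b) //= big1 => [|a /negbTE nab].
    by rewrite hornerZ lagrange_diag addr0 mulrCA divff ?ell_neq0 // mulr1 subrr.
  rewrite hornerZ; apply/eqP; rewrite mulf_eq0; apply/orP; right.
  have := lagrange_horner d (mon_img a) (mon_img b); rewrite !carlitz_E_monic subrr => /eqP.
  by rewrite mulf_eq0 subr_eq0 (inj_eq (@mon_img_inj d)) eq_sym nab.
- by rewrite map_inj_uniq ?enum_uniq //; apply: mon_img_inj.
rewrite szrs; apply: (leq_trans (size_polyD _ _)); rewrite geq_max sP size_polyN.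
apply: (leq_trans (size_scale_leq _ _)).
apply: (leq_trans (size_sum _ _ _)); apply/bigmax_leqP => a _.
exact: leq_trans (size_scale_leq _ _) (size_lagrange _ _).
Qed.

(** The coefficients of [lagrange_poly] are combinations of powers of the node, so
    that those of P become power sums. *)
Lemma lagrange_interp_coef d (P : {poly L}) n : (size P <= q ^ d)%N ->
  P`_n / ell d = \sum_(a : {poly_d F})
     P.[mon_img a] * (\sum_(k < d.+1 | (n < q ^ k)%N) hh k d * mon_img a ^+ (q ^ k - n.+1)).
Proof.
move=> /lagrange_interp {1}->; rewrite coefZ coef_sum mulrC mulKf ?ell_neq0 //.
apply: eq_bigr => a _; rewrite coefZ coef_sum [in RHS]big_mkcond; congr (_ * _).
apply: eq_bigr => k _; rewrite coefZ coef_poly; case: ifP => // _; last by rewrite mulr0.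
by rewrite -subn1 -subnDA add1n.
Qed.

(** Compare the coefficients of X^(q^d - 1) in the interpolation formula: P has none,
    and only the leading term of E_d contributes on the other side. *)
Lemma sum_monic_eq0 d (P : {poly L}) : (size P < q ^ d)%N ->
  \sum_(a : {poly_d F}) P.[mon_img a] = 0.
Proof.
move=> sP; have := lagrange_interp_coef (q ^ d).-1 (ltnW sP).
rewrite nth_default; last by rewrite -ltnS prednK.
rewrite mul0r => /esym; rewrite (eq_bigr (fun a => P.[mon_img a] * hh d d)) => [|a _].
  rewrite -mulr_suml => /eqP; rewrite mulf_eq0 => /orP[/eqP//|].
  rewrite /hh carlitz_HE // mulf_eq0 !invr_eq0 expf_eq0 (negbTE (ell_neq0 _)) andbF.
  by rewrite (negbTE (carlitz_D_neq0 _)).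
congr (_ * _); rewrite (bigD1 ord_max) /= ?prednK //.
rewrite subnn mulr1 big1 ?addr0 // => k /andP[]; rewrite leq_exp2l //.
by move=> dk /eqP[]; apply/val_inj/anti_leq; rewrite /= dk -ltnS ltn_ord.
Qed.

Definition poly_powsum d n (P : {poly L}) : L := \sum_(a : {poly_d F}) P.[mon_img a] / mon_img a ^+ n.

(** Multiply each term by 1 = E_d(a) and split E_d at the exponent n: the terms
    a^(q^k) with q^k <= n lower the exponent of 1/a, and the others add up to a
    coefficient of P by [lagrange_interp_coef]. *)
Lemma poly_powsum_rec d n (P : {poly L}) : (size P <= q ^ d)%N ->
  poly_powsum d n.+1 P = P`_n / ell d
    + \sum_(k < d.+1 | (q ^ k <= n)%N) hh k d * poly_powsum d (n.+1 - q ^ k) P.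
Proof.
move=> sP; rewrite lagrange_interp_coef // /poly_powsum.
under [X in _ = _ + X]eq_bigr => k _ do rewrite mulr_sumr.
rewrite exchange_big -big_split /=; apply: eq_bigr => a _.
under [X in _ = _ + X]eq_bigr => k _ do rewrite mulrCA.
rewrite -mulr_sumr -mulrDr; congr (_ * _).
have an0 : mon_img a ^+ n.+1 != 0 by rewrite expf_neq0 ?mon_img_neq0.
apply: (mulfI an0); rewrite divff // -(carlitz_E_monic a) carlitz_E_horner (bigID (fun k : 'I_d.+1 => (n < q ^ k)%N)) /=.
rewrite mulrDr; congr (_ + _).
  rewrite mulr_sumr; apply: eq_bigr => k lk; rewrite mulrCA; congr (_ * _).
  by rewrite -exprD subnKC.
rewrite mulr_sumr; apply: eq_big => [k|k]; rewrite -leqNgt // => lk.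
rewrite mulrCA; congr (_ * _).
rewrite -[X in mon_img a ^+ X * _](subnKC (leqW lk)) exprD mulfK //.
by rewrite expf_neq0 ?mon_img_neq0.
Qed.
End Carlitz.

(** * Composition arrays *)

Lemma compmapP (s s' : compmap) : (forall j, s j = s' j) -> s = s'.
Proof. by move=> h; apply/fsfunP. Qed.

Definition cplus (s s' : compmap) : compmap :=
  [fsfun j in (finsupp s `|` finsupp s')%fset => (s j + s' j)%N].

Lemma cplusE s s' j : cplus s s' j = (s j + s' j)%N.
Proof.
rewrite /cplus fsfunE; case: ifPn => //; rewrite in_fsetU negb_or.
by rewrite !memNfinsupp => /andP[/eqP-> /eqP->].
Qed.

Definition cnil : compmap := [fsfun].

Lemma cnilE j : cnil j = 0%N. Proof. by rewrite fsfunE. Qed.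

Lemma cplusC s s' : cplus s s' = cplus s' s.
Proof. by apply: compmapP => j; rewrite !cplusE addnC. Qed.
Lemma cplusA s1 s2 s3 : cplus s1 (cplus s2 s3) = cplus (cplus s1 s2) s3.
Proof. by apply: compmapP => j; rewrite !cplusE addnA. Qed.
Lemma cplus0 s : cplus s cnil = s.
Proof. by apply: compmapP => j; rewrite !cplusE cnilE addn0. Qed.
Lemma cplus0s s : cplus cnil s = s.
Proof. by rewrite cplusC cplus0. Qed.

(** The composition map of a multiset of indices given as a list; it turns products
    over the support with exponents into plain products over the list
    ([cprod_cmap]). *)
Definition cmap (l : seq posnat) : compmap :=
  [fsfun j in [fset x in l]%fset => count_mem j l].

Lemma cmapE l j : cmap l j = count_mem j l.
Proof.
rewrite /cmap fsfunE inE; case: ifPn => // jl.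
by apply/esym/eqP; rewrite -leqn0 leqNgt -has_count has_pred1.
Qed.

Lemma cmap_nil : cmap [::] = cnil.
Proof. by apply: compmapP => j; rewrite cmapE cnilE. Qed.

Lemma cmap_cat l l' : cmap (l ++ l') = cplus (cmap l) (cmap l').
Proof. by apply: compmapP => j; rewrite cplusE !cmapE count_cat. Qed.

Lemma cmap_perm l l' : perm_eq l l' -> cmap l = cmap l'.
Proof. by move=> /permP h; apply: compmapP => j; rewrite !cmapE h. Qed.

Lemma cmap_surj s : exists l, s = cmap l.
Proof.
exists (flatten [seq nseq (s j) j | j <- finsupp s]); apply: compmapP => j.
rewrite cmapE count_flatten -map_comp sumnE big_map.
rewrite (eq_bigr (fun i => if i == j then s j else 0%N)) => [|i _]; last first.
  by rewrite /= count_nseq /=; case: eqP => [->|]; rewrite ?mul1n.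
rewrite -big_mkcond /=; have [js|] := boolP (j \in finsupp s); last first.
  move=> js; rewrite big1_seq ?(eqP (memNfinsupp _ _)) //.
    by move: js; rewrite memNfinsupp => /eqP.
  by move=> i /andP[/eqP-> ]; rewrite (negbTE js).
rewrite -big_filter (_ : [seq i <- finsupp s | i == j] = [:: j]) ?big_seq1 //.
by rewrite filter_pred1_uniq.
Qed.

Lemma adm_nil : admissible cnil 0 [::].
Proof. by split=> // [j|]; rewrite big_nil ?cnilE. Qed.

Lemma adm_nil_inv s n : admissible s n [::] -> s = cnil /\ n = 0%N.
Proof.
by case=> _ h <-; split; rewrite ?big_nil //; apply: compmapP => j; rewrite -h big_nil cnilE.
Qed.

Lemma adm_cons s n s' n' c : (0 < n)%N -> admissible s' n' c ->
  admissible (cplus s s') (n + n') ((s, n) :: c).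
Proof.
move=> n0 [hc hs hn]; split; first by rewrite /= n0.
  by move=> j; rewrite big_cons cplusE hs.
by rewrite big_cons hn.
Qed.

Lemma adm_cons_inv s n s1 n1 c : admissible s n ((s1, n1) :: c) ->
  exists s' n', [/\ (0 < n1)%N, admissible s' n' c, s = cplus s1 s' & n = (n1 + n')%N].
Proof.
case=> /= /andP[n0 hc] hs hn.
pose s' : compmap := [fsfun j in finsupp s => (s j - s1 j)%N].
have s'E j : s' j = (s j - s1 j)%N.
  rewrite /s' fsfunE; case: ifPn => //; rewrite memNfinsupp => /eqP ->.
  by [].
exists s', (\sum_(col <- c) col.2)%N; split=> //.
- by split=> // j; rewrite s'E -hs big_cons /= addKn.
- by apply: compmapP => j; rewrite cplusE s'E -hs big_cons /= addKn.
- by rewrite -hn big_cons.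
Qed.

(** * Truncated multiple sums and their spans *)

Section Seqs.
Variables (R : realType) (F : finFieldType) (C : Cinfty R F).
Notation seqt := (nat -> tfun C).

Definition embC : {rmorphism {poly F} -> C} := (Cemb C \o @tofrac _).

Lemma io_inj : injective embC.
Proof. by move=> a b /fmorph_inj /eqP; rewrite tofrac_eq => /eqP. Qed.

Lemma seq_ext (u v : seqt) : (forall d t, u d t = v d t) -> u = v.
Proof. by move=> h; apply/funext => d; apply/funext => t. Qed.

Lemma seq_sumE I (r : seq I) (P : pred I) (f : I -> seqt) d t :
  (\sum_(i <- r | P i) f i) d t = \sum_(i <- r | P i) f i d t.
Proof. by apply: (big_morph (fun u : seqt => u d t)). Qed.

Lemma seq_mulCA (u v w : seqt) : u * (v * w) = v * (u * w).
Proof. by apply: seq_ext => d t; apply: (mulrCA (u d t) (v d t) (w d t)). Qed.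

Lemma seq_mulACA (u v w z : seqt) : (u * v) * (w * z) = (u * w) * (v * z).
Proof. by apply: seq_ext => d t; apply: (mulrACA (u d t) (v d t) (w d t) (z d t)). Qed.

Definition chi_seq (l : seq posnat) (a : {poly F}) (t : posnat -> C) : C :=
  \prod_(j <- l) peval embC a (t j).

Lemma cprod_cmap (g : posnat -> C) l :
  \prod_(j <- finsupp (cmap l)) g j ^+ cmap l j = \prod_(j <- l) g j.
Proof.
rewrite -[RHS]big_undup_iterop_count /=.
rewrite (perm_big (undup l)) /=; last first.
  apply: uniq_perm; rewrite ?undup_uniq ?fset_uniq // => j.
  rewrite mem_undup mem_finsupp cmapE -lt0n -has_count has_pred1 //.
by apply: eq_bigr => j _; rewrite cmapE; case: (count_mem j l).
Qed.

Lemma chi_cmap l a t : chi (cmap l) a t = chi_seq l a t.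
Proof. exact: cprod_cmap. Qed.

Lemma chi_seq_cat l l' a t : chi_seq (l ++ l') a t = chi_seq l a t * chi_seq l' a t.
Proof. by rewrite /chi_seq big_cat. Qed.

Definition in_K (x : C) : Prop := exists k, x = Cemb C k.
Lemma in_K0 : in_K 0. Proof. by exists 0; rewrite rmorph0. Qed.
Lemma in_K1 : in_K 1. Proof. by exists 1; rewrite rmorph1. Qed.
Lemma in_KD x y : in_K x -> in_K y -> in_K (x + y).
Proof. by move=> [k ->] [k' ->]; exists (k + k'); rewrite rmorphD. Qed.
Lemma in_KM x y : in_K x -> in_K y -> in_K (x * y).
Proof. by move=> [k ->] [k' ->]; exists (k * k'); rewrite rmorphM. Qed.
Lemma in_KN x : in_K x -> in_K (- x).
Proof. by move=> [k ->]; exists (- k); rewrite rmorphN. Qed.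
Lemma in_KV x : in_K x -> in_K (x^-1).
Proof. by move=> [k ->]; exists (k^-1); rewrite fmorphV. Qed.
Lemma in_KX x n : in_K x -> in_K (x ^+ n).
Proof. by move=> [k ->]; exists (k ^+ n); rewrite rmorphXn. Qed.
Lemma in_K_io a : in_K (embC a). Proof. by exists (tofrac a). Qed.
Lemma in_K_sum I (r : seq I) (P : pred I) (f : I -> C) :
  (forall i, P i -> in_K (f i)) -> in_K (\sum_(i <- r | P i) f i).
Proof. by move=> h; elim/big_rec: _ => [|i x Pi Kx]; [apply: in_K0|apply: in_KD; auto]. Qed.
Lemma in_K_prod I (r : seq I) (P : pred I) (f : I -> C) :
  (forall i, P i -> in_K (f i)) -> in_K (\prod_(i <- r | P i) f i).
Proof. by move=> h; elim/big_rec: _ => [|i x Pi Kx]; [apply: in_K1|apply: in_KM; auto]. Qed.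

Definition seq_cst (k : C) : seqt := fun _ _ => k.
Lemma seq_cstM k k' : seq_cst (k * k') = seq_cst k * seq_cst k'. Proof. by []. Qed.
Lemma seq_cst1 : seq_cst 1 = 1. Proof. by []. Qed.

Inductive Kspan (G : seqt -> Prop) : seqt -> Prop :=
| span0 : Kspan G 0
| spanD1 k g u : in_K k -> G g -> Kspan G u -> Kspan G (seq_cst k * g + u).

Section Span.
Variable G : seqt -> Prop.

Lemma span_gen g : G g -> Kspan G g.
Proof.
by move=> Gg; have := spanD1 in_K1 Gg (span0 G); rewrite seq_cst1 mul1r addr0.
Qed.

Lemma spanD u v : Kspan G u -> Kspan G v -> Kspan G (u + v).
Proof.
by elim=> [|k g u' Kk Gg _ IH] Gv; rewrite ?add0r // -addrA; apply: spanD1 => //; apply: IH.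
Qed.

Lemma spanZ k u : in_K k -> Kspan G u -> Kspan G (seq_cst k * u).
Proof.
move=> Kk; elim=> [|k' g u' Kk' Gg _ IH]; first by rewrite mulr0; apply: span0.
by rewrite mulrDr mulrA -seq_cstM; apply: spanD1 => //; apply: in_KM.
Qed.

Lemma spanN u : Kspan G u -> Kspan G (- u).
Proof.
move=> Gu; have -> : - u = seq_cst (-1) * u.
  by apply: seq_ext => d t; rewrite -[RHS]/(-1 * u d t) mulN1r.
by apply: spanZ => //; apply/in_KN/in_K1.
Qed.

Lemma spanB u v : Kspan G u -> Kspan G v -> Kspan G (u - v).
Proof. by move=> Gu Gv; apply: spanD => //; apply: spanN. Qed.

Lemma span_sum I (r : seq I) (P : pred I) (f : I -> seqt) :
  (forall i, P i -> Kspan G (f i)) -> Kspan G (\sum_(i <- r | P i) f i).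
Proof. by move=> h; elim/big_rec: _ => [|i x Pi Kx]; [apply: span0|apply: spanD; auto]. Qed.
End Span.

Lemma span_map G G' (f : seqt -> seqt) u :
  f 0 = 0 -> (forall k g v, f (seq_cst k * g + v) = seq_cst k * f g + f v) ->
  (forall g, G g -> Kspan G' (f g)) -> Kspan G u -> Kspan G' (f u).
Proof.
move=> f0 fD fG; elim=> [|k g v Kk Gg _ IH]; first by rewrite f0; apply: span0.
by rewrite fD; apply: spanD IH; apply: spanZ => //; apply: fG.
Qed.

Lemma span_mul G G' G'' u v :
  (forall g g', G g -> G' g' -> Kspan G'' (g * g')) ->
  Kspan G u -> Kspan G' v -> Kspan G'' (u * v).
Proof.
move=> h Gu Gv; apply: (span_map (f := fun w => w * v) _ _ _ Gu).
- exact: mul0r.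
- by move=> k g w; rewrite mulrDl mulrA.
move=> g Gg; apply: (span_map (f := fun w => g * w) _ _ _ Gv) => [|k g' w|g' Gg'].
- exact: mulr0.
- by rewrite mulrDr seq_mulCA.
exact: h.
Qed.

Lemma span_sub (G G' : seqt -> Prop) u : (forall g, G g -> Kspan G' g) -> Kspan G u -> Kspan G' u.
Proof. by move=> h; apply: (span_map (f := id)). Qed.

(** Multiple zeta values are handled as limits of sequences of functions, because
    the harmonic product and the operator tau are given by identities that hold at
    every truncation. *)
Definition powsum (s : compmap) (n : nat) : seqt := fun d t =>
  \sum_(a : {poly_d F}) chi s (mon a) t / mon_img embC a ^+ n.

Definition partial_sum (u : seqt) : seqt := fun d t => \sum_(e < d) u e t.

Fixpoint mzsum (c : comp_array) : seqt :=
  if c is (s, n) :: c' then partial_sum (powsum s n * mzsum c') else 1.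

(** The part of [mzsum] in which the first polynomial has degree exactly d. *)
Definition mzsum_at (c : comp_array) : seqt :=
  if c is (s, n) :: c' then powsum s n * mzsum c' else 0.

Definition Wspan s n := Kspan (fun u => exists2 c, admissible s n c & u = mzsum c).
Definition Vspan s n := Kspan (fun u => exists2 c, c <> [::] /\ admissible s n c & u = mzsum_at c).

Lemma partial_sum0 : partial_sum 0 = 0.
Proof. by apply: seq_ext => d t; rewrite /partial_sum big1. Qed.

Lemma partial_sum_lin k g v : partial_sum (seq_cst k * g + v) = seq_cst k * partial_sum g + partial_sum v.
Proof.
apply: seq_ext => d t; rewrite -[RHS]/(k * partial_sum g d t + partial_sum v d t) /partial_sum.
by rewrite mulr_sumr -big_split.
Qed.

Lemma partial_sum_at0 u t : partial_sum u 0%N t = 0.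
Proof. by rewrite /partial_sum big_ord0. Qed.

Lemma partial_sumS u d t : partial_sum u d.+1 t = partial_sum u d t + u d t.
Proof. by rewrite /partial_sum big_ord_recr. Qed.

(** The three terms are the cases e < e', e > e' and e = e' of the double sum:
    this is the combinatorial part of the harmonic product. *)
Lemma partial_sumM u v : partial_sum u * partial_sum v = partial_sum (u * partial_sum v + partial_sum u * v + u * v).
Proof.
apply: seq_ext => d t; rewrite -[LHS]/(partial_sum u d t * partial_sum v d t).
elim: d => [|d IH]; first by rewrite !partial_sum_at0 mul0r.
rewrite !partial_sumS -IH -[X in _ = _ + X]/(u d t * partial_sum v d t + partial_sum u d t * v d t + u d t * v d t).
by ring.
Qed.

Lemma mzsum_cons s n c : mzsum ((s, n) :: c) = partial_sum (mzsum_at ((s, n) :: c)).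
Proof. by []. Qed.

Lemma Vspan_partial_sum s n u : Vspan s n u -> Wspan s n (partial_sum u).
Proof.
apply: span_map; [exact: partial_sum0|exact: partial_sum_lin|].
by move=> _ [[|[s1 n1] c] [// _ Ac] ->]; apply: span_gen; exists ((s1, n1) :: c).
Qed.

Lemma Wspan1 : Wspan cnil 0 1.
Proof. by apply: span_gen; exists [::] => //; apply: adm_nil. Qed.

Lemma Wspan_cst k : in_K k -> Wspan cnil 0 (seq_cst k).
Proof. by move=> Kk; rewrite -[seq_cst k]mulr1; apply: spanZ => //; apply: Wspan1. Qed.

Lemma powsum_mulW s1 n1 s n w : (0 < n1)%N -> Wspan s n w -> Vspan (cplus s1 s) (n1 + n) (powsum s1 n1 * w).
Proof.
move=> n0; apply: (span_map (f := fun w => powsum s1 n1 * w)) => [|k g v|].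
- exact: mulr0.
- by rewrite mulrDr seq_mulCA.
move=> _ [c Ac ->]; apply: span_gen; exists ((s1, n1) :: c) => //; split=> //.
exact: adm_cons.
Qed.

Lemma powsum_Vspan s n : (0 < n)%N -> Vspan s n (powsum s n).
Proof.
by move=> n0; have := powsum_mulW s n0 Wspan1; rewrite cplus0 addn0 mulr1.
Qed.

Lemma powsum_Wspan s n : (0 < n)%N -> Wspan s n (partial_sum (powsum s n)).
Proof. by move=> n0; apply: Vspan_partial_sum; apply: powsum_Vspan. Qed.
End Seqs.

(** * The harmonic product *)

Lemma coef_ZXnD (R : nzRingType) (f : R) (c : {poly R}) d i :
  (f *: 'X^d + c)`_i = f * (i == d)%:R + c`_i.
Proof. by rewrite coefD coefZ coefXn. Qed.

Section PolySums.
Variables (F : finFieldType) (U : zmodType).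
Implicit Type G : {poly F} -> U.

Lemma npoly0_eq (c : {poly_0 F}) : polyn c = 0.
Proof. by apply/eqP; rewrite -size_poly_eq0 -leqn0 size_npoly. Qed.

Lemma sum_poly0 G : \sum_(c : {poly_0 F}) G c = G 0.
Proof.
rewrite (bigD1 0) //= big1 ?addr0 // => c /eqP[]; apply: val_inj.
by rewrite /= npoly0_eq.
Qed.

Lemma sum_polyS d G : \sum_(c : {poly_(d.+1) F}) G c =
  \sum_(f : F) \sum_(c : {poly_d F}) G (f *: 'X^d + polyn c).
Proof.
rewrite pair_big /=.
have sz (f : F) (c : {poly_d F}) : (size (f *: 'X^d + polyn c)%R <= d.+1)%N.
  rewrite (leq_trans (size_polyD _ _)) // geq_max (leq_trans (size_scale_leq _ _)) ?size_polyXn //.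
  exact: leqW (size_npoly _).
rewrite (reindex (fun p : F * {poly_d F} => npolyp d.+1 (p.1 *: 'X^d + polyn p.2))) /=.
  by apply: eq_bigr => -[f c] _ /=; rewrite npolypK.
exists (fun c : {poly_(d.+1) F} => (c`_d, npolyp d (polyn c))) => [[f c]|c] _ /=.
  rewrite npolypK //; congr (_, _).
    by rewrite [LHS]coef_ZXnD eqxx mulr1 nth_default ?addr0 // size_npoly.
  apply: val_inj; apply/polyP => i; rewrite [LHS]coef_npolyp.
  rewrite [X in if _ then X else _]coef_ZXnD; case: ltngtP => [ilt|igt|->]; rewrite ?mulr0 ?add0r //.
    by rewrite nth_default // (leq_trans (size_npoly _)) // ltnW.
  by rewrite nth_default // size_npoly.
apply: val_inj; apply/polyP => i; rewrite /= (npolypK (sz _ _)) [LHS]coef_ZXnD coef_npolyp.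
case: ltngtP => [ilt|igt|->]; rewrite ?mulr0 ?add0r ?mulr1 ?addr0 //.
by rewrite nth_default // (leq_trans (size_npoly _)).
Qed.

Lemma sum_poly_monic d G : \sum_(c : {poly_d F} | polyn c \is monic) G c =
  \sum_(e < d) \sum_(a : {poly_e F}) G (mon a).
Proof.
rewrite big_mkcond /=.
elim: d => [|d IH].
  by rewrite (sum_poly0 (fun c => if c \is monic then G c else 0)) big_ord0 monicE lead_coef0 eq_sym oner_eq0.
rewrite (sum_polyS d (fun c => if c \is monic then G c else 0)) big_ord_recr /= -IH.
rewrite (bigD1 0) //= (bigD1 1) ?oner_neq0 //= addrA; rewrite [X in _ + X = _]big1 ?addr0 => [|f /andP[f0 f1]].
  congr (_ + _); apply: eq_bigr => c _; rewrite ?scale0r ?add0r //.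
  rewrite scale1r monicE lead_coefE (size_mon c) /= mon_lead eqxx //.
rewrite big1 // => c _; rewrite monicE.
have sz : size (f *: 'X^d + polyn c) = d.+1.
  by rewrite size_polyDl size_scale ?size_polyXn // ltnS size_npoly.
rewrite lead_coefE sz /= [X in X == _]coef_ZXnD eqxx mulr1 nth_default ?size_npoly // addr0.
by rewrite (negbTE f1).
Qed.
End PolySums.

Section PolySumsNz.
Variables (F : finFieldType) (L : fieldType).
Variables (G : {poly F} -> L) (x : F -> L).
Hypothesis Gx : forall f c, f != 0 -> G (f *: c) = x f * G c.

(** Every nonzero polynomial is a nonzero constant times a monic one. *)
Lemma sum_poly_neq0 d : \sum_(c : {poly_d F} | c != 0) G c =
  (\sum_(f : F | f != 0) x f) * \sum_(e < d) \sum_(a : {poly_e F}) G (mon a).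
Proof.
have E n : \sum_(c : {poly_n F} | c != 0) G c =
    \sum_(c : {poly_n F}) (if polyn c != 0 then G c else 0) by rewrite big_mkcond.
elim: d => [|d IH].
  by rewrite E (sum_poly0 (fun c => if c != 0 then G c else 0)) eqxx big_ord0 mulr0.
rewrite E (sum_polyS d (fun c => if c != 0 then G c else 0)) big_ord_recr /= mulrDr -IH E.
rewrite (bigD1 0) //=; congr (_ + _).
  by apply: eq_bigr => c _; rewrite scale0r add0r.
rewrite mulr_suml; apply: eq_bigr => f f0.
rewrite (reindex (fun c : {poly_d F} => f *: c)) /=; last first.
  by exists (fun c => f^-1 *: c) => c _; rewrite scalerA ?divff ?mulVf ?scale1r.
rewrite mulr_sumr; apply: eq_bigr => c _.
rewrite -Gx // /mon scalerDr ifT //.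
rewrite -scalerDr scaler_eq0 negb_or f0 -size_poly_eq0.
by rewrite -[_ + _]/(mon c) size_mon.
Qed.
End PolySumsNz.

Section Harmonic.
Variables (R : realType) (F : finFieldType) (C : Cinfty R F).
Notation seqt := (nat -> tfun C).
Notation imc := (mon_img (embC C)).

Lemma powsum_cmap l n d t : powsum (cmap l) n d t = \sum_(a : {poly_d F}) chi_seq l (mon a) t / imc a ^+ n :> C.
Proof. by apply: eq_bigr => a _; rewrite chi_cmap. Qed.

(** For j = 0 and l3 empty this is the off-diagonal part of a product of two power
    sums of the same degree d; the factors in a - b appear when it is reduced. *)
Definition mixed_sum (l1 : seq posnat) (n : nat) (l2 : seq posnat) (m : nat) (l3 : seq posnat) (j : nat) : seqt :=
  fun d t => \sum_(a : {poly_d F}) \sum_(b : {poly_d F} | b != a)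
    chi_seq l1 (mon a) t * chi_seq l2 (mon b) t * chi_seq l3 (polyn a - polyn b) t
    / (imc a ^+ n * imc b ^+ m * (imc a - imc b) ^+ j).

(** Products attached to a splitting of l and n into two nontrivial weights, where
    the second factor only involves lower degrees. *)
Definition shuffle_gen (l : seq posnat) n (u : seqt) : Prop := exists l' l'' n' n'',
  [/\ u = powsum (cmap l') n' * partial_sum (powsum (cmap l'') n''), (0 < n')%N, (0 < n'')%N,
    perm_eq (l' ++ l'') l & n = (n' + n'')%N].

Lemma shuffle_gen_perm l l' n u : perm_eq l l' -> Kspan (shuffle_gen l n) u -> Kspan (shuffle_gen l' n) u.
Proof.
move=> p; apply: span_sub => g [l1 [l2 [n1 [n2 [-> n1p n2p pl ->]]]]].
by apply: span_gen; exists l1, l2, n1, n2; split=> //; apply: perm_trans p.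
Qed.

Lemma mon_imgB d (a b : {poly_d F}) : imc a - imc b = embC C (polyn a - polyn b).
Proof. by rewrite /mon_img /mon !rmorphD rmorphN opprD addrACA subrr add0r. Qed.

Lemma pevalZ (f : F) a (t : C) : peval (embC C) (f *: a) t = emb_cst (embC C) f * peval (embC C) a t.
Proof. by rewrite -mul_polyC pevalM pevalC. Qed.

Lemma chi_seqZ l (f : F) a (t : posnat -> C) :
  chi_seq l (f *: a) t = emb_cst (embC C) f ^+ size l * chi_seq l a t.
Proof.
rewrite /chi_seq; elim: l => [|j l IH]; first by rewrite !big_nil mulr1.
by rewrite !big_cons IH pevalZ exprS; ring.
Qed.

Lemma pevalN a (t : C) : peval (embC C) (- a) t = - peval (embC C) a t.
Proof. by rewrite -sub0r pevalB /peval rmorph0 horner0 sub0r. Qed.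

Lemma chi_seqN l a (t : posnat -> C) : chi_seq l (- a) t = (-1) ^+ size l * chi_seq l a t.
Proof.
rewrite /chi_seq; elim: l => [|j l IH]; first by rewrite !big_nil mulr1.
by rewrite !big_cons IH pevalN exprS; ring.
Qed.

Lemma in_K_cst f : in_K (emb_cst (embC C) f).
Proof. exact: in_K_io. Qed.

(** Without b, the sum over b is a sum over the nonzero polynomials a - b of
    degree less than d, hence a multiple of the sum over monic polynomials of
    lower degree. *)
Lemma mixed_sum_base l1 n l3 j :
  exists2 k : C, in_K k & mixed_sum l1 n [::] 0 l3 j.+1 =
    seq_cst k * (powsum (cmap l1) n * partial_sum (powsum (cmap l3) j.+1)).
Proof.
(* A summand gets this factor when a - b is multiplied by the constant f. *)
exists (\sum_(f : F | f != 0) emb_cst (embC C) f ^+ size l3 / emb_cst (embC C) f ^+ j.+1).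
  by apply: in_K_sum => f _; apply: in_KM; [|apply: in_KV]; apply: in_KX; apply: in_K_cst.
apply: seq_ext => d t.
rewrite -[RHS]/(_ * (powsum (cmap l1) n d t * \sum_(e < d) powsum (cmap l3) j.+1 e t)).
rewrite powsum_cmap mulrCA mulr_suml; apply: eq_bigr => a _.
rewrite (reindex (fun c : {poly_d F} => a - c)) /=; last first.
  by exists (fun c => a - c) => c _; rewrite subKr.
pose G (c : {poly F}) := chi_seq l3 c t / embC C c ^+ j.+1.
transitivity (\sum_(c : {poly_d F} | c != 0) chi_seq l1 (mon a) t / imc a ^+ n * G c).
  apply: eq_big => [c|c _].
    by rewrite -subr_eq0 addrAC subrr add0r oppr_eq0.
  rewrite mon_imgB /= subKr /G /chi_seq big_nil expr0 !mulr1 invfM; ring.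
rewrite -mulr_sumr; congr (_ * _).
rewrite (sum_poly_neq0 (x := fun f => emb_cst (embC C) f ^+ size l3 / emb_cst (embC C) f ^+ j.+1)).
  by congr (_ * _); apply: eq_bigr => e _; rewrite powsum_cmap.
move=> f c f0; rewrite /G chi_seqZ -mul_polyC rmorphM exprMn invfM.
by rewrite -[embC C f%:P]/(emb_cst (embC C) f); ring.
Qed.

(** The variables attached to b are removed one at a time with
    b(t) = a(t) - (a - b)(t). *)
Lemma mixed_sum_right l2 : forall l1 n l3 j, (0 < n)%N ->
  Kspan (shuffle_gen (l1 ++ l2 ++ l3) (n + j.+1)) (mixed_sum l1 n l2 0 l3 j.+1).
Proof.
elim: l2 => [|k l2 IH] l1 n l3 j n0.
  have [k Kk ->] := mixed_sum_base l1 n l3 j; apply: spanZ => //; apply: span_gen.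
  by exists l1, l3, n, j.+1.
have -> : mixed_sum l1 n (k :: l2) 0 l3 j.+1 = mixed_sum (k :: l1) n l2 0 l3 j.+1 - mixed_sum l1 n l2 0 (k :: l3) j.+1.
  apply: seq_ext => d t.
  rewrite -[RHS]/(mixed_sum (k :: l1) n l2 0 l3 j.+1 d t - mixed_sum l1 n l2 0 (k :: l3) j.+1 d t).
  rewrite /mixed_sum -sumrB; apply: eq_bigr => a _; rewrite -sumrB; apply: eq_bigr => b _.
  rewrite /chi_seq !big_cons -/(chi_seq l1 _ _) -/(chi_seq l2 _ _) -/(chi_seq l3 _ _).
  have -> : peval (embC C) (mon b) (t k) = peval (embC C) (mon a) (t k) - peval (embC C) (polyn a - polyn b) (t k).
    by rewrite -pevalB; congr (peval _ _ _); rewrite /mon; ring.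
  by ring.
apply: spanB; [have := IH (k :: l1) n l3 j n0|have := IH l1 n (k :: l3) j n0];
  apply: shuffle_gen_perm.
  by apply/permP => p; rewrite /= !count_cat /= !count_cat; lia.
by apply/permP => p; rewrite /= !count_cat /= !count_cat /=; lia.
Qed.

Lemma mixed_sum_swap l1 n l2 m l3 j : exists2 k : C, in_K k &
  mixed_sum l1 n l2 m l3 j = seq_cst k * mixed_sum l2 m l1 n l3 j.
Proof.
exists ((-1) ^+ size l3 / (-1) ^+ j).
  by apply: in_KM; [|apply: in_KV]; apply: in_KX; apply/in_KN/in_K1.
apply: seq_ext => d t; rewrite -[RHS]/(_ * mixed_sum l2 m l1 n l3 j d t) /mixed_sum.
rewrite (exchange_big_dep predT) //= mulr_sumr; apply: eq_bigr => b _.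
rewrite mulr_sumr; apply: eq_big => [a|a _]; first by rewrite eq_sym.
rewrite -opprB chi_seqN -[imc a - _]opprB [(- (imc b - _)) ^+ j]exprNn !invfM.
by rewrite /seq_cst /mon_img; ring.
Qed.

(** Induction with 1 / (a b) = (1 / b - 1 / a) / (a - b), until one of the
    exponents of a and b is zero. *)
Lemma mixed_sum_span s : forall l1 n l2 m l3 j, (n + m = s)%N -> (0 < s)%N ->
  [|| (0 < j)%N | (0 < n)%N && (0 < m)%N] ->
  Kspan (shuffle_gen (l1 ++ l2 ++ l3) (s + j)) (mixed_sum l1 n l2 m l3 j).
Proof.
elim: s => // s IH l1 n l2 m l3 j.
case: n => [|n]; [|case: m => [|m]] => hs _ hj.
- case: j hj => // j _.
  have [k Kk ->] := mixed_sum_swap l1 0 l2 m l3 j.+1; apply: spanZ => //.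
  rewrite add0n in hs; rewrite -hs.
  have := @mixed_sum_right l1 l2 m l3 j; rewrite hs => /(_ isT); apply: shuffle_gen_perm.
  by rewrite perm_catCA.
- case: j hj => // j _; rewrite addn0 in hs; rewrite -hs.
  by apply: mixed_sum_right.
have -> : mixed_sum l1 n.+1 l2 m.+1 l3 j = mixed_sum l1 n l2 m.+1 l3 j.+1 - mixed_sum l1 n.+1 l2 m l3 j.+1.
  apply: seq_ext => d t.
  rewrite -[RHS]/(mixed_sum l1 n l2 m.+1 l3 j.+1 d t - mixed_sum l1 n.+1 l2 m l3 j.+1 d t).
  rewrite /mixed_sum -sumrB; apply: eq_bigr => a _; rewrite -sumrB; apply: eq_bigr => b nba.
  have ha : imc a != 0 := mon_img_neq0 (@io_inj _ _ C) a.
  have hb : imc b != 0 := mon_img_neq0 (@io_inj _ _ C) b.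
  have hab : imc a - imc b != 0 by rewrite subr_eq0 (inj_eq (@mon_img_inj _ _ _ (@io_inj _ _ C) d)) eq_sym.
  rewrite -mulrBr; congr (_ * _); move: ha hb hab.
  move: (imc a) (imc b) => x y hx hy hxy; rewrite !exprS.
  have hxn := expf_neq0 n hx; have hym := expf_neq0 m hy; have hzj := expf_neq0 j hxy.
  by field; rewrite hx hy hxy hxn hym hzj.
have s0 : (0 < s)%N by lia.
have -> : (s.+1 + j = s + j.+1)%N by lia.
by apply: spanB; apply: IH => //; lia.
Qed.

Lemma powsumM l n l' n' : (0 < n)%N -> (0 < n')%N ->
  exists2 u, Kspan (shuffle_gen (l ++ l') (n + n')) u &
    powsum (cmap l) n * powsum (cmap l') n' = powsum (cmap (l ++ l')) (n + n') + u.
Proof.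
move=> n0 n0'; exists (mixed_sum l n l' n' [::] 0).
  have := @mixed_sum_span (n + n') l n l' n' [::] 0 erefl; rewrite cats0 addn0 => h.
  by apply: h; rewrite ?addn_gt0 ?n0 ?n0'.
apply: seq_ext => d t.
rewrite -[LHS]/(powsum (cmap l) n d t * powsum (cmap l') n' d t).
rewrite -[RHS]/(powsum (cmap (l ++ l')) (n + n') d t + mixed_sum l n l' n' [::] 0 d t).
rewrite !powsum_cmap mulr_suml -big_split; apply: eq_bigr => a _ /=.
rewrite mulr_sumr (bigD1 a) //=; congr (_ + _).
  by rewrite chi_seq_cat exprD invfM; ring.
apply: eq_bigr => b _; rewrite /chi_seq [\prod_(j <- [::]) _]big_nil expr0 !mulr1 invfM; ring.
Qed.

Lemma shuffle_gen_Vspan l n u : shuffle_gen l n u -> Vspan (cmap l) n u.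
Proof.
move=> [l' [l'' [n' [n'' [-> n0 n0' pl ->]]]]].
by rewrite -(cmap_perm pl) cmap_cat; apply: powsum_mulW => //; apply: powsum_Wspan.
Qed.

(** Induction on the total weight: by [partial_sumM] a product of two multiple sums
    reduces to products of smaller total weight, multiplied by a power sum or by
    the product of two power sums of the same degree; the latter is given by
    [powsumM]. *)
Lemma WspanM_upto N : forall s n s' n' (u v : seqt), (n + n' <= N)%N -> Wspan s n u -> Wspan s' n' v ->
  Wspan (cplus s s') (n + n') (u * v).
Proof.
elim: N => [|N IH] s n s' n' u v hN.
all: apply: span_mul => _ _ [c Ac ->] [c' Ac' ->].
all: move: c c' Ac Ac' => [|[s1 n1] c] [|[s1' n1'] c'] Ac Ac'.
all: try by have [-> ->] := adm_nil_inv Ac; rewrite cplus0s mul1r; apply: span_gen; exists [::].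
all: try by have [-> ->] := adm_nil_inv Ac; rewrite cplus0s mul1r; apply: span_gen; exists ((s1', n1') :: c').
all: try by have [-> ->] := adm_nil_inv Ac'; rewrite cplus0 addn0 mulr1; apply: span_gen; exists ((s1, n1) :: c).
all: have [s2 [n2 [n10 Ac2 es en]]] := adm_cons_inv Ac.
all: have [s2' [n2' [n10' Ac2' es' en']]] := adm_cons_inv Ac'.
  by exfalso; lia.
have Wc : Wspan s2 n2 (mzsum c : seqt) by apply: span_gen; exists c.
have Wc' : Wspan s2' n2' (mzsum c' : seqt) by apply: span_gen; exists c'.
have Wcc : Wspan s n (mzsum ((s1, n1) :: c) : seqt) by apply: span_gen; exists ((s1, n1) :: c).
have Wcc' : Wspan s' n' (mzsum ((s1', n1') :: c') : seqt) by apply: span_gen; exists ((s1', n1') :: c').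
rewrite !mzsum_cons partial_sumM; apply: Vspan_partial_sum.
rewrite -!mzsum_cons /=.
apply: spanD; first apply: spanD.
- rewrite -mulrA es en -cplusA -addnA; apply: powsum_mulW => //.
  by rewrite -/(mzsum ((s1', n1') :: c') : seqt); apply: IH => //; lia.
- rewrite seq_mulCA -/(mzsum ((s1, n1) :: c) : seqt) es' en'.
  have -> : cplus s (cplus s1' s2') = cplus s1' (cplus s s2') by rewrite cplusA [cplus s _]cplusC -cplusA.
  have -> : (n + (n1' + n2') = n1' + (n + n2'))%N by lia.
  by apply: powsum_mulW => //; apply: IH => //; lia.
have [l1 e1] := cmap_surj s1; have [l1' e1'] := cmap_surj s1'.
have Wcm : Wspan (cplus s2 s2') (n2 + n2') ((mzsum c : seqt) * (mzsum c' : seqt)) by apply: IH => //; lia.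
rewrite seq_mulACA; have -> : cplus s s' = cplus (cmap (l1 ++ l1')) (cplus s2 s2').
  by rewrite cmap_cat -e1 -e1' es es'; apply: compmapP => j; rewrite !cplusE; lia.
have -> : (n + n' = (n1 + n1') + (n2 + n2'))%N by lia.
have [w Tw] := powsumM l1 l1' n10 n10'; rewrite -e1 -e1' => ->.
rewrite mulrDl; apply: spanD.
  apply: powsum_mulW => //; lia.
apply: (span_mul _ Tw Wcm) => _ _ [l2 [l2' [m1 [m2 [-> m10 m20 pl em]]]]] [c2 Ac22 ->].
rewrite -(cmap_perm pl) cmap_cat em -cplusA -addnA -mulrA; apply: powsum_mulW => //.
apply: IH; [lia|exact: powsum_Wspan|].
by apply: span_gen; exists c2.
Qed.

Lemma WspanM s n s' n' (u v : seqt) : Wspan s n u -> Wspan s' n' v -> Wspan (cplus s s') (n + n') (u * v).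
Proof. exact: (@WspanM_upto (n + n')). Qed.

Lemma VspanMW s n s' n' (u v : seqt) : Vspan s n u -> Wspan s' n' v -> Vspan (cplus s s') (n + n') (u * v).
Proof.
move=> Vu Wv; apply: (span_mul _ Vu Wv) => _ _ [[|[s1 n1] c] [// _ Ac] ->] [c' Ac' ->].
have [s2 [n2 [n10 Ac2 -> ->]]] := adm_cons_inv Ac.
rewrite -cplusA -addnA /= -mulrA; apply: powsum_mulW => //.
by apply: WspanM; apply: span_gen; [exists c|exists c'].
Qed.

Lemma powsumM_Vspan s n s' n' : (0 < n)%N -> (0 < n')%N ->
  Vspan (cplus s s') (n + n') (powsum s n * powsum s' n' : seqt).
Proof.
move=> n0 n0'; have [l ->] := cmap_surj s; have [l' ->] := cmap_surj s'.
have [u Tu ->] := powsumM l l' n0 n0'; rewrite -cmap_cat; apply: spanD.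
  by apply: powsum_Vspan; rewrite addn_gt0 n0.
by apply: span_sub Tu => g; apply: shuffle_gen_Vspan.
Qed.

Lemma VspanM s n s' n' (u v : seqt) : Vspan s n u -> Vspan s' n' v -> Vspan (cplus s s') (n + n') (u * v).
Proof.
move=> Vu Vv; apply: (span_mul _ Vu Vv) => _ _ [[|[s1 n1] c] [// _ Ac] ->] [[|[s1' n1'] c'] [// _ Ac'] ->].
have [s2 [n2 [n10 Ac2 -> ->]]] := adm_cons_inv Ac.
have [s2' [n2' [n10' Ac2' -> ->]]] := adm_cons_inv Ac'.
have -> : cplus (cplus s1 s2) (cplus s1' s2') = cplus (cplus s1 s1') (cplus s2 s2').
  by apply: compmapP => j; rewrite !cplusE; lia.
have -> : ((n1 + n2) + (n1' + n2') = (n1 + n1') + (n2 + n2'))%N by lia.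
rewrite /= seq_mulACA; apply: VspanMW; first exact: powsumM_Vspan.
by apply: WspanM; apply: span_gen; [exists c|exists c'].
Qed.
End Harmonic.

(** * Stability of truncated sums under tau *)

Lemma sum_ord_range (U : zmodType) (P : pred nat) (f : nat -> U) a b :
  (forall k, P k -> (a <= k)%N || (b <= k)%N -> f k = 0) ->
  \sum_(k < a | P k) f k = \sum_(k < b | P k) f k.
Proof.
have E m M : (m <= M)%N -> (forall k, P k -> (m <= k)%N -> f k = 0) ->
    \sum_(k < m | P k) f k = \sum_(k < M | P k) f k.
  move=> mM h; rewrite (big_ord_widen_cond _ P f mM) [RHS](bigID (fun k : 'I_M => (k < m)%N)) /=.
  by rewrite [X in _ = _ + X]big1 ?addr0 // => k /andP[Pk]; rewrite -leqNgt; apply: h.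
move=> h; rewrite (E a (maxn a b)) ?leq_maxl // => [|k Pk ak]; last by apply: h; rewrite ?ak.
by rewrite -(E b (maxn a b)) ?leq_maxr // => k Pk bk; apply: h; rewrite ?bk ?orbT.
Qed.

Section TauStable.
Variables (R : realType) (F : finFieldType) (C : Cinfty R F).
Notation q := #|F|.
Notation seqt := (nat -> tfun C).
Notation io := (embC C).
Notation io_inj := (@io_inj R F C).
Notation th := (theta_img io).
Notation ell := (carlitz_ell io).
Notation bb := (carlitz_b io).
Notation HH := (carlitz_H io).
Notation hh := (carlitz_h io).
Notation DD := (carlitz_D io).
Notation EE := (carlitz_E io).

Lemma in_K_theta : in_K th. Proof. exact: in_K_io. Qed.
Lemma in_K_ell d : in_K (ell d).
Proof.
by apply: in_K_prod => i _; apply: in_KD; [|apply/in_KN/in_KX]; apply: in_K_theta.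
Qed.
Lemma in_K_carlitz_D k : in_K (DD k).
Proof.
elim: k => [|k IH] /=; first exact: in_K1.
by apply: in_KM; [apply: in_KD; [apply: in_KX|apply: in_KN]; apply: in_K_theta|apply: in_KX].
Qed.

(** A bound on the degree of the polynomials that compute a |-> a(t) on the monic
    polynomials of degree d. It is 0 for d = 0 and q^(d-1) otherwise, so that fewer
    than q such factors stay within the range of interpolation. *)
Definition deg_bound d := if d is d'.+1 then (q ^ d')%N else 0%N.

Lemma size_prod_deg_bound d I (l : seq I) (P : I -> {poly C}) :
  (size l < q)%N -> (forall i, (size (P i) <= (deg_bound d).+1)%N) ->
  (size (\prod_(i <- l) P i)%R <= q ^ d)%N.
Proof.
move=> sl sP; have H : (size (\prod_(i <- l) P i)%R <= (size l * deg_bound d).+1)%N.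
  elim: l {sl} => [|i l IH]; first by rewrite big_nil size_poly1.
  rewrite big_cons (leq_trans (size_polyMleq _ _)) //=.
  have := sP i; move: IH; rewrite mulSn.
  move: (size (P i)) (size _) (deg_bound d) => x y z; lia.
apply: (leq_trans H); case: d {H sP} => [|d] /=; first by rewrite muln0.
rewrite expnS; have := qX_gt0 F d; move: sl; move: (q ^ d)%N (size l) q => x y z; nia.
Qed.

(** The Newton expansion of a(x) for a monic of degree d, as a polynomial in a:
    as E_d(a) = 1, its last term is the constant b_d(x). *)
Definition newton_poly d (x : C) : {poly C} := (bb d x)%:P + \sum_(i < d) bb i x *: EE i.

Lemma size_carlitz_E i : (size (EE i) <= (q ^ i).+1)%N.
Proof.
apply: (leq_trans (size_sum _ _ _)); apply/bigmax_leqP => k _.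
apply: (leq_trans (size_scale_leq _ _)); rewrite size_polyXn ltnS.
by rewrite leq_exp2l ?q_gt1 // -ltnS.
Qed.

Lemma size_carlitz_E_bound i d : (i < d)%N -> (size (EE i) <= (deg_bound d).+1)%N.
Proof.
case: d => // d lid; apply: (leq_trans (size_carlitz_E i)).
by rewrite /= ltnS leq_exp2l ?q_gt1.
Qed.

Lemma size_newton_poly d x : (size (newton_poly d x) <= (deg_bound d).+1)%N.
Proof.
apply: (leq_trans (size_polyD _ _)); rewrite geq_max; apply/andP; split.
  by apply: (leq_trans (size_polyC_leq1 _)).
apply: (leq_trans (size_sum _ _ _)); apply/bigmax_leqP => i _.
by apply: (leq_trans (size_scale_leq _ _)); apply: size_carlitz_E_bound.
Qed.

Lemma newton_polyE d x (a : {poly_d F}) : (newton_poly d x).[mon_img io a] = peval io (mon a) x.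
Proof.
rewrite (carlitz_newton io_inj (N := d.+1)) ?size_mon // big_ord_recr /=.
rewrite -/(mon_img io a) carlitz_E_monic; last exact: io_inj.
rewrite mul1r addrC hornerD hornerC horner_sum; congr (_ + _).
by apply: eq_bigr => i _; rewrite hornerZ mulrC.
Qed.

Definition interp_poly l d (t : posnat -> C) := \prod_(j <- l) newton_poly d (t j).

Lemma powsum_interp l n d t : powsum (cmap l) n d t = poly_powsum io d n (interp_poly l d t).
Proof.
rewrite powsum_cmap; apply: eq_bigr => a _; congr (_ / _).
by rewrite /interp_poly horner_prod; apply: eq_bigr => j _; rewrite newton_polyE.
Qed.

Lemma powsum_rec l n d t : (size l < q)%N ->
  powsum (cmap l) n.+1 d t = (interp_poly l d t)`_n / ell d +
    \sum_(k < n.+1 | (q ^ k <= n)%N) hh k d * powsum (cmap l) (n.+1 - q ^ k) d t :> C.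
Proof.
move=> sl; rewrite powsum_interp poly_powsum_rec; [|exact: io_inj|]; last first.
  by apply: size_prod_deg_bound => // j; apply: size_newton_poly.
congr (_ + _).
rewrite (sum_ord_range (P := fun k => (q ^ k <= n)%N) (f := fun k => hh k d * poly_powsum io d (n.+1 - q ^ k) (interp_poly l d t)) (b := n.+1)).
  by apply: eq_bigr => k _; rewrite powsum_interp.
move=> k kn /orP[dk|nk]; first by rewrite /carlitz_h carlitz_H_out // !mul0r.
by have := ltn_expl k (q_gt1 F); lia.
Qed.

Lemma newton_poly_coef0 d x : (newton_poly d x)`_0 = bb d x.
Proof.
rewrite -horner_coef0 hornerD hornerC horner_sum big1 ?addr0 // => i _.
by rewrite hornerZ carlitz_E_at0 mulr0.
Qed.

Lemma powsum1 l d t : (size l < q)%N -> powsum (cmap l) 1 d t = (\prod_(j <- l) bb d (t j)) / ell d :> C.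
Proof.
move=> sl; rewrite powsum_rec // [X in _ + X]big_pred0 ?addr0 => [|k]; last by apply/negbTE; rewrite -ltnNge qX_gt0.
rewrite -horner_coef0 horner_prod; congr (_ / _).
by apply: eq_bigr => j _; rewrite horner_coef0 newton_poly_coef0.
Qed.

(** For n at most q, only the term k = 0 of the recursion survives, so that the
    sum over monic a of a^(-n) is the n-th power of the sum of a^(-1). *)
Lemma powsum_cnil n d t : (0 < n <= q)%N -> powsum cnil n d t = ell d ^- n :> C.
Proof.
rewrite -cmap_nil; case: n => // n.
elim: n => [|n IH] /andP[_ hn].
  by rewrite powsum1 ?q_gt0 // big_nil mul1r expr1.
rewrite powsum_rec ?q_gt0 // /interp_poly big_nil coef1 mul0r add0r.
rewrite (bigD1 ord0) //= big1 ?addr0.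
  by rewrite carlitz_h0 expn0 subn1 IH ?(ltnW hn) // [in RHS]exprS invfM.
move=> k /andP[hk k0]; exfalso.
have : (q ^ 1 <= q ^ k)%N by rewrite leq_exp2l ?q_gt1 // lt0n.
by rewrite expn1 => h; have := leq_trans hn (leq_trans h hk); rewrite ltnn.
Qed.

(** In terms of ell_d, each power sum is ell_e^(1-q), and the sum telescopes since
    theta - theta^(q^(d+2)) = (theta - theta^q) + (theta - theta^(q^(d+1)))^q. *)
Lemma sum_powsum_q1 d t : partial_sum (powsum cnil q.-1) d.+1 t = ell d.+1 / (ell 1 * ell d ^+ q) :> C.
Proof.
have q1 := q_gt1 F; have n0 := ell_neq0 io_inj.
elim: d => [|d IH].
  rewrite partial_sumS partial_sum_at0 add0r powsum_cnil ?ell0 ?expr1n ?invr1 ?mulr1; last lia.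
  by rewrite divff.
rewrite partial_sumS IH powsum_cnil; last lia.
have -> : (ell d.+1 ^- q.-1 = ell d.+1 / ell d.+1 ^+ q).
  by rewrite -[in RHS](prednK (ltnW q1)) exprS invfM mulVKf //.
have hx := theta_frob_neq io_inj d; have h1 := theta_frob_neq io_inj 0.
have hu := expf_neq0 q hx; have he := expf_neq0 q (n0 d).
have -> : ell d.+2 = ell d.+1 * (ell 1 + (th - th ^+ (q ^ d.+1)) ^+ q).
  rewrite ellS; congr (_ * _); rewrite ellS ell0 mul1r (frobE F (_ - th ^+ (q ^ d.+1))).
  by rewrite (frobB io) frobX addn1 expn1; ring.
rewrite (ellS _ d) ellS ell0 mul1r exprMn; move: hx h1 hu he (n0 d).
move: (th - th ^+ (q ^ d.+1)) => x; move: (th - th ^+ (q ^ 1)) => y.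
move: (x ^+ q) (ell d ^+ q) (ell d) => xq eq e hx hy hu he hn.
by field; rewrite hu he hy.
Qed.

Definition frob_pt (t : posnat -> C) : posnat -> C := fun j => t j ^+ q.

Definition Lfactor (s : compmap) (t : posnat -> C) : C :=
  \prod_(j <- finsupp s) (t j - th) ^+ s j.

Lemma Lfactor_cmap l t : Lfactor (cmap l) t = \prod_(j <- l) (t j - th).
Proof. exact: (cprod_cmap (fun j => t j - th)). Qed.

Lemma Lfactor_cplus s s' t : Lfactor (cplus s s') t = Lfactor s t * Lfactor s' t.
Proof.
have [l ->] := cmap_surj s; have [l' ->] := cmap_surj s'.
by rewrite -cmap_cat !Lfactor_cmap big_cat.
Qed.

Lemma Lfactor_cnil t : Lfactor cnil t = 1.
Proof. by rewrite -cmap_nil Lfactor_cmap big_nil. Qed.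

(** At the point frob_pt t, the value of tau v is the q-th power of v(t), so that no
    expansion of v is involved. The index is shifted by one because
    (t - theta) tau(b_d) = b_(d+1). *)
Definition tau_rel s (v v' : seqt) := forall d t,
  v' d.+1 (frob_pt t) = Lfactor s (frob_pt t) * v d t ^+ q.

(** The vanishing at index 0 makes the shift compatible with partial sums. *)
Definition tau_stableV s n (v : seqt) : Prop := exists v' : seqt,
  [/\ Vspan s (q * n) v', forall t, v' 0%N t = 0 & tau_rel s v v'].

Definition tau_stableW s n (w : seqt) : Prop :=
  exists2 w' : seqt, Wspan s (q * n) w' & tau_rel s w w'.

Lemma frobq0 : 0 ^+ q = 0 :> C. Proof. by rewrite (frobE F) frob0. Qed.
Lemma frobqD (x y : C) : (x + y) ^+ q = x ^+ q + y ^+ q.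
Proof. by rewrite !(frobE F) (frobD io). Qed.
Lemma frobq_sum I (r : seq I) (P : pred I) (f : I -> C) :
  (\sum_(i <- r | P i) f i) ^+ q = \sum_(i <- r | P i) f i ^+ q.
Proof. by rewrite (big_morph _ frobqD frobq0). Qed.

Lemma tau_rel0 s : tau_rel s 0 0.
Proof. by move=> d t; rewrite -[X in X ^+ q]/(0 : C) frobq0 mulr0. Qed.

Lemma tau_rel_lin s k u v u' v' : tau_rel s u u' -> tau_rel s v v' ->
  tau_rel s (seq_cst k * u + v) (seq_cst (k ^+ q) * u' + v').
Proof.
move=> uE vE d t; rewrite -[LHS]/(k ^+ q * u' d.+1 (frob_pt t) + v' d.+1 (frob_pt t)) uE vE.
by rewrite -[(_ + _ : seqt) d t]/(k * u d t + v d t) frobqD exprMn; ring.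
Qed.

Lemma tau_rel_mul s s' v w v' w' : tau_rel s v v' -> tau_rel s' w w' ->
  tau_rel (cplus s s') (v * w) (v' * w').
Proof.
move=> vE wE d t; rewrite -[LHS]/(v' d.+1 (frob_pt t) * w' d.+1 (frob_pt t)) vE wE.
by rewrite Lfactor_cplus -[(_ * _ : seqt) d t]/(v d t * w d t) exprMn; ring.
Qed.

Lemma tau_stableV0 s n : tau_stableV s n 0.
Proof. by exists 0; split=> //; [exact: span0|exact: tau_rel0]. Qed.

Lemma tau_stableV_lin s n k u v : in_K k -> tau_stableV s n u -> tau_stableV s n v -> tau_stableV s n (seq_cst k * u + v).
Proof.
move=> Kk [u' [Vu u0 uE]] [v' [Vv v0 vE]]; exists (seq_cst (k ^+ q) * u' + v'); split.
- by apply: spanD => //; apply: spanZ => //; apply: in_KX.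
- by move=> t; rewrite -[LHS]/(k ^+ q * u' 0%N t + v' 0%N t) u0 v0 mulr0 addr0.
exact: tau_rel_lin.
Qed.

Lemma tau_stableVZ s n k u : in_K k -> tau_stableV s n u -> tau_stableV s n (seq_cst k * u).
Proof. by move=> Kk su; rewrite -[_ * u]addr0; apply: tau_stableV_lin => //; apply: tau_stableV0. Qed.

Lemma tau_stableVD s n u v : tau_stableV s n u -> tau_stableV s n v -> tau_stableV s n (u + v).
Proof.
by move=> su sv; rewrite -[u]mul1r -seq_cst1; apply: tau_stableV_lin => //; apply: in_K1.
Qed.

Lemma tau_stableV_sum s n I (r : seq I) (P : pred I) (f : I -> seqt) :
  (forall i, P i -> tau_stableV s n (f i)) -> tau_stableV s n (\sum_(i <- r | P i) f i).
Proof. by move=> h; elim/big_rec: _ => [|i x Pi Kx]; [apply: tau_stableV0|apply: tau_stableVD; auto]. Qed.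

Lemma tau_stableW0 s n : tau_stableW s n 0.
Proof. by exists 0; [exact: span0|exact: tau_rel0]. Qed.

Lemma tau_stableW_lin s n k u v : in_K k -> tau_stableW s n u -> tau_stableW s n v -> tau_stableW s n (seq_cst k * u + v).
Proof.
move=> Kk [u' Wu uE] [v' Wv vE]; exists (seq_cst (k ^+ q) * u' + v'); last exact: tau_rel_lin.
by apply: spanD => //; apply: spanZ => //; apply: in_KX.
Qed.

Lemma tau_stableVW s n s' n' v w : tau_stableV s n v -> tau_stableW s' n' w -> tau_stableV (cplus s s') (n + n') (v * w).
Proof.
move=> [v' [Vv v0 vE]] [w' Ww wE]; exists (v' * w'); split; last exact: tau_rel_mul.
- by rewrite mulnDr; apply: VspanMW.
- by move=> t; rewrite -[LHS]/(v' 0%N t * w' 0%N t) v0 mul0r.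
Qed.

Lemma tau_stableVV s n s' n' v w : tau_stableV s n v -> tau_stableV s' n' w -> tau_stableV (cplus s s') (n + n') (v * w).
Proof.
move=> [v' [Vv v0 vE]] [w' [Vw _ wE]]; exists (v' * w'); split; last exact: tau_rel_mul.
- by rewrite mulnDr; apply: VspanM.
- by move=> t; rewrite -[LHS]/(v' 0%N t * w' 0%N t) v0 mul0r.
Qed.

Lemma tau_stable_partial_sum s n v : tau_stableV s n v -> tau_stableW s n (partial_sum v).
Proof.
move=> [v' [Vv v0 vE]]; exists (partial_sum v'); first exact: Vspan_partial_sum.
move=> d t; rewrite /partial_sum big_ord_recl v0 add0r frobq_sum mulr_sumr.
by apply: eq_bigr => e _; rewrite /= vE.
Qed.

Lemma tau_stableW1 : tau_stableW cnil 0 1.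
Proof.
exists 1; first by rewrite muln0; apply: Wspan1.
by move=> d t; rewrite Lfactor_cnil mul1r -[(1 : seqt) d t]/(1 : C) expr1n.
Qed.

(** The hypothesis on the number of variables, in a form inherited by the columns
    of a composition array. *)
Definition few_vars (s : compmap) := exists2 l, s = cmap l & (size l < q)%N.

Lemma few_vars_cplus s s' : few_vars (cplus s s') -> few_vars s /\ few_vars s'.
Proof.
move=> [l el hl]; have [l1 e1] := cmap_surj s; have [l2 e2] := cmap_surj s'.
have p : perm_eq (l1 ++ l2) l.
  by apply/allP => j _ /=; apply/eqP; rewrite -!cmapE -el e1 e2 cmap_cat.
have := perm_size p; rewrite size_cat => sz.
by split; [exists l1|exists l2] => //; apply: leq_ltn_trans hl; rewrite -sz ?leq_addr ?leq_addl.
Qed.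

Definition stable_upto N := forall s n,
  few_vars s -> (0 < n <= N)%N -> tau_stableV s n (powsum s n).

(** Power sums generate: this reduces the stability of multiple sums of weight at
    most N to that of power sums, and is applied inside the induction that proves
    the latter. *)
Lemma mzsum_tau_stable N : stable_upto N ->
  forall c s n, few_vars s -> (n <= N)%N -> admissible s n c -> tau_stableW s n (mzsum c).
Proof.
move=> H; elim=> [|[s1 n1] c IH] s n fs nN Ac.
  by have [-> ->] := adm_nil_inv Ac; apply: tau_stableW1.
have [s2 [n2 [n10 Ac2 es en]]] := adm_cons_inv Ac; subst s n.
have [f1 f2] := few_vars_cplus fs.
apply: tau_stable_partial_sum; apply: tau_stableVW; first by apply: H => //; rewrite n10; lia.
by apply: IH => //; lia.
Qed.

Lemma Wspan_tau_stable_upto N : stable_upto N ->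
  forall s n w, few_vars s -> (n <= N)%N -> Wspan s n w -> tau_stableW s n w.
Proof.
move=> H s n w fs nN; elim=> [|k g u Kk [c Ac ->] _ IH]; first exact: tau_stableW0.
by apply: tau_stableW_lin => //; apply: (mzsum_tau_stable H fs nN Ac).
Qed.

Lemma cplus_cnil s s' : cnil = cplus s s' -> s = cnil /\ s' = cnil.
Proof.
by move=> h; split; apply: compmapP => j; move: (congr1 (fun s : compmap => s j) h);
  rewrite cplusE !cnilE; lia.
Qed.

Lemma mzsum_cnil c n d t t' : admissible cnil n c -> mzsum c d t = mzsum c d t' :> C.
Proof.
elim: c n d => // -[s1 n1] c IH n d Ac.
have [s2 [n2 [n10 Ac2 es en]]] := adm_cons_inv Ac.
have [e1 e2] := cplus_cnil es.
subst s1 s2; apply: eq_bigr => e _.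
rewrite -[LHS]/(powsum cnil n1 e t * mzsum c e t) -[RHS]/(powsum cnil n1 e t' * mzsum c e t').
rewrite (IH n2) //; congr (_ * _); rewrite -cmap_nil !powsum_cmap.
by apply: eq_bigr => a _; rewrite /chi_seq !big_nil.
Qed.

Lemma Wspan_cnil n (w : seqt) d t t' : Wspan cnil n w -> w d t = w d t'.
Proof.
elim=> // k g u _ [c Ac ->] _ IH.
by rewrite -[LHS]/(k * mzsum c d t + u d t) IH (mzsum_cnil _ _ t' Ac).
Qed.

(** The Frobenius acts on the coefficients of the E_d within the algebra of
    truncated sums. The denominator ell_(d+1) is the inverse of a power sum of
    weight 1, which is multiplied by w to reach weight q^(k+1). *)
Definition tau_H k := exists w : seqt, [/\ Wspan cnil (q ^ k.+1).-1 w,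
  forall t, w 0%N t = 0 & forall d t, HH k d ^+ q = w d.+1 t / ell d.+1].

Lemma powsum_cnil1 d t : powsum cnil 1 d t = (ell d)^-1 :> C.
Proof. by rewrite powsum_cnil ?q_gt1 ?expr1 //= ltnW ?q_gt1. Qed.

Definition ell_ratio : seqt := seq_cst (ell 1) * partial_sum (powsum cnil q.-1).

Lemma ell_ratio_Wspan : Wspan cnil q.-1 ell_ratio.
Proof.
apply: spanZ; first exact: in_K_ell.
by apply: powsum_Wspan; have := q_gt1 F; lia.
Qed.

Lemma ell_ratio0 t : ell_ratio 0 t = 0.
Proof. by rewrite -[LHS]/(ell 1 * partial_sum _ 0 t) partial_sum_at0 mulr0. Qed.

Lemma ell_ratioE d t : ell_ratio d.+1 t = ell d.+1 / ell d ^+ q.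
Proof.
rewrite -[LHS]/(ell 1 * partial_sum _ d.+1 t) sum_powsum_q1 invfM.
have := ell_neq0 io_inj 1 => h1; have := expf_neq0 q (ell_neq0 io_inj d) => h2.
by field; rewrite h1 h2.
Qed.

Lemma tau_H0 : tau_H 0.
Proof.
exists ell_ratio; split; [by rewrite expn1; apply: ell_ratio_Wspan|exact: ell_ratio0|].
move=> d t; rewrite ell_ratioE mulrAC divff ?mul1r; last exact: ell_neq0 io_inj _.
by rewrite carlitz_HE // subn0 expn0 expr1 exprVn.
Qed.

(** The sequence given by tau_H k computes H_(k+1)(d) as w(d) / ell_d; here w has
    weight q^(k+1) - 1 <= N, so that the tau-stability of w is covered by the
    induction hypothesis. *)
Lemma tau_HS N k : stable_upto N ->
  (q ^ k.+1 <= N.+1)%N -> tau_H k -> tau_H k.+1.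
Proof.
move=> H hN [w [Ww w0 wE]].
have few0 : few_vars cnil by exists [::]; rewrite ?cmap_nil ?q_gt0.
have [|w' Ww' wE'] := Wspan_tau_stable_upto H few0 _ Ww; first by have := qX_gt0 F k.+1; lia.
exists (ell_ratio * w'); split.
- have -> : ((q ^ k.+2).-1 = q.-1 + q * (q ^ k.+1).-1)%N.
    by rewrite (expnS _ k.+1); have := qX_gt0 F k.+1; have := q_gt1 F; nia.
  by have := WspanM ell_ratio_Wspan Ww'; rewrite cplus0.
- by move=> t; rewrite -[LHS]/(ell_ratio 0 t * w' 0 t) ell_ratio0 mul0r.
move=> d t; rewrite -[X in X / _]/(ell_ratio d.+1 t * w' d.+1 t) (Wspan_cnil _ t (frob_pt t) Ww').
rewrite wE' Lfactor_cnil mul1r ell_ratioE.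
have -> : HH k.+1 d = w d t / ell d.
  case: d => [|d]; first by rewrite w0 mul0r carlitz_H_out.
  by rewrite -carlitz_H_frob.
have h1 := ell_neq0 io_inj d.+1; have h2 := expf_neq0 q (ell_neq0 io_inj d).
by rewrite exprMn exprVn; field; rewrite h1 h2.
Qed.

Definition seqH k : seqt := fun d _ => HH k d.

Lemma seqH_tau_stable k : tau_H k -> tau_stableV cnil (q ^ k) (seqH k).
Proof.
move=> [w [Ww w0 wE]]; exists (powsum cnil 1 * w); split.
- have -> : (q * q ^ k = 1 + (q ^ k.+1).-1)%N.
    by rewrite -expnS; have := qX_gt0 F k.+1; lia.
  by have := powsum_mulW cnil (isT : (0 < 1)%N) Ww; rewrite cplus0.
- by move=> t; rewrite -[LHS]/(powsum cnil 1 0 t * w 0 t) w0 mulr0.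
move=> d t; rewrite -[LHS]/(powsum cnil 1 d.+1 (frob_pt t) * w d.+1 (frob_pt t)) powsum_cnil1.
by rewrite Lfactor_cnil mul1r (wE d (frob_pt t)) mulrC.
Qed.

(** D_k times the coefficient of X^(q^k) in the Newton polynomial of the variable
    t_j ([newton_poly_seqG]). *)
Definition seqG k j : seqt := fun d t => \sum_(i < d) bb i (t j) * HH k i.

Lemma carlitz_b_frob i (x : C) : (x ^+ q - th) * bb i x ^+ q = bb i.+1 (x ^+ q).
Proof.
rewrite /carlitz_b big_ord_recl expn0 expr1; congr (_ * _).
rewrite -prodrXl; apply: eq_bigr => e _.
by rewrite /= /bump add1n !(frobE F) (frobB io) frobX addn1.
Qed.

Lemma seqG_tau_stable k j : tau_H k -> tau_stableW (cmap [:: j]) (q ^ k) (seqG k j).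
Proof.
move=> [w [Ww w0 wE]]; exists (partial_sum (powsum (cmap [:: j]) 1 * w)).
  apply: Vspan_partial_sum; have -> : (q * q ^ k = 1 + (q ^ k.+1).-1)%N.
    by rewrite -expnS; have := qX_gt0 F k.+1; lia.
  by have := powsum_mulW (cmap [:: j]) (isT : (0 < 1)%N) Ww; rewrite cplus0.
move=> d t; rewrite /partial_sum big_ord_recl.
rewrite -[X in X + _]/(powsum (cmap [:: j]) 1 0 (frob_pt t) * w 0 (frob_pt t)) w0 mulr0 add0r.
rewrite Lfactor_cmap big_seq1 /seqG frobq_sum mulr_sumr; apply: eq_bigr => i _.
rewrite -[LHS]/(powsum (cmap [:: j]) 1 i.+1 (frob_pt t) * w i.+1 (frob_pt t)).
rewrite powsum1 ?q_gt1 // big_seq1 -carlitz_b_frob exprMn (wE i (frob_pt t)) /frob_pt.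
by rewrite -/(frob_pt t) mulrA; ring.
Qed.

Lemma powsum1_tau_stable l : (size l < q)%N -> tau_stableV (cmap l) 1 (powsum (cmap l) 1).
Proof.
move=> sl; exists (powsum (cmap l) 1 * ell_ratio); split.
- have -> : (q * 1 = 1 + q.-1)%N by have := q_gt1 F; lia.
  by have := powsum_mulW (cmap l) (isT : (0 < 1)%N) ell_ratio_Wspan; rewrite cplus0.
- by move=> t; rewrite -[LHS]/(powsum (cmap l) 1 0 t * ell_ratio 0 t) ell_ratio0 mulr0.
move=> d t; rewrite -[LHS]/(powsum (cmap l) 1 d.+1 (frob_pt t) * ell_ratio d.+1 (frob_pt t)).
rewrite ell_ratioE !powsum1 // exprMn exprVn Lfactor_cmap.
have h1 := ell_neq0 io_inj d.+1; have h2 := expf_neq0 q (ell_neq0 io_inj d).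
have -> : \prod_(j <- l) bb d.+1 (frob_pt t j) =
    (\prod_(j <- l) (frob_pt t j - th)) * (\prod_(j <- l) bb d (t j)) ^+ q.
  by rewrite -prodrXl -big_split; apply: eq_bigr => j _; rewrite -carlitz_b_frob.
by field; rewrite h1 h2.
Qed.

(** A coefficient of the interpolated product, divided by ell_d, in which the
    constant terms b_d of the variables in l' have been chosen already. *)
Definition coef_seq l' l m : seqt := fun d t =>
  (\prod_(j <- l') bb d (t j)) / ell d * (interp_poly l d t)`_m.

Lemma newton_poly_seqG d j t : newton_poly d (t j) = (bb d (t j))%:P + \sum_(k < d) (seqG k j d t / DD k) *: 'X^(q ^ k) :> {poly C}.
Proof.
rewrite /newton_poly; congr (_ + _).
have -> : \sum_(i < d) bb i (t j) *: EE i =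
    \sum_(i < d) \sum_(k < d) (bb i (t j) * hh k i) *: 'X^(q ^ k).
  apply: eq_bigr => i _; rewrite /carlitz_E scaler_sumr.
  rewrite (sum_ord_range (P := predT) (f := fun k => bb i (t j) *: (hh k i *: 'X^(q ^ k))) (b := d)).
    by apply: eq_bigr => k _; rewrite scalerA.
  move=> k _ h; rewrite /carlitz_h carlitz_H_out ?mul0r ?scale0r ?scaler0 //.
  by case/orP: h => // h; apply: leq_trans h.
rewrite exchange_big; apply: eq_bigr => k _ /=; rewrite -scaler_suml; congr (_ *: _).
by rewrite /seqG mulr_suml; apply: eq_bigr => i _; rewrite /carlitz_h mulrA.
Qed.

(** Choose, in the Newton polynomial of t_j, either the constant term or one of the
    terms in X^(q^k). *)
Lemma coef_seq_cons l' j l m : coef_seq l' (j :: l) m = coef_seq (j :: l') l m +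
  \sum_(k < m.+1 | (q ^ k <= m)%N) seq_cst (DD k)^-1 * (coef_seq l' l (m - q ^ k) * seqG k j).
Proof.
apply: seq_ext => d t.
have E1 (u v : seqt) : (u + v) d t = u d t + v d t by [].
rewrite E1 seq_sumE.
rewrite /coef_seq /interp_poly !big_cons -!/(interp_poly l d t) newton_poly_seqG mulrDl coefD mulrDr; congr (_ + _).
  by rewrite coefCM; ring.
rewrite mulr_suml coef_sum mulr_sumr.
pose f k := (\prod_(j0 <- l') bb d (t j0)) / ell d * (if (m < q ^ k)%N then 0 else seqG k j d t / DD k * (interp_poly l d t)`_(m - q ^ k)).
transitivity (\sum_(k < d | true) f k).
  apply: eq_bigr => k _; rewrite /f; congr (_ * _).
  by rewrite -scalerAl coefZ coefXnM; case: ifP; rewrite ?mulr0.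
transitivity (\sum_(k < m.+1 | true) f k).
  apply: (sum_ord_range (P := predT) (f := f)) => k _ /orP[dk|mk].
    rewrite /f; have -> : seqG k j d t = 0.
      rewrite /seqG big1 // => i _; rewrite carlitz_H_out ?mulr0 //.
      exact: leq_trans (ltn_ord i) dk.
    by rewrite !mul0r if_same mulr0.
  rewrite /f ifT ?mulr0 //; exact: leq_trans mk (ltnW (ltn_expl _ (q_gt1 F))).
rewrite [RHS]big_mkcond /=; apply: eq_bigr => k _.
rewrite /f; case: (leqP (q ^ k) m) => _; last by rewrite mulr0.
rewrite -[RHS]/((DD k)^-1 * ((\prod_(j0 <- l') bb d (t j0)) / ell d * (interp_poly l d t)`_(m - q ^ k) * seqG k j d t)).
by ring.
Qed.

Lemma coef_seq_tau_stable N : (forall k, (q ^ k <= N)%N -> tau_H k) ->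
  forall l l' m, (m <= N)%N -> (size (l' ++ l) < q)%N ->
  tau_stableV (cmap (l' ++ l)) m.+1 (coef_seq l' l m).
Proof.
move=> HK; elim=> [|j l IH] l' m mN sl.
  rewrite cats0 in sl *; case: m mN => [|m] mN.
    have -> : coef_seq l' [::] 0 = powsum (cmap l') 1.
      apply: seq_ext => d t; rewrite powsum1 // /coef_seq /interp_poly big_nil coef1 eqxx mulr1 //.
    exact: powsum1_tau_stable.
  have -> : coef_seq l' [::] m.+1 = 0.
    by apply: seq_ext => d t; rewrite /coef_seq /interp_poly big_nil coef1 mulr0.
  exact: tau_stableV0.
rewrite coef_seq_cons; apply: tau_stableVD.
  have -> : cmap (l' ++ j :: l) = cmap ((j :: l') ++ l).
    by apply: cmap_perm; rewrite perm_catC /= perm_cons perm_catC.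
  by apply: IH => //; move: sl; rewrite /= !size_cat /= addnS.
apply: tau_stableV_sum => k km; apply: tau_stableVZ; first by apply/in_KV/in_K_carlitz_D.
have -> : cmap (l' ++ j :: l) = cplus (cmap (l' ++ l)) (cmap [:: j]).
  by rewrite -cmap_cat; apply: cmap_perm; rewrite -cat1s -catA perm_cat2l perm_catC.
case: k km => k _ /= km.
have em : m.+1 = ((m - q ^ k).+1 + q ^ k)%N by rewrite addSn subnK.
rewrite [X in tau_stableV _ X]em; apply: tau_stableVW.
  by apply: IH; [lia|move: sl; rewrite !size_cat /=; lia].
by apply: seqG_tau_stable; apply: HK; apply: leq_trans mN.
Qed.

Lemma powsum_decomp l n : (size l < q)%N -> powsum (cmap l) n.+1 = coef_seq [::] l n +
  \sum_(k < n.+1 | (q ^ k <= n)%N) seq_cst (DD k)^-1 * (powsum (cmap l) (n.+1 - q ^ k) * seqH k).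
Proof.
move=> sl; apply: seq_ext => d t.
have E1 (u v : seqt) : (u + v) d t = u d t + v d t by [].
rewrite E1 seq_sumE.
rewrite powsum_rec //; congr (_ + _); first by rewrite /coef_seq big_nil mul1r mulrC.
apply: eq_bigr => k _.
by rewrite -[RHS]/((DD k)^-1 * (powsum (cmap l) (n.+1 - q ^ k) d t * HH k d)) /carlitz_h; ring.
Qed.

(** Strong induction on n along [powsum_decomp]: each ingredient of the recursion
    is stable, by the stability of the power sums of lower weight. *)
Lemma powsum_tau_stable s n : few_vars s -> (0 < n)%N -> tau_stableV s n (powsum s n).
Proof.
case: n => // n fs _; elim/ltn_ind: n s fs => n IH s [l -> sl].
have H s' n' : few_vars s' -> (0 < n' <= n)%N -> tau_stableV s' n' (powsum s' n').
  by case: n' => // n' fs' /andP[_ h]; apply: IH.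
have HK k : (q ^ k <= n)%N -> tau_H k.
  elim: k => [|k IHk] hk; first exact: tau_H0.
  apply: (tau_HS H); first exact: leqW.
  by apply: IHk; apply: leq_trans hk; rewrite leq_exp2l ?q_gt1.
rewrite powsum_decomp //; apply: tau_stableVD; first exact: (coef_seq_tau_stable HK (l' := [::]) (leqnn n) sl).
apply: tau_stableV_sum => -[k _] /= kn; apply: tau_stableVZ; first by apply/in_KV/in_K_carlitz_D.
have sl' : tau_stableV (cmap l) (n.+1 - q ^ k) (powsum (cmap l) (n.+1 - q ^ k)).
  by apply: H; [exists l|move: (qX_gt0 F k) kn; move: (q ^ k)%N => x; lia].
by have := tau_stableVV sl' (seqH_tau_stable (HK _ kn)); rewrite cplus0 subnK // leqW.
Qed.

Lemma Wspan_tau_stable s n w : few_vars s -> Wspan s n w -> tau_stableW s n w.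
Proof.
by move=> fs; apply: (@Wspan_tau_stable_upto n) => // s' n' fs' /andP[n0 _]; apply: powsum_tau_stable.
Qed.
End TauStable.

(** * Ultrametric analysis *)

Section Ultra.
Variables (R : realType) (F : finFieldType) (C : Cinfty R F).
Notation q := #|F|.
Notation io := (embC C).
Notation io_inj := (@io_inj R F C).
Notation th := (theta_img io).
Notation ell := (carlitz_ell io).
Notation bb := (carlitz_b io).
Implicit Types (x y : C) (u v : nat -> C).

Lemma Cabs_gt0 x : x != 0 -> 0 < Cabs x.
Proof.
move=> /eqP x0; rewrite lt_neqAle Cabs_ge0 andbT eq_sym.
by apply/eqP => /Cabs_eq0.
Qed.

Lemma Cabs1 : Cabs (1 : C) = 1.
Proof.
have h : Cabs (1 : C) != 0 by rewrite gt_eqF // Cabs_gt0 ?oner_neq0.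
by apply: (mulfI h); rewrite -CabsM !mulr1.
Qed.

Lemma CabsX x n : Cabs (x ^+ n) = Cabs x ^+ n.
Proof. by elim: n => [|n IH]; rewrite ?Cabs1 // !exprS CabsM IH. Qed.

Lemma CabsN x : Cabs (- x) = Cabs x.
Proof.
have h : Cabs (-1 : C) = 1.
  apply/eqP; rewrite -(@eqrXn2 _ 2) ?Cabs_ge0 //.
  by rewrite -CabsX sqrrN !expr1n Cabs1.
by rewrite -mulN1r CabsM h mul1r.
Qed.

Lemma CabsV x : Cabs (x^-1) = (Cabs x)^-1.
Proof.
have [->|x0] := eqVneq x 0; first by rewrite invr0 Cabs0 invr0.
have h : Cabs x != 0 by rewrite gt_eqF // Cabs_gt0.
by apply: (mulfI h); rewrite -CabsM !divff // Cabs1.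
Qed.

Lemma CabsB_sym x y : Cabs (x - y) = Cabs (y - x).
Proof. by rewrite -opprB CabsN. Qed.

Lemma CabsD_le x y B : Cabs x <= B -> Cabs y <= B -> Cabs (x + y) <= B.
Proof. by move=> hx hy; rewrite (le_trans (CabsD _ _)) // ge_max hx. Qed.

Lemma CabsD_lt x y B : Cabs x < B -> Cabs y < B -> Cabs (x + y) < B.
Proof. by move=> hx hy; rewrite (le_lt_trans (CabsD _ _)) // gt_max hx. Qed.

Lemma CabsB_lt x y B : Cabs x < B -> Cabs y < B -> Cabs (x - y) < B.
Proof. by move=> hx hy; apply: CabsD_lt; rewrite ?CabsN. Qed.

Lemma CabsB_le x y B : Cabs x <= B -> Cabs y <= B -> Cabs (x - y) <= B.
Proof. by move=> hx hy; apply: CabsD_le; rewrite ?CabsN. Qed.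

Lemma Cabs_sum_le I (r : seq I) (P : pred I) (f : I -> C) B : 0 <= B ->
  (forall i, P i -> Cabs (f i) <= B) -> Cabs (\sum_(i <- r | P i) f i) <= B.
Proof.
move=> B0 h; elim/big_rec: _ => [|i x Pi hx]; first by rewrite Cabs0.
by apply: CabsD_le; rewrite ?h.
Qed.

Lemma Cabs_prod I (r : seq I) (P : pred I) (f : I -> C) :
  Cabs (\prod_(i <- r | P i) f i) = \prod_(i <- r | P i) Cabs (f i).
Proof. by apply: big_morph; [exact: CabsM|exact: Cabs1]. Qed.

Lemma Cabs_isosc x y : Cabs x < Cabs y -> Cabs (x - y) = Cabs y.
Proof.
move=> xy; have h1 : Cabs (x - y) <= Cabs y by apply: CabsB_le => //; apply: ltW.
apply/eqP; rewrite eq_le h1 /= leNgt; apply/negP => h.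
have : Cabs (x - (x - y)) < Cabs y by apply: CabsB_lt.
by rewrite subKr ltxx.
Qed.

(** Convergence in C is used through explicit bounds; [convE] relates it to the
    convergence in the filter sense. *)
Definition null_seq (r : nat -> R) := forall e, 0 < e -> exists N, forall n, (N <= n)%N -> r n < e.

Lemma null_seq_le (r s : nat -> R) N : (forall n, (N <= n)%N -> r n <= s n) -> null_seq s -> null_seq r.
Proof.
move=> h hs e e0; have [M hM] := hs e e0; exists (maxn N M) => n; rewrite geq_max => /andP[h1 h2].
by apply: (le_lt_trans (h _ h1)); apply: hM.
Qed.

Definition Cconv u l := null_seq (fun n => Cabs (u n - l)).

Lemma convE u l : Ccvg u l <-> Cconv u l.
Proof.
split=> [/cvgr0Pnorm_lt h e e0|h].
  have [N _ hN] := h e e0; exists N => n Nn; have := hN n Nn.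
  by rewrite /= ger0_norm ?Cabs_ge0.
apply/cvgr0Pnorm_lt => e e0; have [N hN] := h e e0; exists N => // n /= Nn.
by rewrite ger0_norm ?Cabs_ge0 // hN.
Qed.

Lemma conv_cst x : Cconv (fun=> x) x.
Proof. by move=> e e0; exists 0%N => n _; rewrite subrr Cabs0. Qed.

Lemma convD u v x y : Cconv u x -> Cconv v y -> Cconv (fun n => u n + v n) (x + y).
Proof.
move=> hu hv e e0; have [N hN] := hu e e0; have [M hM] := hv e e0.
exists (maxn N M) => n; rewrite geq_max => /andP[h1 h2].
by rewrite opprD addrACA; apply: CabsD_lt; [apply: hN|apply: hM].
Qed.

Lemma convN u x : Cconv u x -> Cconv (fun n => - u n) (- x).
Proof.
move=> hu e e0; have [N hN] := hu e e0; exists N => n Nn.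
by rewrite -opprD CabsN; apply: hN.
Qed.

Lemma convZ (k : C) u x : Cconv u x -> Cconv (fun n => k * u n) (k * x).
Proof.
move=> hu e e0; have [->|k0] := eqVneq k 0.
  by exists 0%N => n _; rewrite !mul0r subrr Cabs0.
have k1 : 0 < Cabs k by apply: Cabs_gt0.
have [|N hN] := hu (e / Cabs k) _; first by rewrite divr_gt0.
exists N => n Nn; rewrite -mulrBr CabsM mulrC -ltr_pdivlMr //.
exact: hN.
Qed.

Lemma conv_bounded u x : Cconv u x -> exists B N, 0 < B /\ forall n, (N <= n)%N -> Cabs (u n) <= B.
Proof.
move=> hu; have [N hN] := hu 1 ltr01; exists (Num.max 1 (Cabs x)), N; split=> [|n Nn].
  by rewrite lt_max ltr01.
rewrite -[u n](subrK x); apply: CabsD_le; rewrite le_max ?lexx ?orbT //.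
by rewrite ltW // hN.
Qed.

Lemma convM u v x y : Cconv u x -> Cconv v y -> Cconv (fun n => u n * v n) (x * y).
Proof.
move=> hu hv; have [B [N [B0 hB]]] := conv_bounded hu.
have h1 : Cconv (fun n => u n * (v n - y)) 0.
  move=> e e0; have [|M hM] := hv (e / B) _; first by rewrite divr_gt0.
  exists (maxn N M) => n; rewrite geq_max => /andP[h1 h2].
  rewrite subr0 CabsM (le_lt_trans (ler_wpM2r (Cabs_ge0 _) (hB _ h1))) //.
  by rewrite mulrC -ltr_pdivlMr // hM.
have h2 : Cconv (fun n => y * u n) (y * x) by apply: convZ.
move=> e e0; have [M hM] := convD h1 h2 e0; exists M => n Mn.
rewrite (_ : u n * v n - x * y = u n * (v n - y) + y * u n - (0 + y * x)); first exact: hM.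
by ring.
Qed.

Lemma convX u x k : Cconv u x -> Cconv (fun n => u n ^+ k) (x ^+ k).
Proof.
move=> hu; elim: k => [|k IH]; first exact: conv_cst.
rewrite exprS (_ : (fun n => _) = (fun n => u n * u n ^+ k)); first exact: convM.
by apply/funext => n; rewrite exprS.
Qed.

Lemma conv_sum I (r : seq I) (P : pred I) (f : I -> nat -> C) (g : I -> C) :
  (forall i, P i -> Cconv (f i) (g i)) ->
  Cconv (fun n => \sum_(i <- r | P i) f i n) (\sum_(i <- r | P i) g i).
Proof.
move=> h; elim: r => [|i r IH].
  by rewrite (_ : (fun n => _) = (fun=> 0)) ?big_nil; [exact: conv_cst|apply/funext => n; rewrite big_nil].
rewrite big_cons (_ : (fun n => _) = (fun n => if P i then f i n + \sum_(i <- r | P i) f i n else \sum_(i <- r | P i) f i n)).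
  by case: ifP => Pi //; apply: convD => //; apply: h.
by apply/funext => n; rewrite big_cons.
Qed.

Lemma conv_prod I (r : seq I) (P : pred I) (f : I -> nat -> C) (g : I -> C) :
  (forall i, P i -> Cconv (f i) (g i)) ->
  Cconv (fun n => \prod_(i <- r | P i) f i n) (\prod_(i <- r | P i) g i).
Proof.
move=> h; elim: r => [|i r IH].
  by rewrite (_ : (fun n => _) = (fun=> 1)) ?big_nil; [exact: conv_cst|apply/funext => n; rewrite big_nil].
rewrite big_cons (_ : (fun n => _) = (fun n => if P i then f i n * \prod_(i <- r | P i) f i n else \prod_(i <- r | P i) f i n)).
  by case: ifP => Pi //; apply: convM => //; apply: h.
by apply/funext => n; rewrite big_cons.
Qed.

Lemma conv_uniq u x y : Cconv u x -> Cconv u y -> x = y.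
Proof.
move=> hx hy; apply/eqP; rewrite -subr_eq0; apply/negPn/negP => xy.
have e0 := Cabs_gt0 xy; have [N hN] := hx _ e0; have [M hM] := hy _ e0.
have : Cabs ((u (maxn N M) - y) - (u (maxn N M) - x)) < Cabs (x - y).
  by apply: CabsB_lt; [apply: hM|apply: hN]; rewrite ?leq_maxl ?leq_maxr.
by rewrite opprB addrC addrA subrK ltxx.
Qed.

Lemma conv_ev u v x N : (forall n, (N <= n)%N -> u n = v n) -> Cconv u x -> Cconv v x.
Proof.
move=> h hu e e0; have [M hM] := hu e e0; exists (maxn N M) => n; rewrite geq_max => /andP[h1 h2].
by rewrite -h //; apply: hM.
Qed.

Lemma conv_close u v x : Cconv u x -> null_seq (fun n => Cabs (v n - u n)) -> Cconv v x.
Proof.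
move=> hu hv e e0; have [N hN] := hu e e0; have [M hM] := hv e e0.
exists (maxn N M) => n; rewrite geq_max => /andP[h1 h2].
rewrite -[v n](subrK (u n)) -addrA; apply: CabsD_lt; [exact: hM|exact: hN].
Qed.

Lemma Clim_conv u x : Cconv u x -> Clim u = x.
Proof.
move=> h; rewrite /Clim; case: xgetP => [y _ /= /convE hy|/(_ x)].
  exact: conv_uniq hy h.
by move=> /(_ (iffRL (convE _ _) h)).
Qed.

Lemma Cabs_tele u B N n : 0 <= B -> (N <= n)%N ->
  (forall k, (N <= k)%N -> Cabs (u k.+1 - u k) <= B) -> Cabs (u n - u N) <= B.
Proof.
move=> B0 Nn h; rewrite -(subnKC Nn); elim: (n - N)%N => [|k IH].
  by rewrite addn0 subrr Cabs0.
rewrite addnS -[u _.+1](subrK (u (N + k)%N)) -addrA; apply: CabsD_le => //.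
by apply: h; rewrite leq_addr.
Qed.

(** By the ultrametric inequality, null increments make a sequence Cauchy. *)
Lemma conv_exists u : null_seq (fun n => Cabs (u n.+1 - u n)) -> exists x, Cconv u x.
Proof.
move=> h; have [|x hx] := @Ccomplete _ _ C u; last by exists x; apply/convE.
move=> e e0; have [|N hN] := h (e / 2) _; first by rewrite divr_gt0.
have e2 : 0 <= e / 2 by rewrite divr_ge0 // ltW.
exists N => m n Nm Nn.
have -> : u m - u n = (u m - u N) - (u n - u N) by ring.
apply: (@le_lt_trans _ _ (e / 2)); last by rewrite ltr_pdivrMr // ltr_pMr // ltr1n.
by apply: CabsB_le; apply: Cabs_tele => // k Nk; apply/ltW/hN.
Qed.

Lemma conv_tail u x B N : Cconv u x -> 0 <= B ->
  (forall k, (N <= k)%N -> Cabs (u k.+1 - u k) <= B) -> Cabs (x - u N) <= B.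
Proof.
move=> hu B0 h; have [xu|xu] := leP (Cabs (x - u N)) B => //; exfalso.
have [M hM] := hu _ (le_lt_trans B0 xu).
have := hM (maxn N M) (leq_maxr _ _).
rewrite CabsB_sym; have := Cabs_tele B0 (leq_maxl N M) h => h1 h2.
have : Cabs ((x - u (maxn N M)) + (u (maxn N M) - u N)) < Cabs (x - u N).
  by apply: CabsD_lt => //; apply: le_lt_trans xu.
by rewrite addrA subrK ltxx.
Qed.

(** * Absolute values of the Carlitz quantities *)

Lemma Cabs_theta_img : Cabs th = q%:R. Proof. exact: Cabs_theta. Qed.

(** The growth of b_d on bounded sets ([Cabs_carlitz_b]), whose q-th power is
    |ell_d| ([Cabs_ell]). *)
Definition qprod d : R := \prod_(i < d) (q%:R ^+ (q ^ i)).

Lemma qR_gt1 : 1 < q%:R :> R. Proof. by rewrite ltr1n q_gt1. Qed.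
Lemma qR_ge1 : 1 <= q%:R :> R. Proof. exact: ltW qR_gt1. Qed.

Lemma qprodS d : qprod d.+1 = qprod d * q%:R ^+ (q ^ d).
Proof. by rewrite /qprod big_ord_recr. Qed.

Lemma qprod_fact d : d`!%:R <= qprod d.
Proof.
elim: d => [|d IH]; first by rewrite /qprod big_ord0 lexx.
rewrite qprodS factS mulnC natrM ler_pM ?ler0n // -natrX ler_nat.
have h1 : (d < q ^ d)%N := ltn_expl d (q_gt1 F).
by apply: (leq_trans h1); apply: ltnW; apply: ltn_expl; apply: q_gt1.
Qed.

Lemma qprod_ge1 d : 1 <= qprod d.
Proof. by apply: le_trans (qprod_fact d); rewrite ler1n fact_gt0. Qed.
Lemma qprod_gt0 d : 0 < qprod d.
Proof. exact: lt_le_trans (qprod_ge1 d). Qed.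

Lemma q_exp_gt1 k : (1 < q ^ k.+1)%N.
Proof. exact: leq_ltn_trans (ltn0Sn k) (ltn_expl k.+1 (q_gt1 F)). Qed.

Lemma Cabs_ell d : Cabs (ell d) = qprod d ^+ q.
Proof.
rewrite /carlitz_ell Cabs_prod /qprod -prodrXl; apply: eq_bigr => i _.
rewrite Cabs_isosc CabsX Cabs_theta_img; first by rewrite -exprM expnSr.
rewrite -[X in X < _]expr1 ltr_eXn2l ?qR_gt1 //.
exact: q_exp_gt1.
Qed.

Lemma Cabs_ell_ge1 d : 1 <= Cabs (ell d).
Proof. by rewrite Cabs_ell exprn_ege1 // qprod_ge1. Qed.

Lemma Cabs_ell_gt0 d : 0 < Cabs (ell d).
Proof. exact: lt_le_trans (Cabs_ell_ge1 d). Qed.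

Lemma qprod_mono d e : (d <= e)%N -> qprod d <= qprod e.
Proof.
move=> de; rewrite -(subnKC de); elim: (e - d)%N => [|k IH]; first by rewrite addn0.
rewrite addnS qprodS (le_trans IH) // ler_peMr ?exprn_ege1 ?qR_ge1 //.
exact: ltW (qprod_gt0 _).
Qed.

Lemma Cabs_ell_mono d e : (d <= e)%N -> Cabs (ell d) <= Cabs (ell e).
Proof.
by move=> de; rewrite !Cabs_ell lerXn2r ?nnegrE ?qprod_mono // ltW ?qprod_gt0.
Qed.

Lemma Cabs_carlitz_b d x (M : R) : 1 <= M -> Cabs x <= M -> Cabs (bb d x) <= M ^+ d * qprod d.
Proof.
move=> M1 xM; rewrite /carlitz_b Cabs_prod /qprod.
rewrite -[d in M ^+ d]card_ord -prodr_const -big_split /=.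
apply: ler_prod => i _; rewrite Cabs_ge0 /=; apply: CabsB_le.
  by rewrite (le_trans xM) // ler_peMr ?exprn_ege1 ?qR_ge1 // (le_trans ler01).
by rewrite CabsX Cabs_theta_img ler_peMl // exprn_ge0 // ler0n.
Qed.

Lemma Cabs_carlitz_b_box N d x (M : R) : 1 <= M -> Cabs x <= M -> (d <= N)%N ->
  Cabs (bb d x) <= M ^+ N * qprod N.
Proof.
move=> M1 xM dN; apply: (le_trans (Cabs_carlitz_b d M1 xM)).
apply: ler_pM; [|exact: ltW (qprod_gt0 _)| |exact: qprod_mono].
  by rewrite exprn_ge0 // (le_trans ler01).
by rewrite ler_weXn2l.
Qed.

Lemma null_seq_expfact (M : R) : 0 <= M -> null_seq (fun d => M ^+ d / d`!%:R).
Proof.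
move=> M0 e e0; have /cvgr0Pnorm_lt/(_ e e0)[N _ hN] := cvg_exp_coeff M.
exists N => n Nn; have := hN n Nn; rewrite /= /exp_coeff /=.
by rewrite ger0_norm // divr_ge0 ?exprn_ge0.
Qed.

(** As s < q, at least one factor qprod d remains in the denominator, and it
    dominates d! and so any M^d. This gives the convergence of Newton series in
    fewer than q variables. *)
Lemma null_seq_newton s (M : R) : (s < q)%N -> 1 <= M ->
  null_seq (fun d => (M ^+ d * qprod d) ^+ s / Cabs (ell d)).
Proof.
move=> sq M1; have M0 : 0 <= M by exact: le_trans M1.
apply: (@null_seq_le _ (fun d => (M ^+ s) ^+ d / d`!%:R) 0); last first.
  by apply: null_seq_expfact; rewrite exprn_ge0.
move=> d _; rewrite exprMn -exprM mulnC exprM -mulrA.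
apply: ler_wpM2l; first by rewrite !exprn_ge0.
rewrite Cabs_ell -(subnKC (ltnW sq)) exprD invfM mulVKf; last first.
  by rewrite expf_neq0 // gt_eqF // qprod_gt0.
rewrite lef_pV2 ?posrE ?exprn_gt0 ?qprod_gt0 ?ltr0n ?fact_gt0 //.
apply: (le_trans (qprod_fact d)); apply: ler_eXnr; last exact: qprod_ge1.
by rewrite subn_gt0.
Qed.

Lemma Cabs_carlitz_D k : 1 <= Cabs (carlitz_D io k).
Proof.
elim: k => [|k IH]; first by rewrite Cabs1.
rewrite carlitz_DS CabsM CabsX.
have h : 1 <= Cabs (th ^+ (q ^ k.+1) - th).
  have := Cabs_ell_ge1 1; rewrite CabsB_sym Cabs_isosc.
    by rewrite CabsX Cabs_theta_img => _; rewrite exprn_ege1 // qR_ge1.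
  rewrite CabsX Cabs_theta_img -[X in X < _]expr1 ltr_eXn2l ?qR_gt1 //.
  exact: q_exp_gt1.
by rewrite -[1]mulr1 ler_pM ?ler01 // exprn_ege1.
Qed.

Lemma Cabs_carlitz_h k d : Cabs (carlitz_h io k d) <= 1.
Proof.
rewrite /carlitz_h CabsM CabsV -[1]mulr1; apply: ler_pM; rewrite ?Cabs_ge0 ?invr_ge0 ?Cabs_ge0 //.
  rewrite /carlitz_H; case: ifP => _; last by rewrite Cabs0 ler01.
  by rewrite CabsV CabsX invf_le1 ?exprn_ege1 ?exprn_gt0 ?Cabs_ell_ge1 ?Cabs_ell_gt0.
by rewrite invf_le1 ?Cabs_carlitz_D // (lt_le_trans ltr01 (Cabs_carlitz_D k)).
Qed.
End Ultra.

(** * Newton series of multiple zeta values *)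

Lemma sum_tuple_cons (T : finType) (U : zmodType) n (f : seq T -> U) :
  \sum_(a : n.+1.-tuple T) f a = \sum_(x : T) \sum_(a : n.-tuple T) f (x :: a).
Proof.
rewrite pair_big /= (reindex (fun p : T * n.-tuple T => [tuple of p.1 :: p.2])) /=.
  by apply: eq_bigr => -[x a].
exists (fun a => (thead a, [tuple of behead a])) => [[x a]|a] _ /=.
  by congr (_, _); apply: val_inj.
by rewrite [RHS]tuple_eta.
Qed.

Lemma sum_tuple0 (T : finType) (U : zmodType) (f : seq T -> U) :
  \sum_(a : 0.-tuple T) f a = f [::].
Proof.
rewrite (bigD1 [tuple]) //= big1 ?addr0 // => a /eqP[].
by apply: val_inj; rewrite /= (tuple0 a).
Qed.

Section Zsum.
Variables (R : realType) (F : finFieldType) (C : Cinfty R F).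
Notation q := #|F|.
Notation io := (embC C).
Notation io_inj := (@io_inj R F C).
Notation ell := (carlitz_ell io).
Notation bb := (carlitz_b io).
Notation EE := (carlitz_E io).

(** The evaluations a |-> a(t_j) are replaced by arbitrary functions of a, so that
    Newton coefficients, obtained from a |-> E_m(a), and values of multiple sums
    are instances of one construction. *)
Definition functl := posnat -> {poly F} -> C.
Implicit Type x : functl.

Definition gchi (s : compmap) x (a : {poly F}) : C :=
  \prod_(j <- finsupp s) x j a ^+ s j.

Definition gpowsum (s : compmap) n d x : C :=
  \sum_(a : {poly_d F}) gchi s x (mon a) / mon_img io a ^+ n.

Fixpoint gmzsum (c : comp_array) d x : C :=
  if c is (s, n) :: c' then \sum_(e < d) gpowsum s n e x * gmzsum c' e x else 1.

Definition eval_functl (t : posnat -> C) : functl := fun j a => peval io a (t j).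

Lemma gmzsum_eval c d t : gmzsum c d (eval_functl t) = mzsum c d t.
Proof.
elim: c d => // -[s n] c IH d; apply: eq_bigr => e _.
by rewrite -/gmzsum IH.
Qed.

Definition zsum (N : nat) (c : comp_array) x : C :=
  \sum_(a : (size c).-tuple {poly_N F} |
      all (fun p : {poly_N F} => polyn p \is monic) a
      && sorted (fun p r : {poly_N F} => (size r < size p)%N) a)
    \prod_(i < size c)
      (gchi (tnth (in_tuple c) i).1 x (tnth a i)
       / io (tnth a i) ^+ (tnth (in_tuple c) i).2).

Lemma zetaA_zsum c t : zetaA C c t = Clim (fun N => zsum N c (eval_functl t)).
Proof. by []. Qed.

Definition gterm x N (cp : (compmap * nat) * {poly_N F}) : C :=
  gchi cp.1.1 x cp.2 / io cp.2 ^+ cp.1.2.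

(** Tuples as in the definition of zeta, of degrees less than d. *)
Definition okseq N d (a : seq {poly_N F}) : bool :=
  [&& all (fun p : {poly_N F} => polyn p \is monic) a,
   sorted (fun p r : {poly_N F} => (size r < size p)%N) a
   & all (fun p : {poly_N F} => (size p <= d)%N) a].

Lemma zsum_seq N c x : zsum N c x = \sum_(a : (size c).-tuple {poly_N F})
  if okseq N a then \prod_(p <- zip c a) gterm x p else 0.
Proof.
rewrite /zsum big_mkcond; apply: eq_bigr => a _.
have -> : okseq N a = (all (fun p : {poly_N F} => polyn p \is monic) a
      && sorted (fun p r : {poly_N F} => (size r < size p)%N) a).
  rewrite /okseq [X in [&& _, _ & X]](_ : _ = true) ?andbT //.
  by apply/allP => p _; apply: size_npoly.
case: ifP => // _.
case: c a => [|col c] a; first by rewrite big_ord0 big1_seq //; case: (tval a).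
move: (tnth a ord0) => p0.
rewrite (big_nth (col, p0)) big_mkord size_zip size_tuple minnn.
apply: eq_bigr => i _; rewrite /gterm nth_zip ?size_tuple //.
by rewrite (tnth_nth col) (tnth_nth p0).
Qed.

Lemma okseq_cons N d (p : {poly_N F}) a :
  okseq d (p :: a) = [&& polyn p \is monic, (size p <= d)%N & okseq (size p).-1 a].
Proof.
rewrite /okseq /=; case: (boolP (polyn p \is monic)) => //= pm.
have p0 : (0 < size p)%N by rewrite lt0n size_poly_eq0 monic_neq0.
rewrite path_sortedE; last by move=> y x z; move=> h1 h2; apply: ltn_trans h2 h1.
have -> : all (fun r : {poly_N F} => (size r <= (size p).-1)%N) a =
    all (fun r : {poly_N F} => (size r < size p)%N) a.
  by apply: eq_all => r; rewrite -[LHS]ltnS prednK.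
have [h|] := boolP (all (fun r : {poly_N F} => (size r < size p)%N) a); last by rewrite !andbF.
case: (boolP (size p <= d)%N) => pd; last by rewrite !andbF.
have -> : all (fun r : {poly_N F} => (size r <= d)%N) a.
  by apply/allP => r ra; apply: leq_trans pd; apply: ltnW; apply: (allP h).
by rewrite !andbT.
Qed.

(** The sum over tuples of decreasing degrees is an iterated sum, by induction on
    the number of columns: d becomes the degree of the first polynomial. *)
Lemma zsum_gmzsum_from N x c d : (d <= N)%N ->
  \sum_(a : (size c).-tuple {poly_N F})
    (if okseq d a then \prod_(p <- zip c a) gterm x p else 0) = gmzsum c d x.
Proof.
elim: c d => [|[s n] c IH] d dN.
  by rewrite (sum_tuple0 (fun a : seq {poly_N F} => if okseq d a then \prod_(p <- zip [::] a) gterm x p else 0)) big_nil.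
rewrite (sum_tuple_cons _ (fun a : seq {poly_N F} => if okseq d a then \prod_(p <- zip ((s, n) :: c) a) gterm x p else 0)).
pose G (p : {poly F}) := if (size p <= d)%N then gchi s x p / io p ^+ n * gmzsum c (size p).-1 x else 0.
transitivity (\sum_(p : {poly_N F} | polyn p \is monic) G p).
  rewrite [RHS]big_mkcond; apply: eq_bigr => p _; rewrite /G.
  under eq_bigr => a _ do rewrite okseq_cons /= big_cons.
  case: (boolP (polyn p \is monic)) => pm /=; last by rewrite big1.
  case: ifP => pd; last by rewrite big1.
  rewrite -IH; last first.
    by rewrite (leq_trans (leq_pred _)) // (leq_trans pd).
  rewrite mulr_sumr; apply: eq_bigr => a _.
  by rewrite (fun_if (fun y => _ * y)) mulr0.
rewrite sum_poly_monic -[RHS]/(\sum_(e < d) gpowsum s n e x * gmzsum c e x) (big_ord_widen N (fun e => gpowsum s n e x * gmzsum c e x) dN).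
rewrite [RHS]big_mkcond; apply: eq_bigr => e _; rewrite /G.
under eq_bigr => a _ do rewrite size_mon.
by case: ifP => ed; rewrite ?sumr_const ?mul0rn // -mulr_suml.
Qed.

Lemma zsum_gmzsum N c x : zsum N c x = gmzsum c N x.
Proof. by rewrite zsum_seq zsum_gmzsum_from. Qed.

Section Box.
Variables (Sigma : {fset posnat}).

Definition extend0 (T : Type) (x0 : T) (m : Sigma -> T) : posnat -> T :=
  fun j => if insub j is Some j' then m j' else x0.

Lemma extend0_val (T : Type) (x0 : T) (m : Sigma -> T) (j : Sigma) : extend0 x0 m (val j) = m j.
Proof. by rewrite /extend0 valK. Qed.

Definition newton_functl (m : Sigma -> nat) : functl := fun j a => (EE (extend0 0%N m j)).[io a].

Variables (c : comp_array) (n : nat).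
Hypothesis Ac : admissible (charmap Sigma) n c.

Lemma charmapE j : charmap Sigma j = (j \in Sigma) :> nat.
Proof. by rewrite /charmap fsfunE; case: ifP. Qed.

Lemma gchi_col (i : 'I_(size c)) x a : gchi (tnth (in_tuple c) i).1 x a =
  \prod_(j : Sigma) x (val j) a ^+ (tnth (in_tuple c) i).1 (val j).
Proof.
set s := (tnth _ _).1.
have sub j : j \in finsupp s -> j \in Sigma.
  rewrite mem_finsupp -lt0n => sj.
  have [_ h _] := Ac; have := h j; rewrite charmapE big_tnth (bigD1 i) //= -/s.
  by case: (j \in Sigma) => //; lia.
rewrite /gchi -(big_seq_fsetE _ _ predT (fun j => x j a ^+ s j)) /=.
apply: big_fset_incl; first by apply/fsubsetP.
by move=> j _ /=; rewrite memNfinsupp => /eqP ->.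
Qed.

(** As the total composition map is the characteristic function of Sigma, each
    variable occurs in one column only. *)
Lemma col_of (j : Sigma) : exists i : 'I_(size c), forall x : 'I_(size c) -> C,
  \prod_i x i ^+ (tnth (in_tuple c) i).1 (val j) = x i.
Proof.
have [_ h _] := Ac; have := h (val j); rewrite charmapE big_tnth (fsvalP j) => /eqP.
move=> /sum_nat_eq1[i [_ hi hj]]; exists i => x.
rewrite (bigD1 i) //= hi expr1 big1 ?mulr1 // => k ki.
by rewrite hj.
Qed.

Lemma zprod_split N (a : (size c).-tuple {poly_N F}) x :
  \prod_(i < size c) (gchi (tnth (in_tuple c) i).1 x (tnth a i)
       / io (tnth a i) ^+ (tnth (in_tuple c) i).2) =
  (\prod_(j : Sigma) \prod_(i < size c) x (val j) (tnth a i) ^+ (tnth (in_tuple c) i).1 (val j)) *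
    \prod_(i < size c) io (tnth a i) ^- (tnth (in_tuple c) i).2.
Proof.
rewrite big_split /= exchange_big; congr (_ * _).
by apply: eq_bigr => i _; rewrite gchi_col.
Qed.

(** Expand a(t_j) by [carlitz_newton] for every j in Sigma, in the unique column
    where t_j occurs, and distribute the product over the variables. *)
Lemma gmzsum_expand N M t : (N <= M)%N -> gmzsum c N (eval_functl t) =
  \sum_(m : {ffun Sigma -> 'I_M}) (\prod_(j : Sigma) bb (m j) (t (val j))) *
     gmzsum c N (newton_functl (fun j => m j)).
Proof.
move=> NM; rewrite -zsum_gmzsum.
under eq_bigr => m _ do rewrite -zsum_gmzsum /zsum mulr_sumr.
rewrite exchange_big /zsum; apply: eq_bigr => a _ /=.
rewrite zprod_split; under [RHS]eq_bigr => m _ do rewrite zprod_split mulrA -big_split.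
rewrite -mulr_suml; congr (_ * _).
rewrite [RHS](_ : _ = \sum_(m : {ffun Sigma -> 'I_M}) \prod_(j : Sigma) (bb (m j) (t (val j)) *
   \prod_i (EE (m j)).[io (tnth a i)] ^+ (tnth (in_tuple c) i).1 (val j))); last first.
  apply: eq_bigr => m _; apply: eq_bigr => j _; congr (_ * _).
  by apply: eq_bigr => i _; rewrite /newton_functl extend0_val.
rewrite -(bigA_distr_bigA (fun (j : Sigma) (m : 'I_M) => bb m (t (val j)) *
   \prod_i (EE m).[io (tnth a i)] ^+ (tnth (in_tuple c) i).1 (val j))) /=.
apply: eq_bigr => j _; have [i hi] := col_of j.
rewrite hi; under eq_bigr => m _ do rewrite hi.
rewrite /eval_functl (carlitz_newton io_inj (N := M)) ?(leq_trans (size_npoly _)) //.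
by apply: eq_bigr => m _; rewrite mulrC.
Qed.

Lemma gmzsum_vanish N m (j : Sigma) : (N <= m j)%N -> gmzsum c N (newton_functl m) = 0.
Proof.
move=> Nm; rewrite -zsum_gmzsum /zsum big1 // => a _; rewrite zprod_split.
rewrite (bigD1 j) //=; have [i hi] := col_of j.
rewrite hi /newton_functl extend0_val (carlitz_E_small io_inj) ?mul0r //.
exact: leq_trans (size_npoly _) Nm.
Qed.
End Box.

(** Integrality of the coefficients is preserved by products, and holds for the E_k
    because |D_k| and |ell_d| are at least 1. *)
Definition coefs_le1 (P : {poly C}) := forall i, Cabs P`_i <= 1.

Lemma coefs_le1_1 : coefs_le1 1.
Proof. by move=> i; rewrite coef1; case: eqP => _ /=; rewrite ?Cabs1 ?Cabs0 ?ler01. Qed.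

Lemma coefs_le1M P Q : coefs_le1 P -> coefs_le1 Q -> coefs_le1 (P * Q).
Proof.
move=> hP hQ i; rewrite coefM; apply: Cabs_sum_le => // k _.
by rewrite CabsM -[1]mulr1 ler_pM ?Cabs_ge0.
Qed.

Lemma coefs_le1_E k : coefs_le1 (EE k).
Proof.
move=> i; rewrite /carlitz_E coef_sum; apply: Cabs_sum_le => // e _.
rewrite coefZ coefXn; case: eqP => _ /=; rewrite ?mulr1 ?mulr0 ?Cabs0 ?ler01 //.
exact: Cabs_carlitz_h.
Qed.

(** The recursion has integral coefficients, apart from the factor 1/ell_d of its
    initial term. *)
Lemma poly_powsum_bound d n P : coefs_le1 P -> (size P <= q ^ d)%N -> Cabs (poly_powsum io d n.+1 P) <= (Cabs (ell d))^-1.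
Proof.
move=> hP sP; elim/ltn_ind: n => n IH.
have e0 : 0 <= (Cabs (ell d))^-1 by rewrite invr_ge0 Cabs_ge0.
rewrite (poly_powsum_rec io_inj) //; apply: CabsD_le.
  by rewrite CabsM CabsV ler_piMl.
apply: Cabs_sum_le => // k kn; rewrite CabsM -[X in _ <= X]mul1r.
rewrite ler_pM ?Cabs_ge0 ?Cabs_carlitz_h // subSn // IH //.
by have := qX_gt0 F k; move: kn; move: (q ^ k)%N => y; lia.
Qed.

Definition newton_functl_of (m : posnat -> nat) : functl := fun j a => (EE (m j)).[io a].

(** E_k takes the constant value 0 or 1 on the monic polynomials of degree d when
    k >= d; replacing it by this constant keeps the degrees within the range of
    interpolation. *)
Definition E_reduced d k : {poly C} := if (k < d)%N then EE k else ((k == d)%:R)%:P.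

Lemma E_reducedE d k (a : {poly_d F}) : (E_reduced d k).[mon_img io a] = (EE k).[mon_img io a].
Proof.
rewrite /E_reduced; case: ltngtP => [//|dk|->]; rewrite hornerC; last by rewrite (carlitz_E_monic io_inj).
by rewrite /mon_img (carlitz_E_small io_inj) // size_mon.
Qed.

Lemma coefs_le1_E_reduced d k : coefs_le1 (E_reduced d k).
Proof.
rewrite /E_reduced; case: ifP => _; first exact: coefs_le1_E.
move=> i; rewrite coefC; case: eqP => _; rewrite ?Cabs0 ?ler01 //.
by case: eqP => _; rewrite ?Cabs1 ?Cabs0 ?ler01.
Qed.

Lemma gpowsum_bound s n d m : few_vars F s -> (0 < n)%N -> Cabs (gpowsum s n d (newton_functl_of m)) <= (Cabs (ell d))^-1.
Proof.
move=> [l -> sl]; case: n => // n _.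
have -> : gpowsum (cmap l) n.+1 d (newton_functl_of m) = poly_powsum io d n.+1 (\prod_(j <- l) E_reduced d (m j)).
  apply: eq_bigr => a _; congr (_ / _).
  rewrite /gchi (cprod_cmap (fun j => newton_functl_of m j (mon a))) horner_prod.
  by apply: eq_bigr => j _; rewrite E_reducedE.
apply: poly_powsum_bound.
  by apply: big_ind => [||j _]; [exact: coefs_le1_1|exact: coefs_le1M|exact: coefs_le1_E_reduced].
apply: size_prod_deg_bound => // j; rewrite /E_reduced; case: ifP => h; first exact: size_carlitz_E_bound.
by apply: leq_trans (size_polyC_leq1 _) _.
Qed.

Lemma gmzsum_bound c s n d m : few_vars F s -> admissible s n c -> Cabs (gmzsum c d (newton_functl_of m)) <= 1.
Proof.
elim: c s n d => [|[s1 n1] c IH] s n d fs Ac; first by rewrite Cabs1.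
have [s2 [n2 [n10 Ac2 es en]]] := adm_cons_inv Ac; subst s n.
have [f1 f2] := few_vars_cplus fs.
apply: Cabs_sum_le => // e _; rewrite CabsM -[X in _ <= X]mulr1 ler_pM ?Cabs_ge0 //.
  apply: (le_trans (gpowsum_bound _ _ f1 n10)).
  by rewrite invf_le1 ?Cabs_ell_ge1 ?Cabs_ell_gt0.
exact: IH Ac2.
Qed.

Lemma gmzsum_incr c s n d m : few_vars F s -> admissible s n c ->
  Cabs (gmzsum c d.+1 (newton_functl_of m) - gmzsum c d (newton_functl_of m)) <= (Cabs (ell d))^-1.
Proof.
case: c => [|[s1 n1] c] fs Ac; first by rewrite subrr Cabs0 invr_ge0 Cabs_ge0.
have [s2 [n2 [n10 Ac2 es en]]] := adm_cons_inv Ac; subst s n.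
have [f1 f2] := few_vars_cplus fs.
rewrite /= big_ord_recr /= [X in Cabs (X - _)]addrC addrK CabsM.
rewrite -[X in _ <= X]mulr1 ler_pM ?Cabs_ge0 //; first exact: gpowsum_bound.
exact: gmzsum_bound Ac2.
Qed.

Section NewtonZeta.
Variables (Sigma : {fset posnat}).
Hypothesis Sq : (#|` Sigma| < q)%N.
Variables (c : comp_array) (n : nat).
Hypothesis Ac : admissible (charmap Sigma) n c.

Lemma few_vars_charmap : few_vars F (charmap Sigma).
Proof.
exists (enum_fset Sigma) => //; apply: compmapP => j.
by rewrite charmapE cmapE count_uniq_mem ?fset_uniq.
Qed.

(** The coefficients of the Newton series of a zeta value. *)
Definition ncoef (m : Sigma -> nat) : C := Clim (fun N => gmzsum c N (newton_functl m)).

Lemma null_seq_ellV : null_seq (fun d => (Cabs (ell d))^-1).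
Proof.
have := @null_seq_newton R F C 0 1 (q_gt0 F) (lexx 1).
by apply: (@null_seq_le _ _ _ 0) => d _; rewrite expr0 mul1r.
Qed.

Lemma ncoef_conv m : Cconv (fun N => gmzsum c N (newton_functl m)) (ncoef m).
Proof.
have [|x hx] := @conv_exists _ _ _ (fun N => gmzsum c N (newton_functl m)).
  apply: (null_seq_le (N := 0) _ null_seq_ellV) => d _.
  exact: gmzsum_incr few_vars_charmap Ac.
by rewrite /ncoef (Clim_conv hx).
Qed.

Lemma ncoef_tail m N : Cabs (ncoef m - gmzsum c N (newton_functl m)) <= (Cabs (ell N))^-1.
Proof.
apply: (conv_tail (ncoef_conv m)); first by rewrite invr_ge0 Cabs_ge0.
move=> k Nk; apply: (le_trans (gmzsum_incr _ _ few_vars_charmap Ac)).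
by rewrite lef_pV2 ?posrE ?Cabs_ell_gt0 // Cabs_ell_mono.
Qed.

(** The truncations at degree m_j vanish, hence the coefficient is a tail of the
    series. *)
Lemma ncoef_bound m (j : Sigma) : Cabs (ncoef m) * Cabs (ell (m j)) <= 1.
Proof.
have := ncoef_tail m (m j); rewrite (gmzsum_vanish Ac (leqnn (m j))) subr0 => h.
by rewrite -ler_pdivlMr ?Cabs_ell_gt0 // div1r.
Qed.

Lemma coords_bounded (t : posnat -> C) : exists2 M : R, 1 <= M & forall j : Sigma, Cabs (t (val j)) <= M.
Proof.
exists (\big[Num.max/1]_(j : Sigma) Cabs (t (val j))).
  by elim/big_rec: _ => // j x _ hx; rewrite le_max hx orbT.
by move=> j; rewrite (bigD1 j) //= le_max lexx.
Qed.

Lemma Cabs_carlitz_b_prod N M (m : Sigma -> nat) (t : posnat -> C) : 1 <= M ->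
  (forall j : Sigma, Cabs (t (val j)) <= M) -> (forall j, (m j <= N)%N) ->
  Cabs (\prod_(j : Sigma) bb (m j) (t (val j))) <= (M ^+ N * qprod R F N) ^+ #|` Sigma|.
Proof.
move=> M1 tM mN; rewrite Cabs_prod cardfE -prodr_const.
by apply: ler_prod => j _; rewrite Cabs_ge0 Cabs_carlitz_b_box.
Qed.

(** The increments are estimated on the Newton expansions: bounded coefficients times
    1/|ell_N| are compared with products of fewer than q values b_m(t_j). *)
Lemma mzsum_conv t : Cconv (fun N => mzsum c N t) (zetaA C c t).
Proof.
rewrite zetaA_zsum; have -> : (fun N => zsum N c (eval_functl t)) = (fun N => mzsum c N t).
  by apply/funext => N; rewrite zsum_gmzsum gmzsum_eval.
have [|x hx] := @conv_exists _ _ _ (fun N => mzsum c N t); last by rewrite (Clim_conv hx).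
have [M M1 tM] := coords_bounded t.
apply: (null_seq_le (N := 0) _ (null_seq_newton C Sq M1)) => N _.
rewrite -!gmzsum_eval (gmzsum_expand Ac _ (leqnn N.+1)) (gmzsum_expand Ac _ (leqnSn N)) -sumrB.
apply: Cabs_sum_le => [|m _].
  rewrite divr_ge0 ?Cabs_ge0 ?exprn_ge0 // mulr_ge0 ?exprn_ge0 ?(le_trans ler01 M1) //.
  exact: ltW (qprod_gt0 _ _ _).
rewrite -mulrBr CabsM; apply: ler_pM; rewrite ?Cabs_ge0 //.
  by apply: Cabs_carlitz_b_prod => // j; rewrite -ltnS.
exact: gmzsum_incr few_vars_charmap Ac.
Qed.

Lemma zetaA_newton_series t :
  Cconv (fun N => \sum_(m : {ffun Sigma -> 'I_N})
     ncoef (fun j => m j) * \prod_(j : Sigma) bb (m j) (t (val j))) (zetaA C c t).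
Proof.
apply: (conv_close (mzsum_conv t)).
have [M M1 tM] := coords_bounded t.
apply: (null_seq_le (N := 0) _ (null_seq_newton C Sq M1)) => N _.
rewrite -gmzsum_eval (gmzsum_expand Ac _ (leqnn N)) -sumrB.
apply: Cabs_sum_le => [|m _].
  rewrite divr_ge0 ?Cabs_ge0 ?exprn_ge0 // mulr_ge0 ?exprn_ge0 ?(le_trans ler01 M1) //.
  exact: ltW (qprod_gt0 _ _ _).
rewrite [ncoef _ * _]mulrC -mulrBr CabsM; apply: ler_pM; rewrite ?Cabs_ge0 ?ncoef_tail //.
by apply: Cabs_carlitz_b_prod => // j; apply: ltnW.
Qed.
End NewtonZeta.
End Zsum.

(** * The Frobenius twist *)

Section Perfect.
Variables (R : realType) (F : finFieldType) (C : Cinfty R F).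
Notation q := #|F|.
Notation io := (embC C).

Lemma frobq_inj (x y : C) : x ^+ q = y ^+ q -> x = y.
Proof.
move=> h; apply/eqP; rewrite -subr_eq0.
have : (x - y) ^+ q == 0 by rewrite (frobE F) (frobB io) -!(frobE F) h subrr.
by rewrite expf_eq0 => /andP[].
Qed.

Lemma Laurent_cst (f : F) : Claurent (emb_cst io f).
Proof.
exists 0%N, (fun i => if i == 0%N then f else 0); apply/convE.
apply: (conv_ev (u := fun=> emb_cst io f) (N := 1)); last exact: conv_cst.
move=> [//|n] _; rewrite big_ord_recl /= big1 => [|i _].
  by rewrite addr0 !expr0 invr1 !mulr1.
by rewrite polyC0 !rmorph0 !mul0r.
Qed.

Lemma Laurent_opp (x : C) : Claurent x -> Claurent (- x).
Proof.
move=> [N [c /convE h]]; exists N, (fun i => - c i); apply/convE.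
rewrite (_ : (fun n => _) = (fun n => - \sum_(i < n) Cemb C (tofrac (c i)%:P) * Ctheta C ^+ N / Ctheta C ^+ i)).
  exact: convN.
apply/funext => n; rewrite -sumrN; apply: eq_bigr => i _.
by rewrite polyCN !rmorphN !mulNr.
Qed.

Lemma Laurent0 : Claurent (0 : C).
Proof. by rewrite -(rmorph0 (emb_cst io)); apply: Laurent_cst. Qed.
Lemma Laurent1 : Claurent (1 : C).
Proof. by rewrite -(rmorph1 (emb_cst io)); apply: Laurent_cst. Qed.

Lemma Calg_Laurent (x : C) : Claurent x -> Calg x.
Proof.
move=> hx; exists ('X - x%:P); split; first by rewrite polyXsubC_eq0.
  move=> i; rewrite coefB coefX coefC; case: i => [|[|i]] /=; rewrite ?sub0r ?subr0.
  - exact: Laurent_opp.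
  - exact: Laurent1.
  - by rewrite ?oppr0; exact: Laurent0.
by rewrite root_XsubC.
Qed.

(** The inverse of a root of y X^q - 1, a polynomial whose coefficients are visibly
    algebraic when y is. *)
Lemma Calg_root (y : C) : Calg y -> exists x, x ^+ q = y.
Proof.
move=> hy; have [->|y0] := eqVneq y 0.
  by exists 0; rewrite frobq0.
pose p : {poly C} := y *: 'X^q - 1.
have cp i : p`_i = y * (i == q)%:R - (i == 0%N)%:R by rewrite coefB coefZ coefXn coef1.
have q1 := q_gt1 F.
have [|| x _ /rootP] := @Calg_closed _ _ C p.
- move=> i; rewrite cp; case: (eqVneq i 0%N) => [->|i0].
    rewrite (_ : (0 == q)%N = false); last by rewrite ltn_eqF // ltnW.
    by rewrite mulr0 sub0r; apply: Calg_Laurent; apply: Laurent_opp; apply: Laurent1.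
  rewrite subr0; case: eqP => _; first by rewrite mulr1.
  by rewrite mulr0; apply: Calg_Laurent; apply: Laurent0.
- rewrite ltnNge; apply/negP => /leq_sizeP/(_ q (ltnW q1)).
  rewrite cp eqxx mulr1 (_ : (q == 0)%N = false) ?subr0; first by move/eqP; rewrite (negbTE y0).
  by rewrite gtn_eqF // ltnW.
rewrite hornerD hornerN hornerZ hornerXn hornerC => /eqP; rewrite subr_eq0 => /eqP h.
exists (x^-1); rewrite exprVn.
have x0 : x ^+ q != 0 by apply/eqP => x0; move: h; rewrite x0 mulr0 => /eqP; rewrite eq_sym oner_eq0.
by apply: (mulIf x0); rewrite mulVf.
Qed.

Lemma null_seq_inv : null_seq (fun n : nat => n.+1%:R^-1 : R).
Proof.
move=> e e0; have [N hN] := ltr_add_invr (y := 0) (x := e) e0.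
exists N => n Nn; rewrite add0r in hN; apply: le_lt_trans hN.
by rewrite lef_pV2 ?posrE ?ltr0n // ler_nat.
Qed.

(** Algebraic elements have q-th roots and are dense; the roots of a sequence that
    converges to x form a Cauchy sequence, as |u - v|^q = |u^q - v^q|. *)
Lemma Cperfect (x : C) : exists y, y ^+ q = x.
Proof.
have H n : exists z : C, Cabs (x - z ^+ q) < n.+1%:R^-1.
  have [|y hy xy] := @Calg_dense _ _ C x (n.+1%:R^-1); first by rewrite invr_gt0 ltr0n.
  by have [z zy] := Calg_root hy; exists z; rewrite zy.
have [z hz] := choice H.
have q0 : (q != 0)%N by rewrite -lt0n q_gt0.
have hx : Cconv (fun n => z n ^+ q) x.
  by apply: (null_seq_le (N := 0) _ null_seq_inv) => n _; rewrite CabsB_sym; apply: ltW.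
have [|l hl] := @conv_exists _ _ C z.
  move=> e e0; have [|N hN] := hx (e ^+ q) _; first by rewrite exprn_gt0.
  exists N => n Nn; rewrite ltNge; apply/negP => h.
  have : e ^+ q <= Cabs (z n.+1 - z n) ^+ q by rewrite lerXn2r ?nnegrE ?Cabs_ge0 // ltW.
  apply/negP; rewrite -ltNge -CabsX (frobE F) (frobB io) -!(frobE F).
  have -> : z n.+1 ^+ q - z n ^+ q = (z n.+1 ^+ q - x) - (z n ^+ q - x) by ring.
  by apply: CabsB_lt; apply: hN => //; apply: leqW.
by exists l; apply: conv_uniq hx; apply: convX.
Qed.

Definition qroot (x : C) : C := projT1 (cid (Cperfect x)).
Lemma qrootK x : qroot x ^+ q = x.
Proof. by rewrite /qroot; case: cid. Qed.

(** For an entire function this raises the coefficients to the power q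
    ([tau_twist]), without reference to an expansion. *)
Definition twist (f : tfun C) : tfun C := fun t => f (fun j => qroot (t j)) ^+ q.

Lemma twistE f t : twist f (frob_pt t) = f t ^+ q.
Proof.
rewrite /twist; congr (f _ ^+ q); apply/funext => j.
by apply: frobq_inj; rewrite qrootK.
Qed.

Lemma frob_pt_surj (t : posnat -> C) : exists t', t = frob_pt t'.
Proof. by exists (fun j => qroot (t j)); apply/funext => j; rewrite /frob_pt qrootK. Qed.

Lemma twist_uniq (f g : tfun C) : (forall t, g (frob_pt t) = f t ^+ q) -> g = twist f.
Proof.
by move=> h; apply/funext => t; have [t' ->] := frob_pt_surj t; rewrite h twistE.
Qed.
End Perfect.

(** * Spaces of multiple zeta values *)

Section Spaces.
Variables (R : realType) (F : finFieldType) (C : Cinfty R F).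
Notation q := #|F|.
Notation io := (embC C).
Notation io_inj := (@io_inj R F C).
Notation seqt := (nat -> tfun C).
Implicit Types (f g : tfun C) (Sigma : {fset posnat}).

Definition slimit (w : seqt) f := forall t, Cconv (fun N => w N t) (f t).

Lemma slimit_uniq w f g : slimit w f -> slimit w g -> f = g.
Proof. by move=> hf hg; apply/funext => t; apply: conv_uniq (hf t) (hg t). Qed.

Lemma slimitD u v f g : slimit u f -> slimit v g -> slimit (u + v) (f + g).
Proof. by move=> hu hv t; apply: (convD (hu t) (hv t)). Qed.
Lemma slimitM u v f g : slimit u f -> slimit v g -> slimit (u * v) (f * g).
Proof. by move=> hu hv t; apply: (convM (hu t) (hv t)). Qed.
Lemma slimit_cst k : slimit (seq_cst k) (cst k : tfun C).
Proof. by move=> t; apply: conv_cst. Qed.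
Lemma slimit0 : slimit 0 0.
Proof. by move=> t; apply: conv_cst. Qed.
Lemma slimit1 : slimit 1 1.
Proof. by move=> t; apply: conv_cst. Qed.

Lemma Zn0 Sigma n : Zn C Sigma n 0.
Proof.
exists 0%N, (fun=> 0), (fun=> [::]); split; first by case.
by rewrite big_ord0.
Qed.

Lemma Zn_consL Sigma n k c f : in_K k -> admissible (charmap Sigma) n c -> Zn C Sigma n f ->
  Zn C Sigma n ((cst k : tfun C) * zetaA C c + f).
Proof.
move=> [k0 ->] Ac [r [ks [cs [As ->]]]].
exists r.+1, (fun i => if unlift ord0 i is Some j then ks j else k0),
  (fun i => if unlift ord0 i is Some j then cs j else c); split.
  by move=> i; case: (unlift ord0 i).
rewrite big_ord_recl unlift_none; congr (_ + _); apply: eq_bigr => i _.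
by rewrite liftK.
Qed.

Lemma Zn_lim Sigma n w : (#|` Sigma| < q)%N -> Wspan (charmap Sigma) n w ->
  exists2 f, Zn C Sigma n f & slimit w f.
Proof.
move=> Sq; elim=> [|k _ u Kk [c Ac ->] _ [f Zf uf]].
  by exists 0; [exact: Zn0|exact: slimit0].
exists ((cst k : tfun C) * zetaA C c + f); first exact: Zn_consL.
apply: slimitD => //; apply: slimitM; first exact: slimit_cst.
by move=> t; apply: mzsum_conv Ac _.
Qed.

(** Multiple zeta values are the limits of the elements of Wspan, through which
    products and tau are computed. *)
Lemma ZnP Sigma n f : (#|` Sigma| < q)%N ->
  Zn C Sigma n f <-> exists2 w, Wspan (charmap Sigma) n w & slimit w f.
Proof.
move=> Sq; split; last first.
  by move=> [w /(Zn_lim Sq)[g Zg gw] fw]; rewrite (slimit_uniq fw gw).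
move=> [r [ks [cs [As ->]]]].
exists (\sum_(i < r) seq_cst (Cemb C (ks i)) * mzsum (cs i)).
  apply: span_sum => i _; apply: spanZ; first by exists (ks i).
  by apply: span_gen; exists (cs i).
elim/big_ind2: _ => [|u f' v g'|i _]; [exact: slimit0|exact: slimitD|].
apply: slimitM; first exact: slimit_cst.
by move=> t; apply: mzsum_conv (As i) _.
Qed.

Lemma ZnD Sigma n f g : (#|` Sigma| < q)%N -> Zn C Sigma n f -> Zn C Sigma n g -> Zn C Sigma n (f + g).
Proof.
move=> Sq /(ZnP _ _ Sq)[u Wu uf] /(ZnP _ _ Sq)[v Wv vg]; apply/ZnP => //.
by exists (u + v); [exact: spanD|exact: slimitD].
Qed.

Lemma ZnZ Sigma n k f : (#|` Sigma| < q)%N -> in_K k -> Zn C Sigma n f -> Zn C Sigma n ((cst k : tfun C) * f).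
Proof.
move=> Sq Kk /(ZnP _ _ Sq)[u Wu uf]; apply/ZnP => //.
by exists (seq_cst k * u); [exact: spanZ|apply: slimitM => //; exact: slimit_cst].
Qed.

Lemma charmap0 : charmap fset0 = cnil.
Proof. by apply: compmapP => j; rewrite charmapE in_fset0 cnilE. Qed.

Lemma charmapU (S1 S2 : {fset posnat}) : [disjoint S1 & S2]%fset ->
  charmap (S1 `|` S2)%fset = cplus (charmap S1) (charmap S2).
Proof.
move=> /fdisjointP d; apply: compmapP => j; rewrite cplusE !charmapE in_fsetU.
by have [/d/negbTE->|] := boolP (j \in S1).
Qed.

Lemma ZnM (S1 S2 : {fset posnat}) n m f g : [disjoint S1 & S2]%fset ->
  (#|` (S1 `|` S2)%fset| < q)%N ->
  Zn C S1 n f -> Zn C S2 m g -> Zn C (S1 `|` S2)%fset (n + m) (f * g).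
Proof.
move=> d Sq; have Sq1 : (#|` S1| < q)%N by apply: leq_ltn_trans Sq; rewrite fsubset_leq_card ?fsubsetUl.
have Sq2 : (#|` S2| < q)%N by apply: leq_ltn_trans Sq; rewrite fsubset_leq_card ?fsubsetUr.
move=> /(ZnP _ _ Sq1)[u Wu uf] /(ZnP _ _ Sq2)[v Wv vg]; apply/ZnP => //.
by exists (u * v); [rewrite charmapU //; apply: WspanM|apply: slimitM].
Qed.

Lemma fset0_lt_q : (#|` (fset0 : {fset posnat})| < q)%N.
Proof. by rewrite cardfs0 q_gt0. Qed.

Lemma graded_sumD (Vn : nat -> set (tfun C)) f g :
  (forall n, Vn n 0) -> (forall n f g, Vn n f -> Vn n g -> Vn n (f + g)) ->
  graded_sum Vn f -> graded_sum Vn g -> graded_sum Vn (f + g).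
Proof.
move=> V0 VD [N [u [hu ->]]] [M [v [hv ->]]].
pose ext (N : nat) (u : nat -> tfun C) n := if (n < N)%N then u n else 0.
have E N' (u' : nat -> tfun C) L : (N' <= L)%N -> \sum_(n < N') u' n = \sum_(n < L) ext N' u' n.
  by move=> NL; rewrite (big_ord_widen L (fun n => u' n) NL) big_mkcond.
exists (maxn N M), (fun n => ext N u n + ext M v n); split.
  by move=> n; apply: VD; rewrite /ext; case: ifP.
by rewrite big_split /= -!E ?leq_maxl ?leq_maxr.
Qed.

Lemma graded_sum_gen (Vn : nat -> set (tfun C)) n f :
  (forall n, Vn n 0) -> Vn n f -> graded_sum Vn f.
Proof.
move=> V0 Vf; exists n.+1, (fun m => if m == n then f else 0); split.
  by move=> m; case: eqP => [->|].
rewrite big_ord_recr /= eqxx big1 ?add0r // => i _.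
by rewrite ltn_eqF.
Qed.

Lemma Zempty_gen n f : Zn C fset0 n f -> Zempty C f.
Proof. by apply: graded_sum_gen => m; apply: Zn0. Qed.

Lemma ZemptyD f g : Zempty C f -> Zempty C g -> Zempty C (f + g).
Proof.
apply: graded_sumD => [n|n f' g']; first exact: Zn0.
by apply: ZnD; apply: fset0_lt_q.
Qed.

Lemma Zempty0 : Zempty C 0. Proof. exact: Zempty_gen (Zn0 _ 0). Qed.

Lemma Zempty_sum I (r : seq I) (P : pred I) (f : I -> tfun C) :
  (forall i, P i -> Zempty C (f i)) -> Zempty C (\sum_(i <- r | P i) f i).
Proof. by move=> h; elim/big_rec: _ => [|i x Pi Zx]; [exact: Zempty0|apply: ZemptyD => //; apply: h]. Qed.

Lemma ZemptyM f g : Zempty C f -> Zempty C g -> Zempty C (f * g).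
Proof.
move=> [N [u [hu ->]]] [M [v [hv ->]]]; rewrite mulr_suml.
apply: Zempty_sum => i _; rewrite mulr_sumr; apply: Zempty_sum => j _.
apply: (@Zempty_gen (i + j)).
have := @ZnM fset0 fset0 i j (u i) (v j); rewrite fsetU0; apply => //; last exact: fset0_lt_q.
exact: fdisjoint0X.
Qed.

Lemma Zempty_K k : in_K k -> Zempty C (cst k : tfun C).
Proof.
move=> Kk; apply: (@Zempty_gen 0); apply/ZnP; first exact: fset0_lt_q.
by exists (seq_cst k); [rewrite charmap0; exact: Wspan_cst|exact: slimit_cst].
Qed.

Lemma Zempty_subring : is_subring (Zempty C).
Proof.
split; [|  |exact: ZemptyM].
  have -> : (1 : tfun C) = cst 1 by apply/funext.
  exact: Zempty_K (in_K1 C).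
move=> f g Zf Zg; have -> : f - g = f + (cst (-1) : tfun C) * g.
  by apply/funext => t; rewrite -[RHS]/(f t + -1 * g t) mulN1r.
by apply: ZemptyD => //; apply: ZemptyM => //; apply: Zempty_K; apply/in_KN/in_K1.
Qed.

(** Truncated sums without variables do not depend on the point, and this passes to
    the limit. *)
Lemma Zempty_cst f t t' : Zempty C f -> f t = f t'.
Proof.
move=> [N [u [hu ->]]].
have E s : (\sum_(n < N) u n) s = \sum_(n < N) u n s.
  by apply: (big_morph (fun g : tfun C => g s)).
rewrite !E; apply: eq_bigr => n _.
have /(ZnP _ _ fset0_lt_q)[w Ww wu] := hu n; rewrite charmap0 in Ww.
apply: (conv_uniq (wu t)); have -> : (fun N => w N t) = (fun N => w N t').
  by apply/funext => d; apply: Wspan_cnil Ww.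
exact: wu.
Qed.

Definition is_mzv (x : C) := Zempty C (cst x : tfun C).

Lemma Zempty_is_mzv f t : Zempty C f -> is_mzv (f t).
Proof.
move=> Zf; rewrite /is_mzv (_ : (cst (f t) : tfun C) = f) //.
by apply/funext => t'; exact: (Zempty_cst t t' Zf).
Qed.
Lemma is_mzvD x y : is_mzv x -> is_mzv y -> is_mzv (x + y).
Proof. exact: ZemptyD. Qed.
Lemma is_mzvM x y : is_mzv x -> is_mzv y -> is_mzv (x * y).
Proof. exact: ZemptyM. Qed.
Lemma is_mzvK x : in_K x -> is_mzv x.
Proof. exact: Zempty_K. Qed.
End Spaces.

(** * Values at the points theta_pt *)

Section Values.
Variables (R : realType) (F : finFieldType) (C : Cinfty R F).
Notation q := #|F|.
Notation io := (embC C).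
Notation io_inj := (@io_inj R F C).
Notation th := (theta_img io).
Notation bb := (carlitz_b io).
Notation seqt := (nat -> tfun C).
Implicit Types (f g : tfun C) (Sigma : {fset posnat}).

Definition Lfun Sigma : tfun C := \prod_(j : Sigma) ((fun t => t (val j) - Ctheta C) : tfun C).

Lemma tprodE (I : Type) (r : seq I) (P : pred I) (g : I -> tfun C) t :
  (\prod_(i <- r | P i) g i) t = \prod_(i <- r | P i) g i t.
Proof. by apply: (big_morph (fun g : tfun C => g t)). Qed.

Lemma tsumE (I : Type) (r : seq I) (P : pred I) (g : I -> tfun C) t :
  (\sum_(i <- r | P i) g i) t = \sum_(i <- r | P i) g i t.
Proof. by apply: (big_morph (fun g : tfun C => g t)). Qed.

Lemma LfunE Sigma t : Lfun Sigma t = Lfactor (charmap Sigma) t.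
Proof.
rewrite /Lfun tprodE.
have -> : charmap Sigma = cmap (enum_fset Sigma).
  by apply: compmapP => j; rewrite charmapE cmapE count_uniq_mem ?fset_uniq.
by rewrite Lfactor_cmap -(big_seq_fsetE _ _ predT (fun j => t j - th)).
Qed.

Lemma conv_unshift (u : nat -> C) x : Cconv (fun n => u n.+1) x -> Cconv u x.
Proof. by move=> h e e0; have [N hN] := h e e0; exists N.+1 => -[|n] // Nn; apply: hN. Qed.

(** The truncations satisfy the identity of [Wspan_tau_stable]; the shift of the
    index disappears in the limit. *)
Lemma Zn_tau Sigma n f : (#|` Sigma| < q)%N -> Zn C Sigma n f ->
  Zn C Sigma (q * n) (Lfun Sigma * twist f).
Proof.
move=> Sq /(ZnP _ _ Sq)[w Ww wf]; apply/ZnP => //.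
have [w' Ww' wE] := Wspan_tau_stable (few_vars_charmap Sq) Ww; exists w' => // t.
have [t' ->] := frob_pt_surj t; apply: conv_unshift.
rewrite -[_ (frob_pt t')]/(Lfun Sigma (frob_pt t') * twist f (frob_pt t')) twistE LfunE.
rewrite (_ : (fun n => _) = (fun n => Lfactor (charmap Sigma) (frob_pt t') * w n t' ^+ q)).
  by apply: convZ; apply: convX; apply: wf.
by apply/funext => d; apply: wE.
Qed.

Definition mzv_span := Kspan (fun u : seqt => exists n c, admissible cnil n c /\ u = mzsum c).

(** Sums without variables do not depend on the point; this is the point at which
    they are evaluated. *)
Definition t0 : posnat -> C := fun=> 0.

Lemma Wspan_mzv_span n w : Wspan cnil n w -> mzv_span w.
Proof. by apply: span_sub => _ [c Ac ->]; apply: span_gen; exists n, c. Qed.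

Lemma chi0_t0 (s : compmap) a : (forall j, s j = 0%N) -> chi s a t0 = 1 :> C.
Proof.
move=> h; have -> : s = cmap [::] by apply: compmapP => j; rewrite h cmapE.
by rewrite chi_cmap /chi_seq big_nil.
Qed.

Lemma in_K_mon_img d (a : {poly_d F}) : in_K (mon_img io a). Proof. exact: in_K_io. Qed.

Lemma in_K_powsum0 n d : in_K (powsum cnil n d t0 : C).
Proof.
apply: in_K_sum => a _; rewrite chi0_t0 ?mul1r; last by move=> j; rewrite cnilE.
by apply/in_KV/in_KX/in_K_mon_img.
Qed.

Lemma in_K_mzsum0 c n d : admissible cnil n c -> in_K (mzsum c d t0 : C).
Proof.
elim: c n d => [|[s1 n1] c IH] n d Ac; first exact: in_K1.
have [s2 [n2 [n10 Ac2 es en]]] := adm_cons_inv Ac.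
have [e1 e2] := cplus_cnil es; subst s1 s2.
by apply: in_K_sum => e _; apply: in_KM; [exact: in_K_powsum0|exact: IH Ac2].
Qed.

Lemma mzv_span_in_K w d : mzv_span w -> in_K (w d t0).
Proof.
elim=> [|k g u Kk [n [c [Ac ->]]] _ IH]; first exact: in_K0.
by apply: in_KD => //; apply: in_KM => //; apply: in_K_mzsum0 Ac.
Qed.

(** Agreement from some index on is enough for the limit to be a multiple zeta value,
    and the finitely many other terms, being in K, only contribute constants to
    partial sums. *)
Definition mzv_seq (y : nat -> C) := (forall d, in_K (y d)) /\
  exists w N, mzv_span w /\ forall d, (N <= d)%N -> y d = w d t0.

Lemma mzv_span_cst k : in_K k -> mzv_span (seq_cst k).
Proof. by move=> Kk; apply: Wspan_mzv_span (Wspan_cst Kk). Qed.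

Lemma mzv_seq_const (y : nat -> C) N k : (forall d, in_K (y d)) -> (forall d, (N <= d)%N -> y d = k) -> mzv_seq y.
Proof.
move=> Ky yk; split=> //; exists (seq_cst k), N; split=> //; apply: mzv_span_cst.
by rewrite -(yk N).
Qed.

Lemma mzv_span_sum n w : (0 < n)%N -> mzv_span w -> mzv_span (partial_sum (powsum cnil n * w)).
Proof.
move=> n0; apply: (span_map (f := fun w => partial_sum (powsum cnil n * w))).
- by rewrite mulr0 partial_sum0.
- by move=> k g v; rewrite mulrDr seq_mulCA partial_sum_lin.
move=> _ [m [c [Ac ->]]]; rewrite -mzsum_cons; apply: span_gen.
exists (n + m)%N, ((cnil, n) :: c); split=> //.
by have := adm_cons cnil n0 Ac; rewrite cplus0.
Qed.

(** If a vanishes eventually, the partial sums are eventually constant; if a is a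
    power sum, they differ eventually from an element of mzv_span by a constant. *)
Lemma mzv_seq_sum (a : nat -> C) (y : nat -> C) :
  (forall e, in_K (a e)) -> mzv_seq y ->
  (exists2 n, (0 < n)%N & forall e, a e = powsum cnil n e t0) \/
  (exists N, forall e, (N <= e)%N -> a e = 0) ->
  mzv_seq (fun d => \sum_(e < d) a e * y e).
Proof.
move=> Ka [Ky [w [N [Ww yw]]]] h.
have Kd d : in_K (\sum_(e < d) a e * y e) by apply: in_K_sum => e _; apply: in_KM.
case: h => [[n n0 an]|[M aM]]; last first.
  apply: (@mzv_seq_const _ M (\sum_(e < M) a e * y e)) => // d Md.
  rewrite -(subnKC Md) big_split_ord /= [X in _ + X]big1 ?addr0 // => e _.
  by rewrite aM ?leq_addr // mul0r.
split=> //.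
(* The correction for the indices at which y and w differ. *)
pose k := \sum_(e < N) a e * (y e - w e t0).
exists (partial_sum (powsum cnil n * w) + seq_cst k), N; split.
  apply: spanD; first exact: mzv_span_sum.
  apply: mzv_span_cst; apply: in_K_sum => e _; apply: in_KM => //.
  by apply: in_KD => //; apply: in_KN; apply: mzv_span_in_K.
move=> d Nd; rewrite -[RHS]/(partial_sum (powsum cnil n * w) d t0 + k) /partial_sum.
have -> : k = \sum_(e < d) a e * (y e - w e t0).
  rewrite -(subnKC Nd) big_split_ord /= [X in _ + X]big1 ?addr0 // => e _.
  by rewrite yw ?leq_addr // subrr mulr0.
rewrite -big_split; apply: eq_bigr => e _ /=.
by rewrite -[(_ * w) e t0]/(powsum cnil n e t0 * w e t0) -an; ring.
Qed.

(** Since a(theta^(q^k)) = a^(q^k). *)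
Lemma chi_pow (s : compmap) (t : posnat -> C) :
  (forall j, s j != 0%N -> exists k, t j = th ^+ (q ^ k)) ->
  exists w, forall a, chi s a t = io a ^+ w.
Proof.
have [l ->] := cmap_surj s => h.
have {}h j : j \in l -> exists k, t j = th ^+ (q ^ k).
  by move=> jl; apply: h; rewrite cmapE -lt0n -has_count has_pred1.
have [w hw] : exists w, forall a, chi_seq l a t = io a ^+ w.
  elim: l h => [|j l IH] h; first by exists 0%N => a; rewrite /chi_seq big_nil.
  have [w hw] := IH (fun i il => h i (mem_behead (s := j :: l) il)).
  have [k hk] := h j (mem_head _ _); exists (q ^ k + w)%N => a.
  by rewrite /chi_seq big_cons -/(chi_seq l a t) hw hk peval_frob peval_theta exprD.
by exists w => a; rewrite chi_cmap.
Qed.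

(** At such a point the power sum of weight n becomes that of weight n - w for some
    w. It is a power sum without variables if w < n, and vanishes in large degree
    otherwise. *)
Lemma mzv_seq_mzsum c (s : compmap) n (t : posnat -> C) :
  (forall j, s j != 0%N -> exists k, t j = th ^+ (q ^ k)) ->
  admissible s n c -> mzv_seq (fun d => mzsum c d t).
Proof.
elim: c s n => [|[s1 n1] c IH] s n hs Ac.
  by apply: (@mzv_seq_const _ 0 1) => // d; apply: in_K1.
have [s2 [n2 [n10 Ac2 es en]]] := adm_cons_inv Ac; subst s n.
have h1 j : s1 j != 0%N -> exists k, t j = th ^+ (q ^ k).
  by move=> h; apply: hs; rewrite cplusE addn_eq0 negb_and h.
have h2 j : s2 j != 0%N -> exists k, t j = th ^+ (q ^ k).
  by move=> h; apply: hs; rewrite cplusE addn_eq0 negb_and h orbT.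
have [w hw] := chi_pow h1.
have sdE e : powsum s1 n1 e t = \sum_(a : {poly_e F}) mon_img io a ^+ w / mon_img io a ^+ n1 :> C.
  by apply: eq_bigr => a _; rewrite hw.
apply: (mzv_seq_sum (a := fun e => powsum s1 n1 e t) (y := fun d => mzsum c d t) _ (IH _ _ h2 Ac2)) => [e|].
  rewrite sdE; apply: in_K_sum => a _; apply: in_KM; [|apply: in_KV]; apply: in_KX; exact: in_K_mon_img.
have im0 e (a : {poly_e F}) := mon_img_neq0 io_inj a.
have [wn|nw] := ltnP w n1; [left|right].
  exists (n1 - w)%N; rewrite ?subn_gt0 // => e; rewrite sdE; apply: eq_bigr => a _.
  rewrite chi0_t0; last by move=> j; rewrite cnilE.
  rewrite mul1r -[in LHS](subnK (ltnW wn)) exprD invfM mulrCA divff ?mulr1 //.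
  by rewrite expf_neq0.
exists (w - n1).+1 => e he; rewrite sdE.
rewrite -[RHS](@sum_monic_eq0 _ _ _ io_inj e 'X^(w - n1)).
  apply: eq_bigr => a _; rewrite hornerXn -[in LHS](subnK nw) exprD mulfK //.
  by rewrite expf_neq0.
by rewrite size_polyXn (leq_ltn_trans he) // ltn_expl // q_gt1.
Qed.

Lemma mzv_seq_lim y x : mzv_seq y -> Cconv y x -> is_mzv x.
Proof.
move=> [_ [w [N [Ww yw]]]] yx.
have {yw}wx : Cconv (fun d => w d t0) x by apply: (conv_ev (N := N) _ yx) => n /yw.
have [z zZ wz] : exists2 z, Zempty C z & slimit w z.
  elim: Ww => [|k g u Kk [n [c [Ac ->]]] _ [z Zz uz]].
    by exists 0; [exact: Zempty0|exact: slimit0].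
  exists ((cst k : tfun C) * zetaA C c + z).
    apply: ZemptyD => //; apply: ZemptyM; first exact: Zempty_K.
    apply: (@Zempty_gen _ _ _ n); apply/ZnP; first exact: fset0_lt_q.
    exists (mzsum c); first by rewrite charmap0; apply: span_gen; exists c.
    by move=> t; apply: (mzsum_conv (fset0_lt_q F) (n := n)); rewrite charmap0.
  apply: slimitD => //; apply: slimitM; first exact: slimit_cst.
  by move=> t; apply: (mzsum_conv (fset0_lt_q F) (n := n)); rewrite charmap0.
by rewrite (conv_uniq wx (wz t0)); apply: Zempty_is_mzv.
Qed.

Lemma theta_ptE Sigma (i : Sigma -> nat) (j : Sigma) :
  theta_pt C i (val j) = th ^+ (q ^ i j).
Proof. by rewrite /theta_pt valK. Qed.

Lemma Zn_val Sigma n f (i : Sigma -> nat) : (#|` Sigma| < q)%N -> Zn C Sigma n f ->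
  is_mzv (f (theta_pt C i)).
Proof.
move=> Sq [r [ks [cs [As ->]]]]; rewrite tsumE.
elim/big_ind: _ => [|x y|k _]; [exact: is_mzvK (in_K0 C)|exact: is_mzvD|].
apply: is_mzvM; first by apply: is_mzvK; exists (ks k).
apply: (mzv_seq_lim (y := fun d => mzsum (cs k) d (theta_pt C i))).
  apply: (mzv_seq_mzsum _ (As k)) => j; rewrite charmapE.
  case: (boolP (j \in Sigma)) => // jS _; exists (i (Sub j jS)).
  by rewrite -(theta_ptE i (Sub j jS)).
exact: mzsum_conv (As k) _.
Qed.

(** * Uniqueness of Newton series *)

Section NewtonSeries.
Variable Sigma : {fset posnat}.

Definition newton_box (cf : (Sigma -> nat) -> C) N (t : posnat -> C) : C :=
  \sum_(m : {ffun Sigma -> 'I_N}) cf (fun j => m j) * \prod_(j : Sigma) bb (m j) (t (val j)).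

Definition newton_series f := exists cf, forall t, Cconv (fun N => newton_box cf N t) (f t).

Lemma newton_series_lin (a : C) f g : newton_series f -> newton_series g -> newton_series ((cst a : tfun C) * f + g).
Proof.
move=> [cf hf] [cg hg]; exists (fun m => a * cf m + cg m) => t.
have -> : (fun N => newton_box (fun m => a * cf m + cg m) N t) = (fun N => a * newton_box cf N t + newton_box cg N t).
  apply/funext => N; rewrite /newton_box mulr_sumr -big_split; apply: eq_bigr => m _ /=.
  by rewrite mulrDl mulrA.
by apply: convD => //; apply: convZ.
Qed.

Lemma newton_series0 : newton_series 0.
Proof.
exists (fun=> 0) => t; rewrite (_ : (fun N => _) = (fun=> 0)); first exact: conv_cst.
by apply/funext => N; rewrite /newton_box big1 // => m _; rewrite mul0r.
Qed.

Lemma newton_series_Zn n f : (#|` Sigma| < q)%N -> Zn C Sigma n f -> newton_series f.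
Proof.
move=> Sq [r [ks [cs [As ->]]]]; elim/big_ind: _ => [|f1 f2 h1 h2|k _].
- exact: newton_series0.
- by have := newton_series_lin 1 h1 h2; rewrite (_ : (cst 1 : tfun C) * f1 = f1) //; apply: mul1r.
rewrite -[_ * _]addr0; apply: newton_series_lin; last exact: newton_series0.
by exists (ncoef C (cs k)) => t; apply: zetaA_newton_series (As k) _.
Qed.

(** The value at theta_pt i only involves the coefficients cf m with m <= i, so that
    the coefficients vanish one after the other, by induction on the sum of the
    indices. *)
Lemma newton_series_uniq f : newton_series f -> (forall i : Sigma -> nat, f (theta_pt C i) = 0) -> f = 0.
Proof.
move=> [cf hf] f0.
suff cf0 i : cf i = 0.
  apply/funext => t; apply: (conv_uniq (hf t)).
  rewrite (_ : (fun N => _) = (fun=> 0)); first exact: conv_cst.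
  by apply/funext => N; rewrite /newton_box big1 // => m _; rewrite cf0 mul0r.
have [s] := ubnP (\sum_j i j)%N; elim: s i => // s IH i hs.
have nz : \prod_(j : Sigma) bb (i j) (th ^+ (q ^ i j)) != 0.
  by apply/prodf_neq0 => j _; apply: carlitz_b_theta_neq0 io_inj _.
suff H : Cconv (fun N => newton_box cf N (theta_pt C i)) (cf i * \prod_(j : Sigma) bb (i j) (th ^+ (q ^ i j))).
  have := conv_uniq H (hf _); rewrite f0 => /eqP; rewrite mulf_eq0 (negbTE nz) orbF.
  by move/eqP.
apply: (conv_ev (u := fun=> cf i * \prod_(j : Sigma) bb (i j) (th ^+ (q ^ i j))) (N := (\sum_j i j).+1)); last exact: conv_cst.
move=> N hN.
have iN j : (i j < N)%N by apply: leq_trans hN; rewrite ltnS (bigD1 j) //= leq_addr.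
pose m0 : {ffun Sigma -> 'I_N} := [ffun j => Ordinal (iN j)].
rewrite /newton_box (bigD1 m0) //= [X in _ = _ + X]big1 ?addr0 => [|m mm0].
  have -> : (fun j => m0 j : nat) = i by apply/funext => j; rewrite ffunE.
  congr (_ * _); by apply: eq_bigr => j _; rewrite ffunE theta_ptE.
have [/existsP[j hj]|] := boolP [exists j, (i j < m j)%N].
  by rewrite (bigD1 j) //= theta_ptE carlitz_b_theta // mul0r mulr0.
rewrite negb_exists => /forallP hle.
have {}hle j : (m j <= i j)%N by have := hle j; rewrite -leqNgt.
rewrite IH ?mul0r //.
have [j hj] : exists j, m j != i j :> nat.
  apply/existsP; rewrite -negb_forall; apply: contra mm0 => /forallP h.
  by apply/eqP/ffunP => j; rewrite ffunE; apply: val_inj; apply/eqP; apply: h.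
rewrite ltnS in hs; apply: leq_trans hs; rewrite (bigD1 j) //= [X in (_ < X)%N](bigD1 j) //=.
rewrite -addSn leq_add //; first by rewrite ltn_neqAle hj hle.
by apply: leq_sum.
Qed.
End NewtonSeries.
End Values.

(** * The iterates of tau on the one-variable zeta value *)

Section Psi.
Variables (R : realType) (F : finFieldType) (C : Cinfty R F).
Notation q := #|F|.
Notation io := (embC C).
Notation io_inj := (@io_inj R F C).
Notation th := (theta_img io).
Notation bb := (carlitz_b io).
Notation ell := (carlitz_ell io).
Notation DD := (carlitz_D io).
Implicit Types (f g : tfun C) (Sigma : {fset posnat}) (j : posnat).

Definition zeta1 j : tfun C := zetaA C [:: (charmap [fset j]%fset, 1%N)].

Lemma fset1_lt_q j : (#|` [fset j]%fset| < q)%N.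
Proof. by rewrite cardfs1 q_gt1. Qed.

Lemma charmap1 j : charmap [fset j]%fset = cmap [:: j].
Proof. by apply: compmapP => i; rewrite charmapE cmapE in_fset1 /= addn0 eq_sym. Qed.

Lemma adm1 j : admissible (charmap [fset j]%fset) 1 [:: (charmap [fset j]%fset, 1%N)].
Proof. by have := adm_cons (charmap [fset j]%fset) (ltn0Sn 0) adm_nil; rewrite cplus0 addn0. Qed.

Lemma Zn_zeta1 j : Zn C [fset j]%fset 1 (zeta1 j).
Proof.
have := Zn_consL (in_K1 C) (adm1 j) (Zn0 C _ 1); rewrite addr0.
by rewrite (_ : _ * _ = zeta1 j) //; apply: mul1r.
Qed.

(** The truncations of the zeta value in closed form: they vanish at theta^(q^i) for
    0 < i <= d. *)
Lemma sum_carlitz_b_ell d (x : C) :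
  \sum_(e < d.+1) bb e x / ell e = (\prod_(i < d) (x - th ^+ (q ^ i.+1))) / ell d.
Proof.
elim: d => [|d IH]; first by rewrite big_ord1 big_ord0 carlitz_b0 ell0.
rewrite big_ord_recr /= IH [in RHS]big_ord_recr /= ellS /carlitz_b [\prod_(i < d.+1) _]big_ord_recl.
rewrite expn0 expr1; set X := \prod_(i < d) (x - th ^+ (q ^ i.+1)).
have h1 := ell_neq0 io_inj d; have h2 := theta_frob_neq io_inj d.
by field; rewrite h1 h2.
Qed.

Lemma zeta1_val j (t : posnat -> C) i : t j = th ^+ (q ^ i) -> zeta1 j t = (i == 0%N)%:R.
Proof.
move=> tj; have := mzsum_conv (fset1_lt_q j) (adm1 j) t => h; apply: (conv_uniq h).
apply: (conv_ev (u := fun=> (i == 0%N)%:R) (N := i.+2)); last exact: conv_cst.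
move=> [|d] // hd; rewrite ltnS in hd.
transitivity (\sum_(e < d.+1) bb e (t j) / ell e); last first.
  apply: eq_bigr => e _; rewrite -[RHS]/(powsum (charmap [fset j]%fset) 1 e t * 1) mulr1.
  by rewrite charmap1 powsum1 ?q_gt1 // big_seq1.
case: i tj hd => [|i] tj hd.
  rewrite big_ord_recl big1 ?addr0 => [|e _]; first by rewrite carlitz_b0 ell0 divr1.
  by rewrite tj carlitz_b_theta // mul0r.
by rewrite sum_carlitz_b_ell (bigD1 (Ordinal (ltnW hd))) //= tj subrr !mul0r.
Qed.

(** The k-th iterate of tau on [zeta1], written with the twist; the two agree since
    these functions are entire ([iter_tauS_psi]). *)
Fixpoint psi j k : tfun C :=
  if k is k'.+1 then Lfun [fset j]%fset * twist (psi j k') else zeta1 j.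

Lemma Zn_psi j k : Zn C [fset j]%fset (q ^ k) (psi j k).
Proof.
elim: k => [|k IH] /=; first exact: Zn_zeta1.
by rewrite expnS; apply: Zn_tau => //; apply: fset1_lt_q.
Qed.

Lemma Lfun1 j t : Lfun [fset j]%fset t = t j - th.
Proof. by rewrite LfunE charmap1 Lfactor_cmap big_seq1. Qed.

(** The twist carries the value at theta^(q^i) to theta^(q^(i+1)), and the factor
    t_j - theta vanishes at theta. *)
Lemma psi_val j k (t : posnat -> C) i : t j = th ^+ (q ^ i) -> psi j k t = if i == k then DD k else 0.
Proof.
elim: k t i => [|k IH] t i tj; first by rewrite /= (zeta1_val tj); case: eqP.
rewrite -[LHS]/(Lfun [fset j]%fset t * twist (psi j k) t) Lfun1 tj.
case: i tj => [|i] tj; first by rewrite expn0 expr1 subrr mul0r.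
rewrite /twist (IH _ i); last by apply: frobq_inj; rewrite qrootK tj frobS.
by rewrite eqSS; case: eqP => [->|_] //; rewrite frobq0 mulr0.
Qed.

(** * Entire functions *)

Definition entire1 j f := exists a : nat -> C,
  (forall r e : R, 0 < r -> 0 < e -> exists M, forall n, (M <= n)%N -> Cabs (a n) * r ^+ n < e)
  /\ forall t, Cconv (fun N => \sum_(n < N) a n * t j ^+ n) (f t).

Definition carlitz_b_poly d : {poly C} := \prod_(i < d) ('X - (th ^+ (q ^ i))%:P).

Lemma carlitz_b_polyE d x : (carlitz_b_poly d).[x] = bb d x.
Proof. by rewrite horner_prod; apply: eq_bigr => i _; rewrite hornerXsubC. Qed.

Lemma size_carlitz_b_poly d : size (carlitz_b_poly d) = d.+1.
Proof. by rewrite size_prod_XsubC /index_enum -enumT size_enum_ord. Qed.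

(** A bound on the Gauss norm of radius r, which is multiplicative over the linear
    factors. *)
Lemma carlitz_b_poly_coef d n (M r : R) : 1 <= M -> 0 < r -> r <= M ->
  Cabs (carlitz_b_poly d)`_n * r ^+ n <= M ^+ d * qprod R F d.
Proof.
move=> M1 r0 rM; have M0 : 0 <= M by apply: le_trans M1.
elim: d n => [|d IH] n.
  rewrite /carlitz_b_poly /qprod !big_ord0 mulr1 coef1; case: n => [|n] /=; first by rewrite Cabs1 mulr1.
  by rewrite Cabs0 mul0r.
have B0 : 0 <= M ^+ d * qprod R F d by rewrite mulr_ge0 ?exprn_ge0 // ltW // qprod_gt0.
rewrite /carlitz_b_poly big_ord_recr /= -/(carlitz_b_poly d) mulrBr coefB coefMX coefMC.
have -> : M ^+ d.+1 * qprod R F d.+1 = M ^+ d * qprod R F d * (M * q%:R ^+ (q ^ d)) by rewrite exprS qprodS; ring.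
have rn k : 0 < r ^+ k by rewrite exprn_gt0.
rewrite -ler_pdivlMr //; apply: CabsB_le; rewrite ler_pdivlMr //.
  case: n => [|n] /=; first by rewrite Cabs0 mul0r mulr_ge0 // mulr_ge0 // exprn_ge0 // ler0n.
  rewrite exprSr [leLHS]mulrA; apply: ler_pM => //; try exact: ltW; try by rewrite mulr_ge0 ?Cabs_ge0 // ltW.
  by rewrite (le_trans rM) // ler_peMr // exprn_ege1 // qR_ge1.
rewrite CabsM mulrAC CabsX Cabs_theta_img; apply: ler_pM => //;
  try by rewrite exprn_ge0 // ler0n.
  by rewrite mulr_ge0 ?Cabs_ge0 // ltW.
by rewrite ler_peMl // exprn_ge0 // ler0n.
Qed.

(** The Newton series is rearranged into a power series. The double series converges
    because the coefficients, of size 1/|ell_k|, are compared with Gauss norms of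
    size M^k qprod k, whose quotient tends to 0 for every radius. *)
Lemma entire_newton j f (c : nat -> C) (B : R) : 0 <= B ->
  (forall k, Cabs (c k) * Cabs (ell k) <= B) ->
  (forall t, Cconv (fun N => \sum_(k < N) c k * bb k (t j)) (f t)) -> entire1 j f.
Proof.
move=> B0 cB hf.
pose u n N := \sum_(k < N) c k * (carlitz_b_poly k)`_n.
have key (r : R) : 0 < r -> forall e, 0 < e -> exists N, forall k n, (N <= k)%N ->
    Cabs (c k * (carlitz_b_poly k)`_n) <= e / r ^+ n.
  move=> r0 e e0; pose M := Num.max 1 r.
  have M1 : 1 <= M by rewrite le_max lexx.
  have [|N hN] := null_seq_newton C (q_gt1 F) M1 (e := e / (B + 1)) _.
    by rewrite divr_gt0 // ltr_wpDl.
  exists N => k n Nk; rewrite ler_pdivlMr ?exprn_gt0 // CabsM -mulrA.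
  have h1 : Cabs (carlitz_b_poly k)`_n * r ^+ n <= M ^+ k * qprod R F k.
    by apply: carlitz_b_poly_coef => //; rewrite le_max lexx orbT.
  have h2 : Cabs (c k) <= B / Cabs (ell k) by rewrite ler_pdivlMr ?Cabs_ell_gt0.
  apply: (@le_trans _ _ (B / Cabs (ell k) * (M ^+ k * qprod R F k))).
    by apply: ler_pM; rewrite ?Cabs_ge0 // mulr_ge0 ?Cabs_ge0 // exprn_ge0 // ltW.
  have := hN k Nk; rewrite expr1 => /ltW h3.
  rewrite -mulrA [_^-1 * _]mulrC; apply: (le_trans (ler_wpM2l B0 h3)).
  rewrite mulrA ler_pdivrMr ?ltr_wpDl // mulrC ler_pM2l //.
  by rewrite lerDl ler01.
have uS n N : u n N.+1 - u n N = c N * (carlitz_b_poly N)`_n by rewrite /u big_ord_recr /= [X in X - _]addrC addrK.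
have uconv n : Cconv (u n) (Clim (u n)).
  have [|x hx] := @conv_exists _ _ _ (u n); last by rewrite (Clim_conv hx).
  move=> e e0; have [|N hN] := key 1 ltr01 (e / 2) _; first by rewrite divr_gt0.
  exists N => k Nk; rewrite uS; apply: (le_lt_trans (hN k n Nk)).
  by rewrite expr1n divr1 ltr_pdivrMr // ltr_pMr // ltr1n.
have tail (r e : R) : 0 < r -> 0 < e -> exists N, forall n k, (N <= k)%N ->
    Cabs (Clim (u n) - u n k) * r ^+ n <= e.
  move=> r0 e0; have [N hN] := key r r0 e e0; exists N => n k Nk.
  rewrite -ler_pdivlMr ?exprn_gt0 //; apply: (conv_tail (uconv n)).
    by rewrite divr_ge0 ?exprn_ge0 // ltW.
  by move=> l kl; rewrite uS; apply: hN; apply: leq_trans kl.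
exists (fun n => Clim (u n)); split.
  move=> r e r0 e0; have [|N hN] := tail r (e / 2) r0 _; first by rewrite divr_gt0.
  exists N => n Nn; apply: (@le_lt_trans _ _ (e / 2)); last by rewrite ltr_pdivrMr // ltr_pMr // ltr1n.
  have := hN n n Nn; rewrite (_ : u n n = 0) ?subr0 // /u big1 // => k _.
  by rewrite [(carlitz_b_poly k)`_n]nth_default ?mulr0 // size_carlitz_b_poly.
move=> t; apply: (conv_close (hf t)) => e e0.
pose r := Num.max 1 (Cabs (t j)).
have r1 : 1 <= r by rewrite le_max lexx.
have r0 : 0 < r by apply: lt_le_trans r1.
have [|N hN] := tail r (e / 2) r0 _; first by rewrite divr_gt0.
exists N => n Nn; apply: (@le_lt_trans _ _ (e / 2)); last by rewrite ltr_pdivrMr // ltr_pMr // ltr1n.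
have -> : \sum_(k < n) c k * bb k (t j) = \sum_(i < n) u i n * t j ^+ i.
  rewrite /u; under [RHS]eq_bigr => i _ do rewrite mulr_suml.
  rewrite exchange_big; apply: eq_bigr => k _ /=.
  rewrite -carlitz_b_polyE (@horner_coef_wide _ n) ?size_carlitz_b_poly // mulr_sumr.
  by apply: eq_bigr => i _; rewrite mulrA.
rewrite -sumrB; apply: Cabs_sum_le => [|i _]; first by rewrite divr_ge0 // ltW.
rewrite -mulrBl CabsM CabsX; apply: le_trans (hN i n Nn).
by apply: ler_wpM2l; rewrite ?Cabs_ge0 // lerXn2r ?nnegrE ?Cabs_ge0 ?(ltW r0) // le_max lexx orbT.
Qed.

Lemma box1 j (G : nat -> C) N :
  \sum_(m : {ffun [fset j]%fset -> 'I_N}) G (m (Sub j (fset11 j))) = \sum_(k < N) G k.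
Proof.
rewrite (reindex (fun k : 'I_N => [ffun=> k] : {ffun [fset j]%fset -> 'I_N})) /=.
  by apply: eq_bigr => k _; rewrite ffunE.
exists (fun m : {ffun [fset j]%fset -> 'I_N} => m (Sub j (fset11 j))) => [k|m] _.
  by rewrite ffunE.
apply/ffunP => i; rewrite ffunE; congr (m _); apply: val_inj => /=.
by have := fsvalP i; rewrite in_fset1 => /eqP ->.
Qed.

Lemma fset1P j (i : [fset j]%fset) : i = Sub j (fset11 j).
Proof. by apply: val_inj => /=; have := fsvalP i; rewrite in_fset1 => /eqP. Qed.

Lemma prod1 j (G : [fset j]%fset -> C) : \prod_i G i = G (Sub j (fset11 j)).
Proof.
rewrite (bigD1 (Sub j (fset11 j))) //= big1 ?mulr1 // => i.
by rewrite (fset1P i) eqxx.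
Qed.

Lemma newton1_Zn j n f : Zn C [fset j]%fset n f -> exists (c : nat -> C) (B : R),
  [/\ 0 <= B, forall k, Cabs (c k) * Cabs (ell k) <= B
    & forall t, Cconv (fun N => \sum_(k < N) c k * bb k (t j)) (f t)].
Proof.
move=> [r [ks [cs [As ->]]]].
pose cc k : [fset j]%fset -> nat := fun=> k.
exists (fun k => \sum_(i < r) Cemb C (ks i) * ncoef C (cs i) (cc k)),
  (\sum_(i < r) Cabs (Cemb C (ks i))); split.
- by apply: sumr_ge0 => i _; apply: Cabs_ge0.
- move=> k; rewrite -ler_pdivlMr ?Cabs_ell_gt0 //; apply: Cabs_sum_le.
    by rewrite divr_ge0 ?Cabs_ge0 // sumr_ge0 // => i _; apply: Cabs_ge0.
  move=> i _; rewrite ler_pdivlMr ?Cabs_ell_gt0 // CabsM -mulrA.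
  apply: (@le_trans _ _ (Cabs (Cemb C (ks i)))).
    rewrite ler_piMr ?Cabs_ge0 //.
    exact: (ncoef_bound C (fset1_lt_q j) (As i) (cc k) (Sub j (fset11 j))).
  by rewrite (bigD1 i) //= lerDl sumr_ge0 // => i' _; apply: Cabs_ge0.
move=> t; rewrite tsumE.
rewrite (_ : (fun N => _) = (fun N => \sum_(i < r) Cemb C (ks i) * (\sum_(k < N) ncoef C (cs i) (cc k) * bb k (t j)))).
  apply: conv_sum => i _; apply: convZ.
  have := zetaA_newton_series (fset1_lt_q j) (As i) t.
  rewrite (_ : (fun N => _) = (fun N => \sum_(k < N) ncoef C (cs i) (cc k) * bb k (t j))) //.
  apply/funext => N; rewrite -(box1 j (fun k => ncoef C (cs i) (cc k) * bb k (t j))).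
  apply: eq_bigr => m _; rewrite prod1 /=; congr (_ * _); congr ncoef.
  by apply/funext => i'; rewrite (fset1P i').
apply/funext => N; under [RHS]eq_bigr => i _ do rewrite mulr_sumr.
rewrite exchange_big; apply: eq_bigr => k _ /=; rewrite mulr_suml.
by apply: eq_bigr => i _; rewrite mulrA.
Qed.

Lemma entire_psi j k : entire1 j (psi j k).
Proof.
by have [c [B [B0 cB hc]]] := newton1_Zn (Zn_psi j k); exact: (entire_newton B0 cB hc).
Qed.

(** If u^q converges to y, then u converges to the q-th root of y. So if u diverges,
    both limits are the default value 0, which is fixed by the Frobenius. *)
Lemma Clim_frob (u : nat -> C) : Clim (fun n => u n ^+ q) = Clim u ^+ q.
Proof.
have [[x hx]|hx] := pselect (exists x, Cconv u x).
  by rewrite (Clim_conv hx) (Clim_conv (convX q hx)).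
have N1 (v : nat -> C) : ~ (exists x, Cconv v x) -> Clim v = 0.
  move=> hv; rewrite /Clim; case: xgetP => // y _ /= /convE hy.
  by case: hv; exists y.
rewrite !N1 ?frobq0 // => -[y hy]; apply: hx; exists (qroot y) => e e0.
have [|N hN] := hy (e ^+ q) _; first by rewrite exprn_gt0.
exists N => n Nn; rewrite ltNge; apply/negP => h.
have : e ^+ q <= Cabs (u n - qroot y) ^+ q by rewrite lerXn2r ?nnegrE ?Cabs_ge0 // ltW.
apply/negP; rewrite -ltNge -CabsX (frobE F) (frobB io) -!(frobE F) qrootK.
exact: hN.
Qed.

Definition entire Sigma f := exists a, entire_coef (Sigma := Sigma) a /\ f = entire_eval a.

(** The q-th power of sum_m a_m t^m is sum_m a_m^q (t^q)^m, whichever expansion of f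
    is used to define tau. *)
Lemma tau_twist Sigma f : entire Sigma f -> tau Sigma f = twist f.
Proof.
move=> [a0 ha0]; apply: twist_uniq => t; rewrite /tau.
have [_ fE] : entire_coef (@coefs R F C Sigma f) /\ f = entire_eval (@coefs R F C Sigma f).
  by rewrite /coefs; case: xgetP => [a _ //|/(_ a0)[]].
rewrite [in RHS]fE /entire_eval -Clim_frob; congr Clim; apply/funext => N.
rewrite frobq_sum; apply: eq_bigr => m _; rewrite exprMn -prodrXl; congr (_ * _).
by apply: eq_bigr => j _; rewrite /frob_pt -!exprM mulnC.
Qed.

Lemma tauS_twist Sigma f : entire Sigma f -> tauS Sigma f = Lfun Sigma * twist f.
Proof. by move=> h; rewrite /tauS tau_twist. Qed.

Lemma bounded_seq (u : nat -> R) (M : nat) : exists2 B : R, 1 <= B & forall n, (n < M)%N -> u n <= B.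
Proof.
elim: M => [|M [B B1 hB]]; first by exists 1.
exists (Num.max B (u M)) => [|n]; first by rewrite le_max B1.
rewrite ltnS leq_eqVlt => /orP[/eqP->|/hB h]; rewrite le_max ?lexx ?orbT //.
by rewrite h.
Qed.

Lemma finite_box Sigma M (A : set (Sigma -> nat)) :
  (forall m, A m -> forall j : Sigma, (m j < M)%N) -> finite_set A.
Proof.
move=> h; pose B : set (Sigma -> nat) := [set (fun j : Sigma => val (m j)) | m in [set: {ffun Sigma -> 'I_M}]]%classic.
apply: (@sub_finite_set _ _ B); last by apply: finite_image; apply: finite_finset.
move=> m Am; exists [ffun j => Ordinal (h m Am j)] => //.
by apply/funext => j; rewrite ffunE.
Qed.

Lemma box_finite Sigma (A : set (Sigma -> nat)) : finite_set A ->
  exists M, forall m, A m -> forall j : Sigma, (m j < M)%N.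
Proof.
move=> /(finite_image (fun m : Sigma -> nat => (\sum_j m j)%N)) /finite_seqP[s hs].
exists (\sum_(n <- s) n).+1 => m Am j.
have : (\sum_j m j)%N \in s.
  have : [set` s]%classic (\sum_j m j)%N by rewrite -hs; exists m.
  by [].
move=> ms; apply: (@leq_ltn_trans (\sum_j m j)); first by rewrite (bigD1 j) //= leq_addr.
by rewrite ltnS (big_rem _ ms) /= leq_addr.
Qed.

(** Each factor is bounded at radius r, so that a product can be large only if every
    index is small. *)
Lemma entire_coef_prod Sigma (v : C) (a : Sigma -> nat -> C) :
  (forall (j : Sigma) r e, 0 < r -> 0 < e -> exists M, forall n, (M <= n)%N -> Cabs (a j n) * r ^+ n < e) ->
  entire_coef (fun m : Sigma -> nat => v * \prod_(j : Sigma) a j (m j)).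
Proof.
move=> ha r e r0 e0.
have [->|v0] := eqVneq v 0.
  apply: (@finite_box _ 0) => m /=; rewrite mul0r Cabs0 mul0r => h.
  by have := lt_le_trans e0 h; rewrite ltxx.
have vp := Cabs_gt0 v0.
have Hj (j : Sigma) : exists B : R, 1 <= B /\ forall n, Cabs (a j n) * r ^+ n <= B.
  have [M hM] := ha j r 1 r0 ltr01.
  have [B B1 hB] := bounded_seq (fun n => Cabs (a j n) * r ^+ n) M.
  exists B; split=> // n; have [/hB//|Mn] := ltnP n M.
  by apply: le_trans B1; apply/ltW/hM.
have [B hB] := choice Hj.
pose P := \prod_j B j.
have P0 : 0 < P by apply: prodr_gt0 => j _; apply: lt_le_trans ltr01 (hB j).1.
have Hm (j : Sigma) : exists M, forall n, (M <= n)%N -> Cabs (a j n) * r ^+ n < e / (Cabs v * P).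
  by apply: ha => //; rewrite divr_gt0 // mulr_gt0.
have [M hM] := choice Hm.
apply: (@finite_box _ (\max_j M j)) => m /= hm j; rewrite ltnNge; apply/negP => hj.
have {}hj : (M j <= m j)%N by apply: leq_trans hj; apply: leq_bigmax.
move: hm; rewrite leNgt => /negP; apply.
rewrite CabsM Cabs_prod -prodrXr -mulrA -big_split /= mulrC -ltr_pdivlMr //.
rewrite (bigD1 j) //=.
have hB' : \prod_(i | i != j) (Cabs (a i (m i)) * r ^+ m i) <= \prod_(i | i != j) B i.
  by apply: ler_prod => i _; rewrite (hB i).2 andbT mulr_ge0 ?Cabs_ge0 // exprn_ge0 // ltW.
have Pj : 0 < \prod_(i | i != j) B i.
  by apply: prodr_gt0 => i _; apply: lt_le_trans ltr01 (hB i).1.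
apply: (@le_lt_trans _ _ (Cabs (a j (m j)) * r ^+ m j * \prod_(i | i != j) B i)).
  by apply: ler_wpM2l => //; rewrite mulr_ge0 ?Cabs_ge0 // exprn_ge0 // ltW.
rewrite -ltr_pdivlMr //; apply: (lt_le_trans (hM j _ hj)).
rewrite invfM mulrA ler_pM2l ?divr_gt0 //.
by rewrite lef_pV2 ?posrE // /P [X in _ <= X](bigD1 j) //= ler_peMl ?(hB j).1 // ltW.
Qed.

Lemma entire_coef0 Sigma : entire_coef (fun _ : Sigma -> nat => 0 : C).
Proof.
move=> r e r0 e0; apply: (@finite_box _ 0) => m /=; rewrite Cabs0 mul0r => h.
by have := lt_le_trans e0 h; rewrite ltxx.
Qed.

Lemma entire_coefD Sigma (a b : (Sigma -> nat) -> C) :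
  entire_coef a -> entire_coef b -> entire_coef (fun m => a m + b m).
Proof.
move=> ha hb r e r0 e0.
apply: (@sub_finite_set _ _ ([set m | e <= Cabs (a m) * r ^+ (\sum_(j : Sigma) m j)%N] `|`
   [set m | e <= Cabs (b m) * r ^+ (\sum_(j : Sigma) m j)%N])%classic).
  move=> m /= h; have rk : 0 < r ^+ (\sum_(j : Sigma) m j)%N by rewrite exprn_gt0.
  have [|h1] := leP e (Cabs (a m) * r ^+ (\sum_j m j)%N); first by left.
  right; rewrite leNgt; apply/negP => h2; move: h; rewrite leNgt => /negP; apply.
  rewrite -ltr_pdivlMr //; apply: CabsD_lt; rewrite ltr_pdivlMr //.
by rewrite finite_setU; split; [apply: ha|apply: hb].
Qed.

(** Entire expansions that converge at every point. Unlike equality with the value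
    of a limit operator, this is additive. *)
Definition sentire Sigma f := exists a, entire_coef (Sigma := Sigma) a /\
  forall t, Cconv (fun N => \sum_(m : {ffun Sigma -> 'I_N})
    a (fun j : Sigma => m j) * \prod_(j : Sigma) t (val j) ^+ m j) (f t).

Lemma sentire_entire Sigma f : sentire Sigma f -> entire Sigma f.
Proof.
move=> [a [ha hf]]; exists a; split=> //; apply/funext => t.
by rewrite /entire_eval (Clim_conv (hf t)).
Qed.

Lemma sentire0 Sigma : sentire Sigma 0.
Proof.
exists (fun=> 0); split; first exact: entire_coef0.
move=> t; rewrite (_ : (fun N => _) = (fun=> 0)); first exact: conv_cst.
by apply/funext => N; rewrite big1 // => m _; rewrite mul0r.
Qed.

Lemma sentireD Sigma f g : sentire Sigma f -> sentire Sigma g -> sentire Sigma (f + g).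
Proof.
move=> [a [ha hf]] [b [hb hg]]; exists (fun m => a m + b m); split; first exact: entire_coefD.
move=> t; rewrite -[(f + g) t]/(f t + g t).
rewrite (_ : (fun N => _) = (fun N => (\sum_(m : {ffun Sigma -> 'I_N})
    a (fun j : Sigma => m j) * \prod_(j : Sigma) t (val j) ^+ m j) + (\sum_(m : {ffun Sigma -> 'I_N})
    b (fun j : Sigma => m j) * \prod_(j : Sigma) t (val j) ^+ m j))).
  exact: convD.
by apply/funext => N; rewrite -big_split; apply: eq_bigr => m _; rewrite mulrDl.
Qed.

Lemma sentire_prod Sigma (v : C) (f : Sigma -> tfun C) :
  (forall j : Sigma, entire1 (val j) (f j)) -> sentire Sigma ((cst v : tfun C) * \prod_(j : Sigma) f j).
Proof.
move=> /choice[a ha]; exists (fun m : Sigma -> nat => v * \prod_(j : Sigma) a j (m j)); split.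
  by apply: entire_coef_prod => j r e r0 e0; apply: (ha j).1.
move=> t; rewrite -[(_ * _ : tfun C) t]/(v * (\prod_(j : Sigma) f j) t) tprodE.
rewrite (_ : (fun N => _) = (fun N => v * \prod_(j : Sigma) \sum_(n < N) a j n * t (val j) ^+ n)).
  by apply: convZ; apply: conv_prod => j _; apply: (ha j).2.
apply/funext => N; rewrite bigA_distr_bigA mulr_sumr; apply: eq_bigr => m _.
by rewrite -mulrA -big_split.
Qed.
End Psi.

(** * The basis dual to the points theta_pt *)

Section Trivial.
Variables (R : realType) (F : finFieldType) (C : Cinfty R F).
Notation q := #|F|.
Notation io := (embC C).
Notation io_inj := (@io_inj R F C).
Notation DD := (carlitz_D io).
Implicit Types (f g : tfun C).

Lemma Zn_psi_prod (m : posnat -> nat) (l : seq posnat) : uniq l -> (size l < q)%N ->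
  Zn C [fset x in l]%fset (\sum_(j <- l) q ^ m j)%N (\prod_(j <- l) psi j (m j)).
Proof.
elim: l => [|j l IH] /= ul sl.
  rewrite !big_nil; have -> : [fset x in [::]]%fset = fset0 :> {fset posnat}.
    by apply/fsetP => x; rewrite !inE.
  apply/ZnP; first exact: fset0_lt_q.
  by exists 1; [rewrite charmap0; exact: Wspan1|exact: slimit1].
have /andP[jl {}ul] := ul; rewrite !big_cons.
have -> : [fset x in j :: l]%fset = ([fset j] `|` [fset x in l])%fset.
  by apply/fsetP => x; rewrite !inE.
apply: ZnM; last by apply: IH => //; apply: ltnW.
- by apply/fdisjointP => x; rewrite !inE => /eqP ->.
- have -> : ([fset j] `|` [fset x in l] = [fset x in j :: l])%fset.
    by apply/fsetP => x; rewrite !inE.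
  by rewrite card_fseq undup_id //= jl.
exact: Zn_psi.
Qed.

Section OneSigma.
Variable Sigma : {fset posnat}.
Hypothesis Sq : (#|` Sigma| < q)%N.
Notation pt := (theta_pt C (Sigma := Sigma)).

Definition dual_cst (m : Sigma -> nat) : C := \prod_(j : Sigma) (DD (m j))^-1.

Definition dual_mzv (m : Sigma -> nat) : tfun C :=
  (cst (dual_cst m) : tfun C) * \prod_(j : Sigma) psi (val j) (m j).

Lemma in_K_dual_cst m : in_K (dual_cst m).
Proof. by apply: in_K_prod => j _; apply/in_KV/in_K_carlitz_D. Qed.

Lemma Zn_dual m : Zn C Sigma (\sum_(j : Sigma) q ^ m j)%N (dual_mzv m).
Proof.
apply: ZnZ => //; first exact: in_K_dual_cst.
have := @Zn_psi_prod (extend0 0%N m) (enum_fset Sigma) (fset_uniq _) Sq.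
have E (l : seq posnat) : l =i Sigma -> [fset x in l]%fset = Sigma.
  by move=> h; apply/fsetP => x; rewrite !inE h.
rewrite (E _ (fun _ => erefl)).
rewrite (big_seq_fsetE _ _ predT (fun j => q ^ extend0 0%N m j)%N).
rewrite (big_seq_fsetE _ _ predT (fun j => psi j (extend0 0%N m j))) /=.
by under eq_bigr do rewrite extend0_val; under [X in Zn _ _ _ X]eq_bigr do rewrite extend0_val.
Qed.

Lemma dual_mzv_val m i : dual_mzv m (pt i) = (i == m :> (Sigma -> nat))%:R.
Proof.
rewrite -[LHS]/(dual_cst m * (\prod_(j : Sigma) psi (val j) (m j)) (pt i)) tprodE -big_split /=.
case: eqP => [->|im].
  rewrite big1 // => j _; rewrite (psi_val _ (theta_ptE C m j)) eqxx mulVf //.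
  exact: carlitz_D_neq0 io_inj _.
have [j hj] : exists j, i j != m j.
  apply/not_existsP => h; apply: im; apply/funext => j.
  by apply/eqP/negPn/negP; apply: h.
by rewrite (bigD1 j) //= (psi_val _ (theta_ptE C i j)) (negbTE hj) mulr0 mul0r.
Qed.

Definition supp_in f M := forall i, f (pt i) <> 0 -> forall j, (i j < M)%N.

(** What is used of a trivial multiple zeta value. Unlike membership in a graded
    piece, this passes to sums over different weights. *)
Definition interpolable f := [/\ newton_series Sigma f, exists M, supp_in f M & forall i, is_mzv (f (pt i))].

Lemma supp_in_weaken f M M' : (M <= M')%N -> supp_in f M -> supp_in f M'.
Proof. by move=> MM h i fi j; apply: leq_trans MM; apply: h. Qed.

Lemma interpolableD f g : interpolable f -> interpolable g -> interpolable (f + g).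
Proof.
move=> [Nf [M sf] Zf] [Ng [M' sg] Zg]; split.
- by have := newton_series_lin 1 Nf Ng; rewrite (_ : (cst 1 : tfun C) * f = f) //; apply: mul1r.
- exists (maxn M M') => i; rewrite -[(f + g) _]/(f (pt i) + g (pt i)) => h j.
  have [f0|f0] := eqVneq (f (pt i)) 0; last first.
    by apply: leq_trans (leq_maxl _ _); apply: sf; apply/eqP.
  apply: leq_trans (leq_maxr _ _); apply: sg => g0; apply: h.
  by rewrite f0 g0 addr0.
by move=> i; apply: is_mzvD.
Qed.

Lemma interpolable0 : interpolable 0.
Proof.
split; [exact: newton_series0|by exists 0%N => i|].
by move=> i; apply: is_mzvK (in_K0 C).
Qed.

Lemma Ztriv_n_interpolable n f : Ztriv_n C Sigma n f -> interpolable f.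
Proof.
move=> [Zf Ff]; split; first exact: newton_series_Zn Zf.
- by have [M hM] := box_finite Ff; exists M => i fi; apply: hM.
- by move=> i; apply: Zn_val Zf.
Qed.

Lemma Ztriv_interpolable f : Ztriv C Sigma f -> interpolable f.
Proof.
move=> [N [g [hg ->]]]; elim/big_ind: _ => [||n _]; [exact: interpolable0|exact: interpolableD|].
exact: Ztriv_n_interpolable.
Qed.

Lemma newton_seriesB f g : newton_series Sigma f -> newton_series Sigma g -> newton_series Sigma (f - g).
Proof.
move=> Nf Ng; have := newton_series_lin (-1) Ng Nf.
by rewrite (_ : (cst (-1) : tfun C) * g + f = f - g) //; apply/funext => t;
  rewrite -[LHS]/(-1 * g t + f t) mulN1r addrC.
Qed.

Lemma newton_series_ext f g : newton_series Sigma f -> newton_series Sigma g -> (forall i, f (pt i) = g (pt i)) -> f = g.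
Proof.
move=> Nf Ng h; apply/eqP; rewrite -subr_eq0; apply/eqP.
apply: (newton_series_uniq (newton_seriesB Nf Ng)) => i.
by rewrite -[LHS]/(f (pt i) - g (pt i)) h subrr.
Qed.

Definition box_fun M (m : {ffun Sigma -> 'I_M}) : Sigma -> nat := fun j => m j.

Lemma box_sum (V : zmodType) M (G : (Sigma -> nat) -> V) (i : Sigma -> nat) :
  (G i <> 0 -> forall j, (i j < M)%N) ->
  \sum_(m : {ffun Sigma -> 'I_M}) (if i == box_fun m then G i else 0) = G i.
Proof.
move=> h; have [a0|/eqP a0] := eqVneq (G i) 0.
  by rewrite big1 ?a0 // => m _; case: eqP.
have {}h := h a0; pose m0 : {ffun Sigma -> 'I_M} := [ffun j => Ordinal (h j)].
have e0 : box_fun m0 = i by apply/funext => j; rewrite /box_fun ffunE.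
rewrite (bigD1 m0) //= e0 eqxx big1 ?addr0 // => m mm0.
case: eqP => // im.
case/eqP: mm0; apply/ffunP => j; apply: val_inj => /=; rewrite ffunE /=.
by rewrite im.
Qed.

(** Makes the choice of the box in [tensor_lift] immaterial. *)
Lemma box_sum_indep (V : zmodType) M M' (G : (Sigma -> nat) -> V) :
  (forall i, G i <> 0 -> forall j, (i j < M)%N) ->
  (forall i, G i <> 0 -> forall j, (i j < M')%N) ->
  \sum_(m : {ffun Sigma -> 'I_M}) G (box_fun m) = \sum_(m : {ffun Sigma -> 'I_M'}) G (box_fun m).
Proof.
move=> h h'; under eq_bigr => m _ do rewrite -(box_sum (h' (box_fun m))).
rewrite exchange_big; apply: eq_bigr => m' _ /=.
rewrite -[RHS](box_sum (h (box_fun m'))); apply: eq_bigr => m _.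
by rewrite eq_sym; case: eqP => [->|].
Qed.

Lemma newton_series_sum (I : Type) (r : seq I) (P : pred I) (h : I -> tfun C) :
  (forall i, P i -> newton_series Sigma (h i)) -> newton_series Sigma (\sum_(i <- r | P i) h i).
Proof.
move=> hh; elim/big_ind: _ => [|f g Nf Ng|//]; first exact: newton_series0.
by have := newton_series_lin 1 Nf Ng; rewrite (_ : (cst 1 : tfun C) * f = f) //; apply: mul1r.
Qed.

(** Both sides are Newton series with the same values at the points theta_pt. *)
Lemma dual_decomposition f M : newton_series Sigma f -> supp_in f M ->
  f = \sum_(m : {ffun Sigma -> 'I_M}) (cst (f (pt (box_fun m))) : tfun C) * dual_mzv (box_fun m).
Proof.
move=> Nf sf; apply: newton_series_ext => // [|i].
  apply: newton_series_sum => m _; rewrite -[_ * _]addr0; apply: newton_series_lin; last exact: newton_series0.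
  exact: newton_series_Zn (Zn_dual _).
rewrite tsumE -[LHS](box_sum (G := fun i => f (pt i)) (sf i)); apply: eq_bigr => m _.
rewrite -[RHS]/(f (pt (box_fun m)) * dual_mzv (box_fun m) (pt i)) dual_mzv_val.
by case: eqP => [->|_]; rewrite ?mulr1 ?mulr0.
Qed.

Lemma finite_supp f M : supp_in f M -> finite_set [set i : Sigma -> nat | f (pt i) <> 0].
Proof. by move=> sf; apply: (@finite_box _ M) => i /sf. Qed.

Lemma Ztriv_n0 n : Ztriv_n C Sigma n 0.
Proof.
split; first exact: Zn0.
by apply: (@finite_supp _ 0) => i.
Qed.

Lemma Ztriv_nD n f g : Ztriv_n C Sigma n f -> Ztriv_n C Sigma n g -> Ztriv_n C Sigma n (f + g).
Proof.
move=> hf hg; have [_ [M sM] _] := interpolableD (Ztriv_n_interpolable hf) (Ztriv_n_interpolable hg).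
by split; [apply: ZnD => //; [case: hf|case: hg]|apply: finite_supp sM].
Qed.

Lemma ZtrivD f g : Ztriv C Sigma f -> Ztriv C Sigma g -> Ztriv C Sigma (f + g).
Proof. by apply: graded_sumD => [|n f' g']; [exact: Ztriv_n0|exact: Ztriv_nD]. Qed.

Lemma Ztriv_gen n f : Ztriv_n C Sigma n f -> Ztriv C Sigma f.
Proof. by apply: graded_sum_gen; apply: Ztriv_n0. Qed.

Lemma Ztriv0 : Ztriv C Sigma 0. Proof. exact: Ztriv_gen (Ztriv_n0 0). Qed.

Lemma Ztriv_sum (I : Type) (r : seq I) (P : pred I) (h : I -> tfun C) :
  (forall i, P i -> Ztriv C Sigma (h i)) -> Ztriv C Sigma (\sum_(i <- r | P i) h i).
Proof. by move=> hh; elim/big_ind: _ => [||//]; [exact: Ztriv0|exact: ZtrivD]. Qed.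

Lemma ZtrivM z f : Zempty C z -> Ztriv C Sigma f -> Ztriv C Sigma (z * f).
Proof.
move=> [N [u [hu ->]]] [M [v [hv ->]]]; rewrite mulr_suml.
apply: Ztriv_sum => a _; rewrite mulr_sumr; apply: Ztriv_sum => b _.
apply: (@Ztriv_gen (a + b)).
have [Zv Fv] := hv b; have [L sL] := box_finite Fv.
split; first by have := @ZnM _ _ _ fset0 Sigma a b (u a) (v b); rewrite fset0U; apply => //; apply: fdisjoint0X.
apply: (@finite_supp _ L) => i h j; apply: sL => /= v0; apply: h.
by rewrite -[LHS]/(u a (pt i) * v b (pt i)) v0 mulr0.
Qed.

Lemma Ztriv_submod : submod_over (Zempty C) (Ztriv C Sigma).
Proof. by split=> [|r x y Zr Zx Zy]; [exact: Ztriv0|apply: ZtrivD => //; apply: ZtrivM]. Qed.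

Lemma Ztriv_dual m : Ztriv C Sigma (dual_mzv m).
Proof.
apply: (@Ztriv_gen (\sum_(j : Sigma) q ^ m j)%N); split; first exact: Zn_dual.
apply: (@finite_supp _ (\sum_j m j).+1) => i; rewrite dual_mzv_val => h j.
have -> : i = m by case: eqP h.
by rewrite ltnS (bigD1 j) //= leq_addr.
Qed.

(** * The module structure over K[tau] *)

Lemma Ztriv_entire f : Ztriv C Sigma f -> entire Sigma f.
Proof.
move=> /Ztriv_interpolable[Nf [M sf] _]; apply: sentire_entire.
rewrite (dual_decomposition Nf sf); elim/big_ind: _ => [||m _]; [exact: sentire0|exact: sentireD|].
rewrite /dual_mzv mulrA.
have -> : (cst (f (pt (box_fun m))) : tfun C) * (cst (dual_cst (box_fun m)) : tfun C) =
  (cst (f (pt (box_fun m)) * dual_cst (box_fun m)) : tfun C) by [].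
by apply: sentire_prod => j; apply: entire_psi.
Qed.

Lemma Ztriv_tauS f : Ztriv C Sigma f -> tauS Sigma f = Lfun Sigma * twist f.
Proof. by move=> /Ztriv_entire; apply: tauS_twist. Qed.

Lemma theta_pt_frob (i : Sigma -> nat) : pt (fun j => (i j).+1) = frob_pt (pt i).
Proof.
apply/funext => j; rewrite /frob_pt /theta_pt; case: insubP => [j' _ _|_].
  by rewrite -exprM expnSr.
by rewrite frobq0.
Qed.

(** If tau_Sigma f does not vanish at theta_pt i, then all i_j are positive, because
    of the factors t_j - theta, and f does not vanish at theta_pt (i - 1). *)
Lemma Ztriv_n_tau n f : Ztriv_n C Sigma n f -> Ztriv_n C Sigma (q * n) (tauS Sigma f).
Proof.
move=> hf; have [Zf Ff] := hf; rewrite Ztriv_tauS; last exact: Ztriv_gen hf.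
split; first exact: Zn_tau.
have [M sM] := box_finite Ff.
apply: (@finite_supp _ M.+1) => i h j; rewrite ltnS.
case E : (i j) => [|k] //.
have h1 j' : (0 < i j')%N.
  rewrite lt0n; apply/eqP => ij; apply: h.
  rewrite -[LHS]/(Lfun Sigma (pt i) * twist f (pt i)) /Lfun tprodE (bigD1 j') //=.
  by rewrite theta_ptE ij expn0 expr1 subrr !mul0r.
have ei : i = (fun j => ((i j).-1).+1) by apply/funext => j'; rewrite prednK.
have {}h : f (pt (fun j => (i j).-1)) <> 0.
  move=> f0; apply: h; rewrite ei theta_pt_frob.
  by rewrite -[LHS]/(Lfun Sigma (frob_pt (pt _)) * twist f (frob_pt (pt _))) twistE f0 frobq0 mulr0.
by have := sM _ h j; rewrite E.
Qed.

Lemma twistD f g : twist (f + g) = twist f + twist g.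
Proof. by apply/funext => t; rewrite /twist -[(f + g) _]/(f _ + g _) frobqD. Qed.

Lemma twistM f g : twist (f * g) = twist f * twist g.
Proof. by apply/funext => t; rewrite /twist -[(f * g) _]/(f _ * g _) exprMn. Qed.

Lemma twist_cst k : twist (cst k : tfun C) = cst (k ^+ q). Proof. by []. Qed.

Lemma twist0 : twist (0 : tfun C) = 0.
Proof. by apply/funext => t; rewrite /twist -[X in X ^+ q]/(0 : C) frobq0. Qed.

Lemma Ztriv_tau f : Ztriv C Sigma f -> Ztriv C Sigma (tauS Sigma f).
Proof.
move=> Zf; rewrite Ztriv_tauS //; case: Zf => [N [g [hg ->]]].
rewrite (big_morph _ twistD twist0) mulr_sumr; apply: Ztriv_sum => n _.
rewrite -Ztriv_tauS; last exact: Ztriv_gen (hg n).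
exact: Ztriv_gen (Ztriv_n_tau (hg n)).
Qed.

Variables (HZ : is_subring (Zempty C)) (HM : submod_over (Zempty C) (Ztriv C Sigma)).
Notation ZR := (Zempty_ring HZ).
Notation TM := (Ztriv_mod HZ HM).

Definition mkZ z (Zz : Zempty C z) : ZR := @Subring _ _ HZ z (mem_set Zz).
Definition mkT f (Zf : Ztriv C Sigma f) : TM := @Submod _ _ HZ _ HM f (mem_set Zf).

Lemma valZP (z : ZR) : Zempty C (val z).
Proof. by apply: set_mem; apply: (valP z). Qed.
Lemma valTP (f : TM) : Ztriv C Sigma (val f).
Proof. by apply: set_mem; apply: (valP f). Qed.

Lemma TM_ext (f g : TM) : (forall i, val f (pt i) = val g (pt i)) -> f = g.
Proof.
have [Nf _ _] := Ztriv_interpolable (valTP f); have [Ng _ _] := Ztriv_interpolable (valTP g).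
by move=> h; apply: val_inj; apply: newton_series_ext.
Qed.

Lemma TM_sumE (I : Type) (r : seq I) (P : pred I) (h : I -> TM) t :
  val (\sum_(i <- r | P i) h i) t = \sum_(i <- r | P i) val (h i) t.
Proof. by apply: (big_morph (fun g : TM => val g t)). Qed.

Lemma TM_scaleE (z : ZR) (f : TM) : val (z *: f) = val z * val f.
Proof. by []. Qed.
Lemma TM_linE (z : ZR) (f g : TM) : val (z *: f + g) = val z * val f + val g.
Proof. by []. Qed.

Definition kZ (k : {fraction {poly F}}) : ZR :=
  mkZ (@Zempty_K R F C (Cemb C k) (ex_intro _ k erefl)).

Definition tauT (f : TM) : TM := mkT (Ztriv_tau (valTP f)).

Lemma tauTD (f g : TM) : tauT (f + g) = tauT f + tauT g.
Proof.
apply: val_inj => /=; rewrite !Ztriv_tauS; try exact: valTP.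
  by rewrite twistD mulrDr.
by apply: ZtrivD; exact: valTP.
Qed.

Lemma tauTZ k (f : TM) : tauT (kZ k *: f) = kZ (qfrob k) *: tauT f.
Proof.
apply: val_inj => /=; rewrite !Ztriv_tauS; try exact: valTP.
  by rewrite twistM mulrCA; congr (_ * _); apply/funext => t; rewrite twist_cst /= /qfrob rmorphXn.
by apply: ZtrivM; [exact: Zempty_K (ex_intro _ k erefl)|exact: valTP].
Qed.

Definition actT (p : Ktau F) (f : TM) : TM :=
  \sum_(i < size (p : {poly _})) kZ (p : {poly _})`_i *: iter i tauT f.

Lemma kZ0 : kZ 0 = 0.
Proof. by apply: val_inj; apply/funext => t; rewrite /= rmorph0. Qed.
Lemma kZD k k' : kZ (k + k') = kZ k + kZ k'.
Proof. by apply: val_inj; apply/funext => t; rewrite /= rmorphD. Qed.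
Lemma kZM k k' : kZ (k * k') = kZ k * kZ k'.
Proof. by apply: val_inj; apply/funext => t; rewrite /= rmorphM. Qed.
Lemma kZ1 : kZ 1 = 1.
Proof. by apply: val_inj; apply/funext => t; rewrite /= rmorph1. Qed.

Lemma iterTD i (f g : TM) : iter i tauT (f + g) = iter i tauT f + iter i tauT g.
Proof. by elim: i => // i IH; rewrite !iterS IH tauTD. Qed.
Lemma iterTZ i k (f : TM) : iter i tauT (kZ k *: f) = kZ (skew_iter (@qfrob F) i k) *: iter i tauT f.
Proof. by elim: i => // i IH; rewrite !iterS IH tauTZ. Qed.

Lemma actTE n (p : {poly {fraction {poly F}}}) (f : TM) : (size p <= n)%N ->
  actT p f = \sum_(i < n) kZ p`_i *: iter i tauT f.
Proof.
move=> pn; rewrite /actT (big_ord_widen n (fun i => kZ p`_i *: iter i tauT f) pn) big_mkcond.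
apply: eq_bigr => i _; case: ltnP => // h.
by rewrite nth_default // kZ0 scale0r.
Qed.

Lemma actTDr p : {morph actT p : f g / f + g}.
Proof.
move=> f g; rewrite /actT -big_split; apply: eq_bigr => i _ /=.
by rewrite iterTD scalerDr.
Qed.

Lemma actTDl (f : TM) : {morph actT^~ f : a b / a + b}.
Proof.
move=> a b; pose n := maxn (size (a : {poly _})) (size (b : {poly _})).
rewrite (@actTE n (_ + _)) ?size_polyD // (@actTE n a) ?leq_maxl // (@actTE n b) ?leq_maxr //.
by rewrite -big_split; apply: eq_bigr => i _ /=; rewrite coefD kZD scalerDl.
Qed.

Lemma actT_mono k i (f : TM) : actT (k *: 'X^i : {poly {fraction {poly F}}}) f = kZ k *: iter i tauT f.
Proof.
rewrite (@actTE i.+1); last by rewrite (leq_trans (size_scale_leq _ _)) // size_polyXn.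
rewrite big_ord_recr /= coefZ coefXn eqxx mulr1 big1 ?add0r // => j _.
by rewrite coefZ coefXn ltn_eqF // mulr0 kZ0 scale0r.
Qed.

Lemma actT0l (f : TM) : actT 0 f = 0.
Proof. by rewrite (@actTE 0 0) ?size_poly0 // big_ord0. Qed.

Lemma actT0r p : actT p 0 = 0.
Proof. by apply: (addrI (actT p 0)); rewrite -actTDr !addr0. Qed.

Lemma actTM a b (f : TM) : actT a (actT b f) = actT (a * b) f.
Proof.
elim/skew_ind: a => [|p1 p2 IH1 IH2|k i].
- by rewrite mul0r !actT0l.
- by rewrite mulrDl !actTDl IH1 IH2.
elim/skew_ind: b => [|p1 p2 IH1 IH2|k' i'].
- by rewrite mulr0 !actT0l actT0r.
- by rewrite mulrDr !actTDl actTDr IH1 IH2.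
rewrite -[X in _ = actT X f]/(skew_mul _ _) skew_mul_mono map_polyZ map_polyXn.
rewrite -scalerAl -exprD scalerA !actT_mono iterTZ scalerA -kZM.
by rewrite addnC iterD.
Qed.

Lemma actT_structure : is_Ktau_structure (HM := HM) (HZ := HZ) actT.
Proof.
split; first split; [exact: actTM| |exact: actTDr|exact: actTDl| |].
- move=> f; have -> : (1 : Ktau F) = (1 *: 'X^0 : {poly {fraction {poly F}}}).
    by rewrite scale1r expr0.
  by rewrite actT_mono kZ1 scale1r.
- move=> k f; have -> : skewC (@qfrob F) k = (k *: 'X^0 : {poly {fraction {poly F}}}).
    by rewrite expr0 /skewC -mul_polyC mulr1.
  by rewrite actT_mono.
move=> f; have -> : skewX (@qfrob F) = (1 *: 'X^1 : {poly {fraction {poly F}}}).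
  by rewrite scale1r expr1.
by rewrite actT_mono kZ1 scale1r.
Qed.

Lemma act_iter act k (f : TM) : is_Ktau_structure (HM := HM) (HZ := HZ) act ->
  val (act (skewX _ ^+ k) f) = iter k (tauS Sigma) (val f).
Proof.
move=> [[aM a1 _ _] _ aX]; elim: k => [|k IH]; first by rewrite expr0 a1.
by rewrite exprS -aM iterS -IH; apply: aX.
Qed.
End OneSigma.
End Trivial.

(** * Free generation in one variable *)

Section Free.
Variables (R : realType) (F : finFieldType) (C : Cinfty R F).
Notation io := (embC C).
Notation io_inj := (@io_inj R F C).
Notation DD := (carlitz_D io).
Variable j : posnat.
Notation S1 := [fset j]%fset.
Variables (HZ : is_subring (Zempty C)) (HM : submod_over (Zempty C) (Ztriv C S1)).
Notation ZR := (Zempty_ring HZ).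
Notation TM := (Ztriv_mod HZ HM).

Let one := fset1_lt_q F j.

Definition pt1 k : posnat -> C := theta_pt C (fun _ : S1 => k).

Lemma pt1E (i : S1 -> nat) : theta_pt C i = pt1 (i (Sub j (fset11 j))).
Proof. by congr theta_pt; apply/funext => i'; rewrite (fset1P i'). Qed.

Lemma psi_pt1 k i : psi j k (pt1 i) = if i == k then DD k else 0.
Proof. by apply: psi_val; rewrite /pt1 (theta_ptE C _ (Sub j (fset11 j))). Qed.

Lemma psi_entire k : entire S1 (psi j k : tfun C).
Proof.
apply: sentire_entire; have := @sentire_prod R F C S1 1 (fun _ => psi j k).
have -> : (cst 1 : tfun C) * \prod_(i : S1) psi j k = psi j k.
  apply/funext => t; rewrite -[LHS]/(1 * (\prod_(i : S1) psi j k) t) mul1r tprodE.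
  by rewrite (prod1 (fun=> psi j k t)).
by apply => i; rewrite (fset1P i); apply: entire_psi.
Qed.

Lemma iter_tauS_psi k : iter k (tauS S1) (zeta1 j : tfun C) = psi j k.
Proof. by elim: k => // k IH; rewrite iterS IH tauS_twist //; apply: psi_entire. Qed.

Lemma Ztriv_zeta1 : Ztriv C S1 (zeta1 j).
Proof.
apply: (@Ztriv_gen _ _ _ _ 1); split; first exact: Zn_zeta1.
apply: (@finite_supp _ _ _ _ _ 1) => i; rewrite pt1E -[zeta1 j]/(psi j 0) psi_pt1 => h i'.
by move: h; rewrite (fset1P i'); case: eqP => [->|].
Qed.

Section Gen.
Variables (act : Ktau F -> TM -> TM) (z : TM).
Hypotheses (actS : is_Ktau_structure act) (zE : Ztriv_val z = zeta1 j).

Lemma act_val k : val (act (skewX _ ^+ k) z) = psi j k.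
Proof. by rewrite (act_iter _ _ actS) -iter_tauS_psi; congr iter. Qed.

(** Evaluation at theta^(q^i) isolates the coefficient of psi_i. *)
Lemma comb_val (g : {fsfun nat -> ZR with 0}) i :
  val (\sum_(k <- finsupp g) g k *: act (skewX _ ^+ k) z) (pt1 i) = val (g i) (pt1 i) * DD i.
Proof.
rewrite TM_sumE.
have E k : val (g k *: act (skewX _ ^+ k) z) (pt1 i) = val (g k) (pt1 i) * (if i == k then DD k else 0).
  by rewrite TM_scaleE act_val -psi_pt1.
under eq_bigr => k _ do rewrite E.
have [ig|] := boolP (i \in finsupp g).
  rewrite (big_fsetD1 i) //= eqxx big1_seq ?addr0 // => k /andP[_].
  by rewrite !inE eq_sym => /andP[/negbTE -> _]; rewrite mulr0.
move=> ig; rewrite big1_seq => [|k /andP[_ kg]].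
  by move: ig; rewrite memNfinsupp => /eqP ->; rewrite mul0r.
by case: eqP => [ik|_]; rewrite ?mulr0 //; case/negP: ig; rewrite ik.
Qed.

Lemma psi_basis (f : TM) : exists! g : {fsfun nat -> ZR with 0},
  f = \sum_(k <- finsupp g) g k *: act (skewX _ ^+ k) z.
Proof.
have [_ [M sM] Zf] := Ztriv_interpolable one (valTP f).
have Zg k : Zempty C (cst (val f (pt1 k) / DD k) : tfun C).
  apply: is_mzvM; first exact: Zf.
  by apply: is_mzvK; apply/in_KV/in_K_carlitz_D.
pose g : {fsfun nat -> ZR with 0} := [fsfun k in [fset k in iota 0 M]%fset => mkZ HZ (Zg k)].
have gE i : val (g i) (pt1 i) * DD i = val f (pt1 i).
  rewrite /g fsfunE !inE mem_iota /=; case: ltnP => iM.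
    by rewrite /= divfK // (carlitz_D_neq0 io_inj).
  rewrite -[X in X * _]/(0 : C) mul0r.
  apply/esym/eqP/negPn/negP => /eqP/sM/(_ (Sub j (fset11 j))).
  by rewrite ltnNge iM.
exists g; split=> [|g' fE].
  by apply: (TM_ext one) => i; rewrite pt1E comb_val gE.
apply/fsfunP => i; apply: val_inj; apply/funext => t.
have h1 := gE i; rewrite fE comb_val in h1.
have dd := carlitz_D_neq0 io_inj i.
have h2 := mulIf dd h1.
rewrite (Zempty_cst t (pt1 i) (valZP (g i))) h2.
by rewrite (Zempty_cst (pt1 i) t (valZP (g' i))).
Qed.
End Gen.
End Free.

(** * The tensor product *)

Section MultiLin.
Variables (A : comPzRingType) (I : finType) (M : I -> lmodType A) (V : lmodType A).
Variable (D : (forall i, M i) -> V).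
Hypothesis Dlin : multilinear D.

Lemma multilinear0 x i : D (dfwith x i 0) = 0.
Proof.
have := Dlin x (i := i) 1 0 0; rewrite !scale1r addr0 => /eqP.
by rewrite -subr_eq0 opprD addrA subrr sub0r oppr_eq0 => /eqP.
Qed.

Lemma multilinear_sum x i n (c : nat -> A) (y : nat -> M i) :
  D (dfwith x i (\sum_(k < n) c k *: y k)) = \sum_(k < n) c k *: D (dfwith x i (y k)).
Proof.
elim: n => [|n IH]; first by rewrite !big_ord0 multilinear0.
by rewrite !big_ord_recr /= addrC Dlin IH addrC.
Qed.

Lemma dfwith_id (x : forall i, M i) i : dfwith x i (x i) = x.
Proof. by apply: functional_extensionality_dep => k; case: dfwithP. Qed.

(** The arguments are replaced by generators one position at a time; in the proof, s
    lists the positions that remain. *)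
Lemma multilinear_ext (b : forall i, nat -> M i) :
  (forall i (x : M i), exists n (c : nat -> A), x = \sum_(k < n) c k *: b i k) ->
  (forall m : I -> nat, D (fun i => b i (m i)) = 0) -> forall x, D x = 0.
Proof.
move=> gen Db.
suff H (s : seq I) x : (forall i, i \notin s -> exists k, x i = b i k) -> D x = 0.
  by move=> x; apply: (H (enum I)) => i; rewrite mem_enum.
elim: s x => [|i s IH] x hx.
  have [m hm] := choice (fun i => hx i isT).
  by rewrite (_ : x = fun i => b i (m i)) //; apply: functional_extensionality_dep.
have [n [c xE]] := gen i (x i).
rewrite -(dfwith_id x i) xE multilinear_sum big1 // => k _; rewrite IH ?scaler0 // => i' i's.
have [->|ii'] := eqVneq i' i; first by exists k; rewrite dfwithin.
rewrite dfwithout 1?eq_sym //; apply: hx.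
by rewrite inE negb_or ii'.
Qed.
End MultiLin.

Section Tensor.
Variables (R : realType) (F : finFieldType) (C : Cinfty R F).
Notation q := #|F|.
Notation io := (embC C).
Notation io_inj := (@io_inj R F C).
Notation DD := (carlitz_D io).
Variable Sigma : {fset posnat}.
Hypothesis Sq : (#|` Sigma| < q)%N.
Variables (HZ : is_subring (Zempty C)) (HM : submod_over (Zempty C) (Ztriv C Sigma)).
Variable (H1 : forall i : Sigma, submod_over (Zempty C) (Ztriv C [fset val i]%fset)).
Notation ZR := (Zempty_ring HZ).
Notation TM := (Ztriv_mod HZ HM).
Notation T1 := (fun i : Sigma => Ztriv_mod HZ (H1 i)).
Notation pt := (theta_pt C (Sigma := Sigma)).

Definition dual1 (j : posnat) k : tfun C := (cst (DD k)^-1 : tfun C) * psi j k.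

Lemma dual1_pt j k i : dual1 j k (pt1 C j i) = (i == k)%:R.
Proof.
rewrite -[LHS]/((DD k)^-1 * psi j k (pt1 C j i)) psi_pt1.
by case: eqP => _; rewrite ?mulr0 // mulVf // (carlitz_D_neq0 io_inj).
Qed.

Lemma Ztriv_dual1 j k : Ztriv C [fset j]%fset (dual1 j k).
Proof.
apply: (@Ztriv_gen _ _ _ _ (q ^ k)); split.
  by apply: ZnZ; [exact: fset1_lt_q|apply/in_KV/in_K_carlitz_D|exact: Zn_psi].
apply: (@finite_supp _ _ _ _ _ k.+1) => i; rewrite pt1E dual1_pt => h i'.
by move: h; rewrite (fset1P i'); case: eqP => [->|].
Qed.

Definition dual1T (i : Sigma) k : T1 i := mkT HZ (H1 i) (Ztriv_dual1 (val i) k).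

(** The coefficients are the values of x at the points theta^(q^k). *)
Lemma dual1T_gen (i : Sigma) (x : T1 i) : exists n (c : nat -> ZR), x = \sum_(k < n) c k *: dual1T i k.
Proof.
have [_ [M sM] Zx] := Ztriv_interpolable (fset1_lt_q F _) (valTP x).
exists M, (fun k => mkZ HZ (Zx (fun=> k))).
apply: (TM_ext (fset1_lt_q F _)) => i'; rewrite TM_sumE pt1E.
set k := i' _.
have E (l : nat) : val (mkZ HZ (Zx (fun=> l)) *: dual1T i l) (pt1 C (val i) k) = val x (pt1 C (val i) l) * (k == l)%:R.
  by rewrite TM_scaleE -(dual1_pt (val i)).
under eq_bigr => l _ do rewrite E.
have [kM|Mk] := ltnP k M.
  rewrite (bigD1 (Ordinal kM)) //= eqxx mulr1 big1 ?addr0 // => l lk.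
  by rewrite (_ : (k == l) = false) ?mulr0 //; apply: contraNF lk => /eqP kl; apply/eqP/val_inj.
rewrite big1 => [|l _]; last first.
  by rewrite (_ : (k == l) = false) ?mulr0 // gtn_eqF // (leq_trans (ltn_ord l)).
apply/eqP/negPn/negP => /eqP/sM/(_ (Sub (val i) (fset11 (val i)))).
by rewrite ltnNge Mk.
Qed.

Lemma prod_dual1 (m : Sigma -> nat) : \prod_(i : Sigma) dual1 (val i) (m i) = dual_mzv m.
Proof.
apply/funext => t; rewrite tprodE -[RHS]/(dual_cst C m * (\prod_(j : Sigma) psi (val j) (m j)) t) tprodE.
by rewrite /dual_cst -big_split.
Qed.

Definition prod_val (x : forall i, T1 i) : tfun C := \prod_(i : Sigma) val (x i).

Lemma prod_sum_Ztriv (n : Sigma -> nat) (c : Sigma -> nat -> tfun C) :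
  (forall i k, Zempty C (c i k)) ->
  Ztriv C Sigma (\prod_(i : Sigma) \sum_(k < n i) c i k * dual1 (val i) k).
Proof.
move=> Zc; pose M := (\max_i n i)%N.
pose d i k := if (k < n i)%N then c i k else 0.
have -> : \prod_(i : Sigma) \sum_(k < n i) c i k * dual1 (val i) k =
    \prod_(i : Sigma) \sum_(k < M) d i k * dual1 (val i) k.
  apply: eq_bigr => i _; have nM : (n i <= M)%N by apply: leq_bigmax.
  rewrite (big_ord_widen M (fun k => c i k * dual1 (val i) k) nM) big_mkcond.
  by apply: eq_bigr => k _; rewrite /d; case: ifP => _; rewrite ?mul0r.
rewrite bigA_distr_bigA; apply: Ztriv_sum => // m _; rewrite big_split /=.
apply: ZtrivM => //.
  elim/big_ind: _ => [||i _]; [by case: HZ|exact: ZemptyM|].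
  by rewrite /d; case: ifP => _; [exact: Zc|exact: Zempty0].
by rewrite (prod_dual1 (fun i => m i)); apply: Ztriv_dual.
Qed.

(** Trivial multiple zeta values in one variable are combinations of the dual1,
    whose products over the variables are the dual elements for Sigma. *)
Lemma Ztriv_prod_val x : Ztriv C Sigma (prod_val x).
Proof.
have [n hn] := choice (fun i => dual1T_gen (x i)).
have hn' i : exists c : nat -> tfun C, (forall k, Zempty C (c k)) /\
    val (x i) = \sum_(k < n i) c k * dual1 (val i) k.
  have [c ->] := hn i; exists (fun k => val (c k)); split=> [k|]; first exact: valZP.
  apply/funext => t; rewrite TM_sumE tsumE; apply: eq_bigr => k _.
  by rewrite TM_scaleE.
have [c hc] := choice hn'.
rewrite /prod_val (eq_bigr _ (fun i _ => (hc i).2)); apply: prod_sum_Ztriv => i k.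
exact: (hc i).1.
Qed.

(** The tensor product is realized by the module of trivial multiple zeta values
    itself, with multiplication of functions. *)
Definition tensor_map (x : forall i, T1 i) : TM := mkT HZ HM (Ztriv_prod_val x).

Lemma tensor_map_multilinear : multilinear tensor_map.
Proof.
move=> x i a u v; apply: val_inj => /=; rewrite /prod_val.
rewrite -[RHS]/(val a * \prod_(j : Sigma) val (dfwith x i u j) + \prod_(j : Sigma) val (dfwith x i v j)).
rewrite !(bigD1 (P := predT) i) //= !dfwithin.
have E (w : T1 i) : \prod_(j | j != i) val (dfwith x i w j) = \prod_(j | j != i) val (x j).
  by apply: eq_bigr => j ji; rewrite dfwithout // eq_sym.
by rewrite !E TM_linE mulrDl mulrA.
Qed.

Lemma tensor_map_dual1T (m : Sigma -> nat) : val (tensor_map (fun i => dual1T i (m i))) = dual_mzv m.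
Proof. exact: prod_dual1. Qed.

Lemma Zcoef_subproof (f : TM) (m : Sigma -> nat) : Zempty C (cst (val f (pt m)) : tfun C).
Proof. by have [_ _ Zf] := Ztriv_interpolable Sq (valTP f); apply: Zf. Qed.

Definition Zcoef f m : ZR := mkZ HZ (@Zcoef_subproof f m).

Lemma TM_supp (f : TM) : exists M, supp_in Sigma (val f) M.
Proof. by have [_ sM _] := Ztriv_interpolable Sq (valTP f). Qed.

Lemma TM_decomp (f : TM) M : supp_in Sigma (val f) M ->
  f = \sum_(m : {ffun Sigma -> 'I_M}) Zcoef f (box_fun m) *: tensor_map (fun i => dual1T i (box_fun m i)).
Proof.
move=> sM; apply: val_inj; have [Nf _ _] := Ztriv_interpolable Sq (valTP f).
rewrite [LHS](dual_decomposition Sq Nf sM) (big_morph (fun y : TM => val y) (id1 := 0) (op1 := +%R)) //.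
by apply: eq_bigr => m _; rewrite -tensor_map_dual1T.
Qed.

Section Universal.
Variables (V : lmodType ZR) (ps : (forall i, T1 i) -> V).
Hypothesis ps_mlin : multilinear ps.

Definition hbox (f : TM) M : V :=
  \sum_(m : {ffun Sigma -> 'I_M}) Zcoef f (box_fun m) *: ps (fun i => dual1T i (box_fun m i)).

Lemma hbox_indep f M M' : supp_in Sigma (val f) M -> supp_in Sigma (val f) M' -> hbox f M = hbox f M'.
Proof.
move=> sM sM'; apply: (box_sum_indep (G := fun m => Zcoef f m *: ps (fun i => dual1T i (m i)))) => i h.
  by apply: sM => f0; apply: h; rewrite (_ : Zcoef f i = 0) ?scale0r //; apply: val_inj; rewrite /= f0.
by apply: sM' => f0; apply: h; rewrite (_ : Zcoef f i = 0) ?scale0r //; apply: val_inj; rewrite /= f0.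
Qed.

(** The factorization of ps through tensor_map is forced on the dual basis; any box
    containing the support of f gives the same value ([tensor_liftE]). *)
Definition tensor_lift (f : TM) : V := hbox f (projT1 (cid (TM_supp f))).

Lemma tensor_liftE f M : supp_in Sigma (val f) M -> tensor_lift f = hbox f M.
Proof. by move=> sM; apply: hbox_indep => //; case: cid. Qed.

Lemma tensor_lift_lin : linear tensor_lift.
Proof.
move=> a f g; have [M sf] := TM_supp f; have [M' sg] := TM_supp g.
have sf' := supp_in_weaken (leq_maxl M M') sf; have sg' := supp_in_weaken (leq_maxr M M') sg.
have sfg : supp_in Sigma (val (a *: f + g)) (maxn M M').
  move=> i; rewrite TM_linE -[(_ + _) _]/(val a (pt i) * val f (pt i) + val g (pt i)) => h.
  have [f0|/eqP f0] := eqVneq (val f (pt i)) 0; last exact: sf'.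
  by apply: sg' => g0; apply: h; rewrite f0 g0 mulr0 addr0.
rewrite (tensor_liftE sf') (tensor_liftE sg') (tensor_liftE sfg) /hbox scaler_sumr -big_split.
apply: eq_bigr => m _ /=; rewrite scalerA -scalerDl; congr (_ *: _).
apply: val_inj; apply/funext => t.
rewrite -[LHS]/(val (a *: f + g) (pt (box_fun m))) TM_linE.
rewrite -[LHS]/(val a (pt (box_fun m)) * val f (pt (box_fun m)) + val g (pt (box_fun m))).
rewrite rmorphD rmorphM -[RHS]/(val a t * val f (pt (box_fun m)) + val g (pt (box_fun m))).
by rewrite (Zempty_cst t (pt (box_fun m)) (valZP a)).
Qed.

HB.instance Definition _ := GRing.isLinear.Build ZR TM V _ tensor_lift tensor_lift_lin.

Lemma tensor_lift_dual1T (m : Sigma -> nat) : tensor_lift (tensor_map (fun i => dual1T i (m i))) = ps (fun i => dual1T i (m i)).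
Proof.
set f := tensor_map _; have fE i : val f (pt i) = (i == m :> (Sigma -> nat))%:R by rewrite tensor_map_dual1T dual_mzv_val.
have sM : supp_in Sigma (val f) (\sum_j m j).+1.
  move=> i; rewrite fE => h j; have -> : i = m by case: eqP h.
  by rewrite ltnS (bigD1 j) //= leq_addr.
rewrite (tensor_liftE sM) /hbox.
rewrite (eq_bigr (fun n : {ffun Sigma -> 'I__} => if m == box_fun n then ps (fun i => dual1T i (m i)) else 0)).
  apply: (box_sum (G := fun m => ps (fun i => dual1T i (m i)))) => _ j.
  by rewrite ltnS (bigD1 j) //= leq_addr.
move=> n _; have -> : Zcoef f (box_fun n) = (m == box_fun n)%:R.
  apply: val_inj; apply/funext => t; rewrite -[LHS]/(val f (pt (box_fun n))) fE eq_sym.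
  by case: eqP.
case: eqP => [mn|_]; last by rewrite scale0r.
by rewrite scale1r -mn.
Qed.

Lemma tensor_lift_map x : tensor_lift (tensor_map x) = ps x.
Proof.
apply/eqP; rewrite -subr_eq0; apply/eqP.
apply: (multilinear_ext (D := fun x => tensor_lift (tensor_map x) - ps x) _ dual1T_gen) => [x' i a u v|m].
  by rewrite tensor_map_multilinear ps_mlin linearP scalerBr opprD addrACA.
by rewrite tensor_lift_dual1T subrr.
Qed.

Lemma tensor_lift_uniq (h' : {linear TM -> V}) : (forall x, h' (tensor_map x) = ps x) -> h' =1 tensor_lift.
Proof.
move=> hh f; have [M sM] := TM_supp f.
rewrite (tensor_liftE sM) {1}(TM_decomp sM) linear_sum; apply: eq_bigr => m _.
by rewrite linearZ hh.
Qed.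
End Universal.

Lemma tensor_map_is_tensor_product : is_tensor_product tensor_map.
Proof.
split; first exact: tensor_map_multilinear.
move=> V ps ps_mlin; exists (tensor_lift ps : {linear TM -> V}); first exact: tensor_lift_map.
by move=> h' hh; apply: tensor_lift_uniq.
Qed.
End Tensor.

Theorem theoremC (R : realType) (F : finFieldType) (C : Cinfty R F)
    (Sigma : {fset posnat}) (hSigma : (#|` Sigma| < #|F|)%N) :
  exists (HZ : is_subring (Zempty C))
         (HM : submod_over (Zempty C) (Ztriv C Sigma))
         (H1 : forall i : Sigma, submod_over (Zempty C) (Ztriv C [fset val i]%fset)),
  [/\ exists act : Ktau F -> Ztriv_mod HZ HM -> Ztriv_mod HZ HM,
        is_Ktau_structure act /\
        (forall (n : nat) (f : Ztriv_mod HZ HM),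
          Ztriv_n C Sigma n (Ztriv_val f) ->
          Ztriv_n C Sigma (#|F| * n) (Ztriv_val (act (skewX _) f))),
      exists (T : lmodType (Zempty_ring HZ))
             (phi : (forall i : Sigma, Ztriv_mod HZ (H1 i)) -> T)
             (h : {linear Ztriv_mod HZ HM -> T}),
        is_tensor_product phi /\ bijective h
    & forall i : Sigma,
        exists (act : Ktau F -> Ztriv_mod HZ (H1 i) -> Ztriv_mod HZ (H1 i))
               (z : Ztriv_mod HZ (H1 i)),
          [/\ is_Ktau_structure act,
              Ztriv_val z = zetaA C [:: (charmap [fset val i]%fset, 1%N)]
            & forall f : Ztriv_mod HZ (H1 i),
                exists! g : {fsfun nat -> Zempty_ring HZ with 0},
                  f = \sum_(k <- finsupp g) g k *: act (skewX _ ^+ k) z]].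
Proof.
have HZ := Zempty_subring C; have HM := Ztriv_submod C hSigma.
have H1 (i : Sigma) := Ztriv_submod C (fset1_lt_q F (val i)).
exists HZ, HM, H1; split.
- exists (actT hSigma (HZ := HZ) (HM := HM)); split; first exact: actT_structure.
  move=> n f hf; have [_ _ aX] := actT_structure hSigma HZ HM.
  by rewrite aX; apply: Ztriv_n_tau.
- exists (Ztriv_mod HZ HM), (@tensor_map R F C Sigma hSigma HZ HM H1), (idfun : {linear _ -> _}).
  by split; [exact: tensor_map_is_tensor_product|exists idfun].
move=> i; have one := fset1_lt_q F (val i).
exists (actT one (HZ := HZ) (HM := H1 i)), (mkT HZ (H1 i) (Ztriv_zeta1 C (val i))).
split=> //; first exact: actT_structure.
by move=> f; apply: psi_basis => //; apply: actT_structure.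
Qed.
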